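(* Let $g\in L^\infty$ and let $k$ be a maximal vector for $\ker T_g$. Then for every nonconstant inner function $\psi$ and every $h_+\in\mathcal{G}H^\infty$, $h_-\in\mathcal{G}\overline{H^\infty}$, the function $h_+^{-1}(k\circ\psi)$ is a maximal vector for $\ker T_{\overline{z}\psi h_-(g\circ\psi)h_+}=h_+^{-1}\ker T_{\overline{z}\psi(g\circ\psi)}$. That is, $$\mathrm{K}_{\min}\big(h_+^{-1}(k\circ\psi)\big)=\ker T_{\overline{z}\psi h_-(g\circ\psi)h_+}=h_+^{-1}\ker T_{\overline{z}\psi(g\circ\psi)}.$$
   Context: $\mathbb{T}$ is the unit circle with normalized Lebesgue measure, $L^\infty=L^\infty(\mathbb{T})$, $H^2$ is the Hardy space of the unit disc $\mathbb{D}$, regarded as a closed subspace of $L^2(\mathbb{T})$ via boundary values, and $H^\infty$ is the algebra of bounded analytic functions on $\mathbb{D}$; $\overline{H^\infty}$ is the set of complex conjugates of (boundary functions of) elements of $H^\infty$. $\mathcal{G}H^\infty$ and $\mathcal{G}\overline{H^\infty}$ denote the sets of invertible elements of these algebras. For $g\in L^\infty$, $T_g:H^2\to H^2$, $T_gf=P_{H^2}(gf)$ with $P_{H^2}:L^2(\mathbb{T})\to H^2$ the orthogonal projection. For an inner function $\psi$, $g\circ\psi$ is the composition of $g$ with the boundary function of $\psi$, and $z$ in symbols denotes the identity function on $\mathbb{T}$. For $k\in H^2\setminus\{0\}$, $\mathrm{K}_{\min}(k)$ denotes the minimal Toeplitz kernel containing $k$: $\mathrm{K}_{\min}(k)=\ker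 T_f$ for some $f\in L^\infty$, $k\in\ker T_f$, and $\ker T_f\subseteq\ker T_h$ for every $h\in L^\infty$ with $k\in\ker T_h$. $k$ is a maximal vector for $\ker T_g$ if $\mathrm{K}_{\min}(k)=\ker T_g$. In this statement $g$ is not the zero function. *)

(* Defs.v *)
From HB Require Import structures.
From mathcomp Require Import all_boot all_order all_algebra.
From mathcomp Require Import complex.
From mathcomp Require Import all_classical all_reals all_analysis.
Set Implicit Arguments.
Unset Strict Implicit.
Unset Printing Implicit Defensive.
Import Order.TTheory GRing.Theory Num.Theory.
Import numFieldNormedType.Exports.
Local Open Scope classical_set_scope.
Local Open Scope complex_scope.
Local Open Scope ring_scope.

Definition circle (R : realType) : Type := {z : R[i] | `|z| == 1}.

Section Hardy.
Context {R : realType}.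
Local Notation C := R[i].
Local Notation T := (circle R).
Local Notation leb := (@lebesgue_measure R).

Lemma cis_subproof (t : R) : `|cos t +i* sin t| == 1 :> C.
Proof. by rewrite eq_complex /= cos2Dsin2 sqrtr1 !eqxx. Qed.

Definition cis (t : R) : T := exist _ (cos t +i* sin t) (cis_subproof t).

Definition angles : set R := `[0, 2 * pi]%classic.

(* Elements of $L^p$ of the circle are represented by Borel functions; a class
   modulo null sets always has such a representative. All the sets of functions
   below are closed under almost everywhere equality of Borel functions. *)
Definition borel (f : T -> C) : Prop :=
  measurable_fun setT (fun t : R => complex.Re (f (cis t))) /\
  measurable_fun setT (fun t : R => complex.Im (f (cis t))).

Definition aeT (P : T -> Prop) : Prop :=
  {ae leb, forall t : R, angles t -> P (cis t)}.

Definition eqT (f g : T -> C) : Prop := aeT (fun z => f z = g z).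

Definition Linf : set (T -> C) :=
  [set f | borel f /\ exists M : R, aeT (fun z => `|f z| <= M%:C)].

Definition inner_prod (u v : T -> C) : C :=
  let w t := u (cis t) * (v (cis t))^* in
  ((2 * pi)^-1)%:C *
    ((\int[leb]_(t in angles) complex.Re (w t))%R +i*
     (\int[leb]_(t in angles) complex.Im (w t))%R).

(* Functions on the disc are total; only their values on $|z| < 1$
   matter. Analyticity in the disc is expansion in a power series at 0. *)
Definition analytic_disc (F : C -> C) : Prop :=
  exists a : nat -> C, forall z : C, `|z| < 1 ->
    series (fun n => a n * z ^+ n : C^o) @ \oo --> (F z : C^o).

Definition boundary_function (F : C -> C) (f : T -> C) : Prop :=
  borel f /\
  aeT (fun z => (F (r%:C * sval z) : C^o) @[r --> (1 : R)^'-] --> (f z : C^o)).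

Definition bounded_means (F : C -> C) : Prop :=
  exists M : R, forall r : R, 0 <= r < 1 ->
    (\int[leb]_(t in angles)
       ((Normc.normc (F (r%:C * sval (cis t))) ^+ 2)%:E) <= M%:E)%E.

Definition H2 : set (T -> C) :=
  [set f | exists F, [/\ analytic_disc F, bounded_means F
                       & boundary_function F f]].

Definition Hinf : set (T -> C) :=
  [set f | exists F, [/\ analytic_disc F,
      exists M : R, forall z : C, `|z| < 1 -> `|F z| <= M%:C
    & boundary_function F f]].

Definition conj_set (A : set (T -> C)) : set (T -> C) :=
  [set f | exists2 h, A h & f = fun z => (h z)^*].

Definition invertible_in (A : set (T -> C)) : set (T -> C) :=
  [set h | A h /\ exists2 h', A h' & eqT (fun z => h z * h' z) (fun=> 1)].

(* The boundary function of an inner function has unimodular values almost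
   everywhere; the representative is taken with values in the circle. *)
Definition inner_function (psi : T -> T) : Prop :=
  Hinf (fun z => sval (psi z)).

Definition nonconstant (psi : T -> T) : Prop :=
  ~ exists c : C, eqT (fun z => sval (psi z)) (fun=> c).

(* [is_projH2 u v]: [v] is the orthogonal projection of [u] on $H^2$. *)
Definition is_projH2 (u v : T -> C) : Prop :=
  H2 v /\ forall w, H2 w -> inner_prod (fun z => u z - v z) w = 0.

(* The graph of $T_g$: [toeplitz g f v] means $T_g f = v$. *)
Definition toeplitz (g f v : T -> C) : Prop :=
  H2 f /\ is_projH2 (fun z => g z * f z) v.

Definition ker_toeplitz (g : T -> C) : set (T -> C) :=
  [set f | toeplitz g f (fun=> 0)].

(* [is_Kmin k S]: $S$ is the minimal Toeplitz kernel containing $k$. *)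
Definition is_Kmin (k : T -> C) (S : set (T -> C)) : Prop :=
  [/\ exists2 f, Linf f & S = ker_toeplitz f,
      S k
    & forall h, Linf h -> ker_toeplitz h k -> S `<=` ker_toeplitz h].

Definition maximal_vector (g k : T -> C) : Prop :=
  [/\ H2 k, ~ eqT k (fun=> 0) & is_Kmin k (ker_toeplitz g)].

(* The product $u S$, saturated modulo null sets: the pointwise image
   $\{u v : v \in S\}$ is not saturated if [u] vanishes somewhere. *)
Definition mul_set (u : T -> C) (S : set (T -> C)) : set (T -> C) :=
  [set f | borel f /\ exists2 v, S v & eqT f (fun z => u z * v z)].

End Hardy.

(* Main.v *)
(* Modulo null sets, [H2] consists of the square integrable functions whose
   negative Fourier coefficients vanish; this rests on Fatou's theorem on
   radial limits of Poisson integrals. Hence [k] lies in [ker T_g] iff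
   [g k = conj (z p)] with [p] in [H2], and then [k] is maximal iff [p] is
   outer, i.e. [u_n p] tends to [1] for some bounded analytic [u_n]. If [p] is
   outer and [k] also lies in [ker T_h], with [h k = conj (z q)], then for [f]
   in [ker T_g] the function [conj (z h f) p] is a product of two elements of
   [H2], and cancelling [p] puts [f] in [ker T_h]. Conversely, Beurling's
   extremal problem gives an inner [I] such that [p / I] is outer, and
   maximality of [k] makes [conj I] analytic.

   Since an inner [psi] distorts Lebesgue measure by at most a constant factor
   (compare the Poisson integrals of [u] and [u o psi]), composition with [psi]
   is bounded on [L2] and preserves [H2] and outer functions. The symbol
   [conj z psi (g o psi)] and the function [k o psi] therefore correspond to
   the outer function [p o psi], and the invertible factors [h_+], [h_-]
   multiply it by an invertible analytic function. *)

Require Import Defs.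
From HB Require Import structures.
From mathcomp Require Import all_boot all_order all_algebra.
From mathcomp Require Import complex.
From mathcomp Require Import all_classical all_reals all_analysis.
From mathcomp Require Import measurable_realfun.
From mathcomp Require Import ring lra.
Set Implicit Arguments.
Unset Strict Implicit.
Unset Printing Implicit Defensive.
Import Order.TTheory GRing.Theory Num.Theory.
Import numFieldNormedType.Exports.
Local Open Scope classical_set_scope.
Local Open Scope complex_scope.
Local Open Scope ring_scope.

(** [H2] is defined by power series, means and radial limits, whereas the arguments about kernels
    concern Fourier coefficients. Once [H2P] identifies [H2] with the predicate [an], only functions
    on the circle and their Poisson integrals occur. The main obstacle is composition. Functions are
    Borel representatives, and [u o psi] depends only on the class of [u] if [psi] pulls null sets
    back to null sets. Almost everywhere convergence of Poisson integrals cannot show this, since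
    its exceptional set would itself have to be pulled back. Hence the start with open sets, at
    whose interior points the Poisson integrals of the indicator converge without exception. The
    mean of [psi^n] is [a^n], where [a] is the mean of [psi]; since [psi] is not constant,
    [|a| < 1], and the summability of [|a|^n] yields the distortion constant. Outer regularity then
    reaches all measurable sets, and the resulting inequality between measures also bounds
    composition on [L2]. *)

#[local] Instance ae_leb_filter (R : realType) :
  Filter (almost_everywhere (@lebesgue_measure R)) := ae_filter_ringOfSetsType _.

(** * The modulus of a complex number as a real number *)

Section ComplexModulus.
Context {R : realType}.
Local Notation C := R[i].
Local Notation nm := (@Normc.normc R).
Local Notation Re := (@complex.Re R).
Local Notation Im := (@complex.Im R).

Lemma nm_ge0 z : 0 <= nm z.
Proof. by case: z => a b; rewrite /Normc.normc sqrtr_ge0. Qed.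

Lemma sqr_nm z : nm z ^+ 2 = Re z ^+ 2 + Im z ^+ 2.
Proof. by case: z => a b /=; rewrite sqr_sqrtr// addr_ge0 ?sqr_ge0. Qed.

Lemma normrE_nm z : `|z| = (nm z)%:C.
Proof. by case: z. Qed.

Lemma nmM z w : nm (z * w) = nm z * nm w.
Proof. exact: Normc.normcM. Qed.

Lemma nmX z n : nm (z ^+ n) = nm z ^+ n.
Proof.
by elim: n => [|n IH]; rewrite ?expr0 ?exprS ?nmM ?IH//; exact: Normc.normc1.
Qed.

Lemma nmD z w : nm (z + w) <= nm z + nm w.
Proof. exact: le_normcD. Qed.

Lemma nmN z : nm (- z) = nm z.
Proof. exact: normcN. Qed.

Lemma nmBC z w : nm (z - w) = nm (w - z).
Proof. by rewrite -nmN opprB. Qed.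

Lemma nmJ z : nm z^* = nm z.
Proof. by case: z => a b /=; rewrite sqrrN. Qed.

Lemma nm_realC (x : R) : nm x%:C = `|x|.
Proof. by rewrite /= expr0n addr0 sqrtr_sqr. Qed.

Lemma nm0 : nm 0 = 0. Proof. exact: Normc.normc0. Qed.
Lemma nm1 : nm 1 = 1. Proof. exact: Normc.normc1. Qed.

Lemma nm_eq0 z : nm z = 0 -> z = 0.
Proof. exact: Normc.eq0_normc. Qed.

Lemma nmV z : nm z^-1 = (nm z)^-1.
Proof. exact: Normc.normcV. Qed.

Lemma nm_sum (I : Type) (s : seq I) (P : pred I) (F : I -> C) :
  nm (\sum_(i <- s | P i) F i) <= \sum_(i <- s | P i) nm (F i).
Proof.
elim/big_ind2 : _ => //; first by rewrite nm0.
by move=> x a y b ha hb; rewrite (le_trans (nmD _ _))// lerD.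
Qed.

Lemma Re_le_nm z : `|Re z| <= nm z.
Proof.
by rewrite -ler_sqr ?nnegrE ?nm_ge0// sqr_nm real_normK ?num_real// lerDl sqr_ge0.
Qed.

Lemma Im_le_nm z : `|Im z| <= nm z.
Proof.
by rewrite -ler_sqr ?nnegrE ?nm_ge0// sqr_nm real_normK ?num_real// lerDr sqr_ge0.
Qed.

Lemma nm_le_ReIm z : nm z <= `|Re z| + `|Im z|.
Proof.
rewrite -ler_sqr ?nnegrE ?nm_ge0 ?addr_ge0// sqr_nm sqrrD !real_normK ?num_real//.
by rewrite lerD2r lerDl mulrn_wge0// mulr_ge0.
Qed.

Lemma mulJ_nm z : z * z^* = (nm z ^+ 2)%:C.
Proof.
by rewrite sqr_nm; case: z => a b; apply/eqP; rewrite eq_complex /=; apply/andP;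
  split; apply/eqP; ring.
Qed.

Lemma nm_distl z w : nm z - nm w <= nm (z - w).
Proof. by rewrite lerBlDr -{1}(subrK w z) nmD. Qed.

Lemma ReM z w : Re (z * w) = Re z * Re w - Im z * Im w.
Proof. by case: z; case: w. Qed.
Lemma ImM z w : Im (z * w) = Re z * Im w + Im z * Re w.
Proof. by case: z => a b; case: w => c d /=. Qed.
Lemma ReD z w : Re (z + w) = Re z + Re w. Proof. by case: z; case: w. Qed.
Lemma ImD z w : Im (z + w) = Im z + Im w. Proof. by case: z; case: w. Qed.
Lemma ReN z : Re (- z) = - Re z. Proof. by case: z. Qed.
Lemma ImN z : Im (- z) = - Im z. Proof. by case: z. Qed.
Lemma ReJ z : Re z^* = Re z. Proof. by case: z. Qed.
Lemma ImJ z : Im z^* = - Im z. Proof. by case: z. Qed.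

Lemma complex_ext (z w : C) : Re z = Re w -> Im z = Im w -> z = w.
Proof. by case: z => a b; case: w => c d /= -> ->. Qed.

Lemma ReV z : Re z^-1 = Re z * (nm z ^+ 2)^-1.
Proof. by rewrite sqr_nm; case: z => a b. Qed.
Lemma ImV z : Im z^-1 = - Im z * (nm z ^+ 2)^-1.
Proof. by rewrite sqr_nm; case: z => a b /=; rewrite mulNr. Qed.

Lemma conjcX (z : C) n : (z ^+ n)^* = z^* ^+ n.
Proof. exact: rmorphXn. Qed.

Lemma conjcM (z w : C) : (z * w)^* = z^* * w^*.
Proof. exact: rmorphM. Qed.

Lemma conjcB (z w : C) : (z - w)^* = z^* - w^*.
Proof. exact: rmorphB. Qed.

Lemma conjCKc (z : C) : (z^*)^* = z.
Proof. exact: conjCK. Qed.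

Lemma conjcV (z : C) : (z^-1)^* = (z^*)^-1.
Proof. exact: fmorphV. Qed.

Lemma conjC_realC (x : R) : (x%:C)^* = x%:C :> C.
Proof. exact: conjc_real. Qed.

Lemma realCM (x y : R) : (x * y)%:C = x%:C * y%:C :> C.
Proof. exact: rmorphM. Qed.

Lemma realCB (x y : R) : (x - y)%:C = x%:C - y%:C :> C.
Proof. exact: rmorphB. Qed.

Lemma realC_sum (I : Type) (s : seq I) (P : pred I) (F : I -> R) :
  (\sum_(i <- s | P i) F i)%:C = \sum_(i <- s | P i) (F i)%:C :> C.
Proof. exact: rmorph_sum. Qed.

Lemma nm_circle (z : circle R) : nm (sval z) = 1.
Proof. by case: z => z /= /eqP; rewrite normrE_nm => -[]. Qed.

Lemma circleJ (z : circle R) : sval z * (sval z)^* = 1.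
Proof. by rewrite mulJ_nm nm_circle expr1n. Qed.

End ComplexModulus.

(** * Borel functions on the circle *)

Section BorelFunctions.
Context {R : realType}.
Local Notation C := R[i].
Local Notation T := (circle R).
Local Notation nm := (@Normc.normc R).
Local Notation Re := (@complex.Re R).
Local Notation Im := (@complex.Im R).
Implicit Types f g : T -> C.

Lemma borel_cst c : borel (fun _ : T => c).
Proof. by split; exact: measurable_cst. Qed.

Lemma borel_sval : borel (fun z : T => sval z).
Proof.
split => /=.
  exact: continuous_measurable_fun (@continuous_cos R).
exact: continuous_measurable_fun (@continuous_sin R).
Qed.

Lemma borelD f g : borel f -> borel g -> borel (fun z => f z + g z).
Proof.
move=> [f1 f2] [g1 g2]; split.
  by under eq_fun do rewrite ReD; exact: measurable_funD.
by under eq_fun do rewrite ImD; exact: measurable_funD.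
Qed.

Lemma borelN f : borel f -> borel (fun z => - f z).
Proof.
move=> [f1 f2]; split.
  by under eq_fun do rewrite ReN; exact: measurable_funN.
by under eq_fun do rewrite ImN; exact: measurable_funN.
Qed.

Lemma borelB f g : borel f -> borel g -> borel (fun z => f z - g z).
Proof. by move=> ? ?; apply: borelD => //; exact: borelN. Qed.

Lemma borelM f g : borel f -> borel g -> borel (fun z => f z * g z).
Proof.
move=> [f1 f2] [g1 g2]; split.
  by under eq_fun do rewrite ReM; apply: measurable_funB; exact: measurable_funM.
by under eq_fun do rewrite ImM; apply: measurable_funD; exact: measurable_funM.
Qed.

Lemma borelJ f : borel f -> borel (fun z => (f z)^*).
Proof.
move=> [f1 f2]; split.
  by under eq_fun do rewrite ReJ.
by under eq_fun do rewrite ImJ; exact: measurable_funN.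
Qed.

Lemma borelX f n : borel f -> borel (fun z => f z ^+ n).
Proof.
move=> bf; elim: n => [|n IH]; first by under eq_fun do rewrite expr0; exact: borel_cst.
by under eq_fun do rewrite exprS; exact: borelM.
Qed.

Lemma borel_sum (I : Type) (s : seq I) (F : I -> T -> C) :
  (forall i, borel (F i)) -> borel (fun z => \sum_(i <- s) F i z).
Proof.
move=> bF; elim: s => [|i s IH].
  by under eq_fun do rewrite big_nil; exact: borel_cst.
by under eq_fun do rewrite big_cons; exact: borelD.
Qed.

Lemma measurable_sqr_nm f : borel f ->
  measurable_fun setT (fun t : R => nm (f (cis t)) ^+ 2).
Proof.
move=> [f1 f2]; under eq_fun do rewrite sqr_nm.
by apply: measurable_funD; exact: measurable_funX.
Qed.

Lemma measurable_nm f : borel f ->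
  measurable_fun setT (fun t : R => nm (f (cis t))).
Proof.
move=> bf.
have -> : (fun t : R => nm (f (cis t))) =
    Num.sqrt \o (fun t : R => nm (f (cis t)) ^+ 2).
  by apply/funext => t /=; rewrite sqrtr_sqr ger0_norm// nm_ge0.
apply: measurableT_comp; last exact: measurable_sqr_nm.
exact: continuous_measurable_fun (@sqrt_continuous R).
Qed.

(** Inversion is continuous on the open complement of 0 and, being total, sends 0 to 0; the two
    pieces are glued. This allows division by functions that vanish on a null set. *)
Lemma measurable_invr : measurable_fun setT (GRing.inv : R -> R).
Proof.
have -> : [set: R] = ~` [set 0] `|` [set 0] by rewrite setUC setUv.
apply/measurable_funU; [exact: measurableC|by []|split].
- apply: open_continuous_measurable_fun.
    by apply: closed_openC; exact: (accessible_closed_set1 (hausdorff_accessible (@Rhausdorff R))).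
  by move=> x; rewrite inE /= => /eqP x0; exact: inv_continuous.
- have h : {in [set 0 : R], (fun=> 0) =1 (GRing.inv : R -> R)}.
    by move=> x; rewrite inE /= => ->; rewrite invr0.
  by apply: (eq_measurable_fun _ h); exact: measurable_cst.
Qed.

Lemma borelV f : borel f -> borel (fun z => (f z)^-1).
Proof.
move=> bf; have [f1 f2] := bf.
have mV : measurable_fun setT (fun t : R => (nm (f (cis t)) ^+ 2)^-1).
  by apply: (measurableT_comp measurable_invr); exact: measurable_sqr_nm.
split.
  by under eq_fun do rewrite ReV; exact: measurable_funM.
by under eq_fun do rewrite ImV; apply: measurable_funM => //; exact: measurable_funN.
Qed.

End BorelFunctions.

(** * Integration over the circle: the spaces L1, L2 and the Cauchy-Schwarz inequality *)

Section CircleIntegral.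
Context {R : realType}.
Local Notation C := R[i].
Local Notation T := (circle R).
Local Notation leb := (@lebesgue_measure R).
Local Notation D := (@angles R).
Local Notation nm := (@Normc.normc R).
Local Notation Re := (@complex.Re R).
Local Notation Im := (@complex.Im R).
Implicit Types (f g h : T -> C) (u v : R -> R).

Definition rint u : Prop := leb.-integrable D (EFin \o u).
Definition RI u : R := (\int[leb]_(t in D) u t)%R.

Lemma mD : measurable (D : set (measurableTypeR R)). Proof. exact: measurable_itv. Qed.

Lemma leb_angles : leb D = (2 * pi)%:E.
Proof.
rewrite /angles lebesgue_measure_itv /= lte_fin.
by rewrite mulr_gt0 ?pi_gt0// sube0.
Qed.

Lemma twopi_gt0 : 0 < 2 * pi :> R.
Proof. by rewrite mulr_gt0// pi_gt0. Qed.

Lemma rint_measurable u : rint u -> measurable_fun D u.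
Proof. by move=> /integrableP[/measurable_EFinP]. Qed.

Lemma rint_cst (c : R) : rint (fun=> c).
Proof.
apply: measurable_bounded_integrable; first exact: mD.
- by rewrite /= leb_angles ltry.
- exact: measurable_cst.
- exact: bounded_cst.
Qed.

Lemma rintD u v : rint u -> rint v -> rint (fun t => u t + v t).
Proof.
move=> ru rv; have h := integrableD mD ru rv.
by rewrite /rint (_ : EFin \o _ = ((EFin \o u) \+ (EFin \o v))%E).
Qed.

Lemma rintZ (c : R) u : rint u -> rint (fun t => c * u t).
Proof.
move=> ru; have h := integrableZl mD c ru.
by rewrite /rint (_ : EFin \o _ = (fun t => c%:E * (EFin \o u) t)%E).
Qed.

Lemma rintN u : rint u -> rint (fun t => - u t).
Proof.
move=> ru; have h := integrableN ru.
by rewrite /rint (_ : EFin \o _ = -%E \o (EFin \o u)).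
Qed.

Lemma rintB u v : rint u -> rint v -> rint (fun t => u t - v t).
Proof. by move=> ru rv; apply: rintD => //; exact: rintN. Qed.

Lemma rint_norm u : rint u -> rint (fun t => `|u t|).
Proof. exact: integrable_norm. Qed.

Lemma rint_le_ae u v : measurable_fun setT u -> rint v ->
  {ae leb, forall t, D t -> `|u t| <= v t} -> rint u.
Proof.
move=> mu rv uv; apply/integrableP; split.
  by apply/measurable_EFinP; exact: measurable_funTS.
have /integrableP[mv] := rv.
apply: le_lt_trans; apply: ae_ge0_le_integral => //.
- exact: mD.
- by apply/measurableT_comp => //; apply/measurable_EFinP; exact: measurable_funTS.
- exact: measurableT_comp.
- by apply: filterS uv => t h Dt /=; rewrite lee_fin (le_trans (h Dt))// ler_norm.
Qed.

Lemma rint_le u v : measurable_fun setT u -> rint v ->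
  (forall t, `|u t| <= v t) -> rint u.
Proof. by move=> mu rv uv; apply: rint_le_ae rv _ => //; apply: aeW. Qed.

Lemma RID u v : rint u -> rint v -> RI (fun t => u t + v t) = RI u + RI v.
Proof. by move=> ru rv; rewrite /RI RintegralD//; exact: mD. Qed.

Lemma RIB u v : rint u -> rint v -> RI (fun t => u t - v t) = RI u - RI v.
Proof. by move=> ru rv; rewrite /RI RintegralB//; exact: mD. Qed.

Lemma RIZ (c : R) u : rint u -> RI (fun t => c * u t) = c * RI u.
Proof. by move=> ru; rewrite /RI RintegralZl//; exact: mD. Qed.

Lemma RIN u : rint u -> RI (fun t => - u t) = - RI u.
Proof.
by move=> ru; rewrite -mulN1r -RIZ//; congr RI; apply/funext => t; rewrite mulN1r.
Qed.

Lemma RI_cst (c : R) : RI (fun=> c) = c * (2 * pi).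
Proof. by rewrite /RI (Rintegral_cst _ mD) /= leb_angles. Qed.

Lemma RI_le u v : rint u -> rint v -> (forall t, u t <= v t) -> RI u <= RI v.
Proof. by move=> ru rv uv; apply: le_Rintegral => //; exact: mD. Qed.

Lemma RI_ge0 u : (forall t, 0 <= u t) -> 0 <= RI u.
Proof. by move=> u0; apply: Rintegral_ge0. Qed.

Lemma RI_EFin u : rint u -> (\int[leb]_(t in D) (u t)%:E)%E = (RI u)%:E.
Proof. by move=> ru; rewrite /RI /Rintegral fineK//; exact: (integrable_fin_num mD ru). Qed.

Lemma RI_ae u v : measurable_fun D u -> measurable_fun D v ->
  {ae leb, forall t, D t -> u t = v t} -> RI u = RI v.
Proof.
move=> mu mv uv; congr fine; apply: ae_eq_integral; first exact: mD.
- exact/measurable_EFinP.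
- exact/measurable_EFinP.
- by apply: filterS uv => t h Dt /=; rewrite h.
Qed.

Lemma RI_le_ae u v : rint u -> rint v ->
  {ae leb, forall t, D t -> u t <= v t} -> RI u <= RI v.
Proof.
move=> ru rv uv; rewrite -(subr_ge0 (RI u)) -RIB//.
(* [RI_ge0] asks for nonnegativity at every point. The positive part has it and agrees with [v - u]
   almost everywhere. *)
have -> : RI (fun t => v t - u t) = RI (fun t => Num.max (v t - u t) 0).
  apply: RI_ae.
  - by apply: rint_measurable; exact: rintB.
  - apply: measurable_maxr; last exact: measurable_cst.
    by apply: rint_measurable; exact: rintB.
  - by apply: filterS uv => t h Dt; rewrite max_l// subr_ge0 h.
by apply: RI_ge0 => t; rewrite le_max lexx orbT.
Qed.

Lemma RI_eq0_ae u : rint u -> (forall t, 0 <= u t) -> RI u = 0 ->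
  {ae leb, forall t, D t -> u t = 0}.
Proof.
move=> ru u0 I0.
have h : (\int[leb]_(t in D) `|(u t)%:E|)%E = 0.
  under eq_integral do rewrite /= ger0_norm//.
  by rewrite RI_EFin// I0.
have := (ae_eq_integral_abs leb mD (measurable_int leb ru)).1 h.
by apply: filterS => t /[apply] -[].
Qed.

Lemma aeT_ae (P : T -> Prop) : aeT P -> {ae leb, forall t, D t -> P (cis t)}.
Proof. by []. Qed.

Lemma aeT_and (P Q S : T -> Prop) : aeT P -> aeT Q ->
  (forall z, P z -> Q z -> S z) -> aeT S.
Proof.
by move=> hP hQ h; apply: filterS2 (aeT_ae hP) (aeT_ae hQ) => t p q Dt; apply: h; [exact: p|exact: q].
Qed.

Lemma aeTW (P Q : T -> Prop) : aeT P -> (forall z, P z -> Q z) -> aeT Q.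
Proof. by move=> hP h; apply: filterS (aeT_ae hP) => t p Dt; apply: h; exact: p. Qed.

Lemma aeT_all (P : T -> Prop) : (forall z, P z) -> aeT P.
Proof. by move=> h; apply: aeW => t _; exact: h. Qed.

Lemma eqT_sym f g : eqT f g -> eqT g f.
Proof. by move=> h; apply: aeTW h _ => z ->. Qed.

Definition L1 f := borel f /\ rint (fun t => nm (f (cis t))).
Definition L2 f := borel f /\ rint (fun t => nm (f (cis t)) ^+ 2).
(** [CI], [N1] and [N2] are taken over the angles without the factor [1 / (2 pi)], and [N2] is the
    square of the L2 norm. *)
Definition CI f : C :=
  RI (fun t => Re (f (cis t))) +i* RI (fun t => Im (f (cis t))).
Definition N2 f : R := RI (fun t => nm (f (cis t)) ^+ 2).
Definition N1 f : R := RI (fun t => nm (f (cis t))).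

Lemma L1_Re f : L1 f -> rint (fun t => Re (f (cis t))).
Proof. by move=> [[b1 b2] hf]; apply: rint_le hf _ => // t; exact: Re_le_nm. Qed.

Lemma L1_Im f : L1 f -> rint (fun t => Im (f (cis t))).
Proof. by move=> [[b1 b2] hf]; apply: rint_le hf _ => // t; exact: Im_le_nm. Qed.

Lemma rint_nm f : L1 f -> rint (fun t => nm (f (cis t))). Proof. by case. Qed.

Lemma L1_le f u : borel f -> rint u -> (forall t, nm (f (cis t)) <= u t) -> L1 f.
Proof.
move=> bf ru h; split => //; apply: rint_le ru _; first exact: measurable_nm.
by move=> t; rewrite ger0_norm ?nm_ge0.
Qed.

Lemma L2_le f u : borel f -> rint u -> (forall t, nm (f (cis t)) ^+ 2 <= u t) -> L2 f.
Proof.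
move=> bf ru h; split => //; apply: rint_le ru _; first exact: measurable_sqr_nm.
by move=> t; rewrite ger0_norm ?sqr_ge0.
Qed.

Lemma L1D f g : L1 f -> L1 g -> L1 (fun z => f z + g z).
Proof.
move=> [bf rf] [bg rg]; apply: (L1_le (borelD bf bg) (rintD rf rg)) => t.
exact: nmD.
Qed.

Lemma L1Z c f : L1 f -> L1 (fun z => c * f z).
Proof.
move=> [bf rf]; apply: (L1_le (borelM (borel_cst c) bf) (rintZ (nm c) rf)) => t.
by rewrite nmM.
Qed.

Lemma L1N f : L1 f -> L1 (fun z => - f z).
Proof. by move=> [bf rf]; apply: (L1_le (borelN bf) rf) => t; rewrite nmN. Qed.

Lemma L1B f g : L1 f -> L1 g -> L1 (fun z => f z - g z).
Proof. by move=> hf hg; apply: L1D => //; exact: L1N. Qed.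

Lemma L1J f : L1 f -> L1 (fun z => (f z)^*).
Proof. by move=> [bf rf]; apply: (L1_le (borelJ bf) rf) => t; rewrite nmJ. Qed.

Lemma L1_cst c : L1 (fun _ : T => c).
Proof. by split; [exact: borel_cst|exact: rint_cst]. Qed.

Lemma L1_sum (I : Type) (s : seq I) (F : I -> T -> C) :
  (forall i, L1 (F i)) -> L1 (fun z => \sum_(i <- s) F i z).
Proof.
move=> bF; elim: s => [|i s IH].
  by under eq_fun do rewrite big_nil; exact: L1_cst.
by under eq_fun do rewrite big_cons; exact: L1D.
Qed.

Lemma CID f g : L1 f -> L1 g -> CI (fun z => f z + g z) = CI f + CI g.
Proof.
move=> hf hg; apply: complex_ext; rewrite ?ReD ?ImD /=.
  by rewrite -RID; [congr RI; apply/funext => t; rewrite ReD|exact: L1_Re..].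
by rewrite -RID; [congr RI; apply/funext => t; rewrite ImD|exact: L1_Im..].
Qed.

Lemma CIZ c f : L1 f -> CI (fun z => c * f z) = c * CI f.
Proof.
move=> hf; have rR := L1_Re hf; have rI := L1_Im hf.
apply: complex_ext; rewrite ?ReM ?ImM /=.
  rewrite -!RIZ// -RIB; [|exact: rintZ..].
  by congr RI; apply/funext => t; rewrite ReM.
rewrite -!RIZ// -RID; [|exact: rintZ..].
by congr RI; apply/funext => t; rewrite ImM.
Qed.

Lemma CIN f : L1 f -> CI (fun z => - f z) = - CI f.
Proof.
by move=> hf; rewrite -mulN1r -CIZ//; congr CI; apply/funext => z; rewrite mulN1r.
Qed.

Lemma CIB f g : L1 f -> L1 g -> CI (fun z => f z - g z) = CI f - CI g.
Proof. by move=> hf hg; rewrite CID ?CIN//; exact: L1N. Qed.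

Lemma CIJ f : L1 f -> CI (fun z => (f z)^*) = (CI f)^*.
Proof.
move=> hf; apply: complex_ext; rewrite ?ReJ ?ImJ /=.
  by congr RI; apply/funext => t; rewrite ReJ.
rewrite -RIN; last exact: L1_Im.
by congr RI; apply/funext => t; rewrite ImJ.
Qed.

Lemma CI_cst c : CI (fun _ : T => c) = c * (2 * pi)%:C.
Proof.
by apply: complex_ext; rewrite ?ReM ?ImM /= RI_cst ?mulr0 ?subr0 ?add0r.
Qed.

Lemma CI_sum (I : Type) (s : seq I) (F : I -> T -> C) :
  (forall i, L1 (F i)) ->
  CI (fun z => \sum_(i <- s) F i z) = \sum_(i <- s) CI (F i).
Proof.
move=> hF; elim: s => [|i s IH].
  by under eq_fun do rewrite big_nil; rewrite big_nil CI_cst mul0r.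
under eq_fun do rewrite big_cons.
by rewrite big_cons CID ?IH//; exact: L1_sum.
Qed.

Lemma eqT_CI f g : borel f -> borel g -> eqT f g -> CI f = CI g.
Proof.
move=> [f1 f2] [g1 g2] fg; apply: complex_ext => /=; apply: RI_ae.
- exact: measurable_funTS.
- exact: measurable_funTS.
- by apply: filterS (aeT_ae fg) => t h Dt; rewrite h.
- exact: measurable_funTS.
- exact: measurable_funTS.
- by apply: filterS (aeT_ae fg) => t h Dt; rewrite h.
Qed.

(** Multiplying [f] by the conjugate of its own integral makes the integral real and nonnegative,
    and a real part is at most the modulus. *)
Lemma nm_CI f : L1 f -> nm (CI f) <= N1 f.
Proof.
move=> hf; have [z0|znz] := eqVneq (nm (CI f)) 0.
  by rewrite z0; apply: RI_ge0 => t; exact: nm_ge0.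
have zgt : 0 < nm (CI f) by rewrite lt0r znz nm_ge0.
rewrite -(ler_pM2l zgt) -expr2.
have -> : nm (CI f) ^+ 2 = Re (CI (fun z => (CI f)^* * f z)).
  by rewrite CIZ// mulrC mulJ_nm.
rewrite /N1 -RIZ; last by case: hf.
apply: RI_le.
- exact: (L1_Re (L1Z _ hf)).
- by apply: rintZ; case: hf.
- move=> t; apply: (le_trans (ler_norm _)); apply: (le_trans (Re_le_nm _)).
  by rewrite nmM nmJ.
Qed.

Lemma N2_ge0 f : 0 <= N2 f.
Proof. by apply: RI_ge0 => t; rewrite sqr_ge0. Qed.

Lemma N1_ge0 f : 0 <= N1 f.
Proof. by apply: RI_ge0 => t; rewrite nm_ge0. Qed.

Lemma L2D f g : L2 f -> L2 g -> L2 (fun z => f z + g z).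
Proof.
move=> [bf rf] [bg rg].
apply: (L2_le (borelD bf bg) (rintD (rintZ 2 rf) (rintZ 2 rg))) => t.
set a := nm (f _); set b := nm (g _).
apply: (@le_trans _ _ ((a + b) ^+ 2)).
  by rewrite ler_sqr ?nnegrE ?addr_ge0 ?nm_ge0//; exact: nmD.
by rewrite -subr_ge0; have := sqr_ge0 (a - b); nra.
Qed.

Lemma L2Z c f : L2 f -> L2 (fun z => c * f z).
Proof.
move=> [bf rf].
apply: (L2_le (borelM (borel_cst c) bf) (rintZ (nm c ^+ 2) rf)) => t.
by rewrite nmM exprMn.
Qed.

Lemma L2N f : L2 f -> L2 (fun z => - f z).
Proof. by move=> [bf rf]; apply: (L2_le (borelN bf) rf) => t; rewrite nmN. Qed.

Lemma L2B f g : L2 f -> L2 g -> L2 (fun z => f z - g z).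
Proof. by move=> hf hg; apply: L2D => //; exact: L2N. Qed.

Lemma L2J f : L2 f -> L2 (fun z => (f z)^*).
Proof. by move=> [bf rf]; apply: (L2_le (borelJ bf) rf) => t; rewrite nmJ. Qed.

Lemma L2_cst c : L2 (fun _ : T => c).
Proof. by split; [exact: borel_cst|exact: rint_cst]. Qed.

Lemma L2_M f g : L2 f -> L2 g -> L1 (fun z => f z * g z).
Proof.
move=> [bf rf] [bg rg]; apply: (L1_le (borelM bf bg) (rintD rf rg)) => t.
rewrite nmM; set a := nm (f _); set b := nm (g _).
have a0 : 0 <= a by exact: nm_ge0.
have b0 : 0 <= b by exact: nm_ge0.
by have := sqr_ge0 (a - b); nra.
Qed.

Lemma L2_L1 f : L2 f -> L1 f.
Proof.
move=> hf; have := L2_M hf (L2_cst 1).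
by under eq_fun do rewrite mulr1.
Qed.

Lemma N2E f : N2 f = Re (CI (fun z => f z * (f z)^*)).
Proof.
by rewrite /N2 /CI /=; congr RI; apply/funext => t; rewrite mulJ_nm.
Qed.

Lemma CI_sqr f : CI (fun z => f z * (f z)^*) = (N2 f)%:C.
Proof.
apply: complex_ext; first by rewrite -N2E.
rewrite /= (_ : (fun _ => _) = fun=> 0) ?RI_cst ?mul0r//.
by apply/funext => t; rewrite mulJ_nm.
Qed.

Lemma eqT_N2 f g : borel f -> borel g -> eqT f g -> N2 f = N2 g.
Proof.
move=> bf bg fg; apply: RI_ae.
- by apply: measurable_funTS; exact: measurable_sqr_nm.
- by apply: measurable_funTS; exact: measurable_sqr_nm.
- by apply: filterS (aeT_ae fg) => t h Dt; rewrite h.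
Qed.

Lemma N2Z c f : L2 f -> N2 (fun z => c * f z) = nm c ^+ 2 * N2 f.
Proof.
move=> [bf rf]; rewrite /N2 -RIZ//; congr RI; apply/funext => t.
by rewrite nmM exprMn.
Qed.

Lemma N2_le f g : L2 f -> L2 g -> aeT (fun z => nm (f z) <= nm (g z)) -> N2 f <= N2 g.
Proof.
move=> [bf rf] [bg rg] fg; apply: RI_le_ae => //.
by apply: filterS (aeT_ae fg) => t h Dt; rewrite ler_sqr ?nnegrE ?nm_ge0// h.
Qed.

Lemma N2D f g : L2 f -> L2 g -> N2 (fun z => f z + g z) <= 2 * N2 f + 2 * N2 g.
Proof.
move=> hf hg; have [bf rf] := hf; have [bg rg] := hg.
rewrite /N2 -!RIZ// -RID; [|exact: rintZ..].
apply: RI_le; [by have [] := L2D hf hg|by apply: rintD; exact: rintZ|] => t.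
set a := nm (f _); set b := nm (g _).
apply: (@le_trans _ _ ((a + b) ^+ 2)).
  by rewrite ler_sqr ?nnegrE ?addr_ge0 ?nm_ge0//; exact: nmD.
by rewrite -subr_ge0; have := sqr_ge0 (a - b); nra.
Qed.

(** This reduces Cauchy-Schwarz to integrating [2 x y <= l x^2 + l^-1 y^2]. The weight [l = a / A]
    is the optimal one; if [A = 0] and [a > 0], the weight [(B + a) / a] gives [2 a <= a], a
    contradiction. *)
Lemma sqr_le_of_weighted (a A B : R) : 0 <= a -> 0 <= A -> 0 <= B ->
  (forall l, 0 < l -> 2 * a <= l * A + l^-1 * B) -> a ^+ 2 <= A * B.
Proof.
move=> a0 A0 B0 h.
have [az|an] := eqVneq a 0; first by rewrite az expr0n/= mulr_ge0.
have ap : 0 < a by rewrite lt0r an.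
have [Az|An] := eqVneq A 0.
  have BA : 0 < (B + a) / a by rewrite divr_gt0// ltr_wpDl.
  have Bap : 0 < B + a by rewrite ltr_wpDl.
  have := h _ BA; rewrite Az mulr0 add0r invf_div.
  have : a / (B + a) * B <= a.
    by rewrite mulrAC ler_pdivrMr// ler_pM2l// lerDl.
  by move=> h1 h2; have := le_trans h2 h1; lra.
have Ap : 0 < A by rewrite lt0r An.
have := h _ (divr_gt0 ap Ap); rewrite divfK// invf_div.
rewrite mulrAC => h1; have : a <= A * B / a by lra.
by rewrite ler_pdivlMr// expr2.
Qed.

Lemma CauchySchwarz f g : L2 f -> L2 g ->
  N1 (fun z => f z * g z) ^+ 2 <= N2 f * N2 g.
Proof.
move=> hf hg; have [bf rf] := hf; have [bg rg] := hg.
apply: sqr_le_of_weighted; [exact: N1_ge0|exact: N2_ge0|exact: N2_ge0|] => l l0.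
have rfg := rint_nm (L2_M hf hg).
rewrite /N1 /N2 -!RIZ// -RID; [|exact: rintZ..].
apply: RI_le; [exact: rintZ|by apply: rintD; exact: rintZ|] => t.
rewrite nmM; set a := nm (f _); set b := nm (g _).
rewrite -subr_ge0.
have -> : l * a ^+ 2 + l^-1 * b ^+ 2 - 2 * (a * b) = l * (a - l^-1 * b) ^+ 2.
  by field; rewrite gt_eqF.
by rewrite mulr_ge0 ?sqr_ge0// ltW.
Qed.

Lemma nm_CI_mul f g : L2 f -> L2 g ->
  nm (CI (fun z => f z * g z)) ^+ 2 <= N2 f * N2 g.
Proof.
move=> hf hg; apply: le_trans (CauchySchwarz hf hg).
by rewrite ler_sqr ?nnegrE ?nm_ge0 ?N1_ge0//; exact/nm_CI/L2_M.
Qed.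

Lemma LinfP f : Linf f <->
  borel f /\ exists M : R, 0 <= M /\ aeT (fun z => nm (f z) <= M).
Proof.
split=> -[bf [M]]; last first.
  by move=> [M0 h]; split => //; exists M; apply: aeTW h _ => z; rewrite normrE_nm lecR.
move=> h; split => //; exists (Num.max M 0); split; first by rewrite le_max lexx orbT.
by apply: aeTW h _ => z; rewrite normrE_nm lecR le_max => ->.
Qed.

Lemma Linf_bound f : borel f -> (exists M : R, aeT (fun z => nm (f z) <= M)) -> Linf f.
Proof.
by move=> bf [M h]; split => //; exists M; apply: aeTW h _ => z; rewrite normrE_nm lecR.
Qed.

Lemma LinfM f g : Linf f -> Linf g -> Linf (fun z => f z * g z).
Proof.
move=> /LinfP[bf [M [M0 hM]]] /LinfP[bg [N [N0 hN]]].
apply: Linf_bound; [exact: borelM|exists (M * N)].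
by apply: aeT_and hM hN _ => z h1 h2; rewrite nmM ler_pM ?nm_ge0.
Qed.

Lemma LinfD f g : Linf f -> Linf g -> Linf (fun z => f z + g z).
Proof.
move=> /LinfP[bf [M [M0 hM]]] /LinfP[bg [N [N0 hN]]].
apply: Linf_bound; [exact: borelD|exists (M + N)].
by apply: aeT_and hM hN _ => z h1 h2; rewrite (le_trans (nmD _ _))// lerD.
Qed.

Lemma LinfJ f : Linf f -> Linf (fun z => (f z)^*).
Proof.
move=> /LinfP[bf [M [M0 hM]]].
apply: Linf_bound; [exact: borelJ|exists M].
by apply: aeTW hM _ => z; rewrite nmJ.
Qed.

Lemma Linf_cst c : Linf (fun _ : T => c).
Proof.
by apply: Linf_bound; [exact: borel_cst|exists (nm c); exact: aeT_all].
Qed.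

Lemma Linf_sval : Linf (fun z : T => sval z).
Proof.
by apply: Linf_bound; [exact: borel_sval|exists 1; apply: aeT_all => z; rewrite nm_circle].
Qed.

Lemma LinfX f n : Linf f -> Linf (fun z => f z ^+ n).
Proof.
move=> bf; elim: n => [|n IH]; first by under eq_fun do rewrite expr0; exact: Linf_cst.
by under eq_fun do rewrite exprS; exact: LinfM.
Qed.

Lemma Linf_sum (I : Type) (s : seq I) (F : I -> T -> C) :
  (forall i, Linf (F i)) -> Linf (fun z => \sum_(i <- s) F i z).
Proof.
move=> bF; elim: s => [|i s IH].
  by under eq_fun do rewrite big_nil; exact: Linf_cst.
by under eq_fun do rewrite big_cons; exact: LinfD.
Qed.

Lemma Linf_borel f : Linf f -> borel f. Proof. by case. Qed.
Lemma L1_borel f : L1 f -> borel f. Proof. by case. Qed.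
Lemma L2_borel f : L2 f -> borel f. Proof. by case. Qed.

Lemma LinfM_L1 f g : Linf f -> L1 g -> L1 (fun z => f z * g z).
Proof.
move=> /LinfP[bf [M [M0 hM]]] [bg rg]; split; first exact: borelM.
apply: (rint_le_ae _ (rintZ M rg)).
  exact: (measurable_nm (borelM bf bg)).
apply: filterS (aeT_ae hM) => t h Dt; rewrite ger0_norm ?nm_ge0// nmM.
by apply: ler_wpM2r; [exact: nm_ge0|exact: h].
Qed.

Lemma LinfM_L2 f g : Linf f -> L2 g -> L2 (fun z => f z * g z).
Proof.
move=> /LinfP[bf [M [M0 hM]]] [bg rg]; split; first exact: borelM.
apply: (rint_le_ae _ (rintZ (M ^+ 2) rg)).
  exact: (measurable_sqr_nm (borelM bf bg)).
apply: filterS (aeT_ae hM) => t h Dt; rewrite ger0_norm ?sqr_ge0// nmM exprMn.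
by apply: ler_wpM2r; rewrite ?sqr_ge0// ler_sqr ?nnegrE ?nm_ge0//; exact: h.
Qed.

Lemma Linf_L2 f : Linf f -> L2 f.
Proof.
move=> hf; have := LinfM_L2 hf (L2_cst 1).
by under eq_fun do rewrite mulr1.
Qed.

(** By Cauchy-Schwarz, a vanishing integral against [g] survives L2 limits. Through this lemma
    identities pass from polynomials to the functions they approximate. The tolerance is divided by
    [N2 g + 1] because [N2 g] may be 0. *)
Lemma CI_mul_eq0_closed f g : L2 f -> L2 g ->
  (forall e : R, 0 < e -> exists x, [/\ L2 x, N2 (fun z => x z - f z) <= e
    & CI (fun z => x z * g z) = 0]) ->
  CI (fun z => f z * g z) = 0.
Proof.
move=> hf hg h; apply: nm_eq0; apply/eqP; rewrite -sqrf_eq0 eq_le sqr_ge0 andbT.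
apply/ler_addgt0Pr => e e0; rewrite add0r.
have gp : 0 < N2 g + 1 by rewrite ltr_wpDl// N2_ge0.
have [x [hx xf xg]] := h (e / (N2 g + 1)) (divr_gt0 e0 gp).
have -> : CI (fun z => f z * g z) = - CI (fun z => (x z - f z) * g z).
  under [in RHS]eq_fun do rewrite mulrBl.
  by rewrite CIB ?xg ?sub0r ?opprK//; exact: L2_M.
rewrite nmN; apply: (le_trans (nm_CI_mul (L2B hx hf) hg)).
apply: (le_trans (ler_wpM2r (N2_ge0 g) xf)).
rewrite mulrAC ler_pdivrMr// ler_pM2l//; lra.
Qed.

End CircleIntegral.

(** * Fatou's lemma and completeness of L2 *)

Section L2Limits.
Context {R : realType}.
Local Notation C := R[i].
Local Notation T := (circle R).
Local Notation leb := (@lebesgue_measure R).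
Local Notation D := (@angles R).
Local Notation nm := (@Normc.normc R).
Local Notation Re := (@complex.Re R).
Local Notation Im := (@complex.Im R).
Implicit Types (f g h : T -> C).

Lemma cvg_nm (u : nat -> C) (l : C) :
  (fun k => nm (u k - l)) @ \oo --> (0 : R) -> (fun k => nm (u k)) @ \oo --> nm l.
Proof.
move=> h; apply/cvgrPdist_le => e e0.
have /cvgrPdist_le/(_ e e0) := h.
apply: filterS => k; rewrite sub0r normrN ger0_norm ?nm_ge0//.
apply: le_trans; rewrite ler_norml; apply/andP; split.
  by rewrite lerNl opprB nm_distl.
by rewrite nmBC nm_distl.
Qed.

Lemma limn_einf_le (u : nat -> \bar R) B : (forall k, u k <= B)%E -> (limn_einf u <= B)%E.
Proof.
move=> h; rewrite limn_einf_lim; apply: lime_le; first exact: is_cvg_einfs.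
apply: nearW => n; apply: (le_trans _ (h n)).
by apply: ereal_inf_lbound; exists n => //=.
Qed.

(** Fatou's lemma for the squares of the moduli. Of the limit only measurability is known
    beforehand; its square integrability is part of the result. *)
Lemma N2_fatou (u : nat -> T -> C) f (B : R) : (forall k, L2 (u k)) -> borel f ->
  aeT (fun z => (fun k => nm (u k z - f z)) @ \oo --> (0 : R)) ->
  (forall k, N2 (u k) <= B) -> L2 f /\ N2 f <= B.
Proof.
move=> hu bf cv hB.
pose F k (t : R) := (nm (u k (cis t)) ^+ 2)%:E.
have mF k : measurable_fun (D : set (measurableTypeR R)) (F k).
  apply/measurable_EFinP/measurable_funTS; exact: (measurable_sqr_nm (L2_borel (hu k))).
have F0 k t : D t -> (0 <= F k t)%E by rewrite lee_fin sqr_ge0.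
have mf : measurable_fun (D : set (measurableTypeR R))
    (fun t => (nm (f (cis t)) ^+ 2)%:E).
  by apply/measurable_EFinP/measurable_funTS; exact: (measurable_sqr_nm bf).
have key : (\int[leb]_(t in D) (nm (f (cis t)) ^+ 2)%:E <= B%:E)%E.
  apply: (@le_trans _ _ (\int[leb]_(t in D) limn_einf (F^~ t))%E).
    apply: ae_ge0_le_integral => //; first exact: mD.
    - by move=> t _; rewrite lee_fin sqr_ge0.
    - move=> t Dt; rewrite limn_einf_lim; apply: lime_ge; first exact: is_cvg_einfs.
      by apply: nearW => n; apply: le_ereal_inf_tmp => _ [m _ <-]; exact: F0.
    - under eq_fun do rewrite limn_einf_lim.
      apply: (emeasurable_fun_cvg (fun n t => einfs (F^~ t) n)).
        by move=> m; exact: measurable_fun_einfs.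
      by move=> t _; exact: is_cvg_einfs.
    apply: filterS (aeT_ae cv) => t ct Dt; move: (ct Dt) => {}ct.
    have : (F^~ t) @ \oo --> (nm (f (cis t)) ^+ 2)%:E.
      by apply: cvg_EFin; [exact: nearW|rewrite expr2; apply: cvgM; exact: cvg_nm].
    by move=> /cvg_limn_einf_sup[-> _].
  apply: (le_trans (fatou leb mD mF F0)).
  apply: limn_einf_le => k; rewrite /F RI_EFin; last by case: (hu k).
  by rewrite lee_fin; exact: hB.
have rf : rint (fun t => nm (f (cis t)) ^+ 2).
  apply/integrableP; split => //.
  under eq_integral do rewrite gee0_abs ?lee_fin ?sqr_ge0//.
  by apply: (le_lt_trans key); rewrite ltry.
by split; [split|rewrite -lee_fin -RI_EFin].
Qed.

(** Absolutely summable increments make both coordinates converge. The limit is spelled out with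
    [limn] so that the same formula can define a function of further parameters. *)
Lemma cvg_complex (u : nat -> C) :
  cvgn (series (fun k => nm (u k.+1 - u k))) ->
  (fun k => nm (u k - (limn (fun k => Re (u k)) +i* limn (fun k => Im (u k)))))
    @ \oo --> (0 : R).
Proof.
move=> cu.
have aux (p : C -> R) : (forall z w, p (z - w) = p z - p w) ->
    (forall z, `|p z| <= nm z) -> cvgn (fun k => p (u k)).
  move=> pB pn.
  have : cvgn (series (fun k => p (u k.+1) - p (u k))).
    apply: normed_cvg; apply: series_le_cvg cu => [n|n|n].
    - exact: normr_ge0.
    - exact: nm_ge0.
    - by rewrite /= -pB.
  move=> /cvg_ex[l /= hl]; apply/cvg_ex; exists (l + p (u 0%N)).
  have -> : (fun k => p (u k)) = (fun k => series (fun k => p (u k.+1) - p (u k)) k + p (u 0%N)).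
    by apply/funext => k; rewrite seriesEnat /= telescope_sumr// subrK.
  by apply: cvgD => //; exact: cvg_cst.
have cR : cvgn (fun k => Re (u k)).
  by apply: aux => [z w|z]; [rewrite ReD ReN|exact: Re_le_nm].
have cI : cvgn (fun k => Im (u k)).
  by apply: aux => [z w|z]; [rewrite ImD ImN|exact: Im_le_nm].
set a := limn _ in cR *; set b := limn _ in cI *.
have h : (fun k => `|Re (u k) - a| + `|Im (u k) - b|) @ \oo --> (0 : R).
  rewrite -[X in _ --> X](addr0 0).
  have dist (v : nat -> R) l : v @ \oo --> l -> (fun k => `|v k - l|) @ \oo --> (0 : R).
    move=> hv; apply/cvgrPdist_le => e e0; have /cvgrPdist_le/(_ e e0) := hv.
    by apply: filterS => k; rewrite sub0r normrN normr_id distrC.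
  by apply: cvgD; exact: dist.
apply: (squeeze_cvgr _ (cvg_cst 0) h).
apply: nearW => k; rewrite nm_ge0 /=; apply: le_trans (nm_le_ReIm _) _.
by rewrite ReD ImD ReN ImN.
Qed.

Lemma N1_le_N2 f : L2 f -> N1 f ^+ 2 <= N2 f * (2 * pi).
Proof.
move=> hf; have := CauchySchwarz hf (L2_cst 1).
rewrite (_ : N2 (fun=> 1) = 2 * pi); last first.
  by rewrite /N2 nm1 expr1n RI_cst mul1r.
by under [in N1 _]eq_fun do rewrite mulr1.
Qed.

(** As [N2] is a squared norm, the rate [4^-k] bounds the L1 norms of the increments by
    [sqrt (2 pi) 2^-k]. By monotone convergence the sum of their moduli is finite almost everywhere,
    and there [u k] converges; Fatou's lemma carries the rate over to the limit. *)
Lemma riesz_fischer (u : nat -> T -> C) : (forall k, L2 (u k)) ->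
  (forall k m, (k <= m)%N -> N2 (fun z => u m z - u k z) <= (4^-1 : R) ^+ k) ->
  exists f, L2 f /\ forall k, N2 (fun z => f z - u k z) <= (4^-1 : R) ^+ k.
Proof.
move=> hu hc.
pose d k (z : T) := u k.+1 z - u k z.
have hd k : L2 (d k) by exact: L2B.
pose S k (t : R) := (\sum_(j < k) nm (d j (cis t)))%:E.
pose c : R := Num.sqrt (2 * pi).
have N1d k : N1 (d k) <= c * 2^-1 ^+ k.
  rewrite -ler_sqr ?nnegrE ?N1_ge0 ?mulr_ge0 ?sqrtr_ge0 ?exprn_ge0 ?invr_ge0//.
  apply: (le_trans (N1_le_N2 (hd k))).
  rewrite exprMn sqr_sqrtr ?(ltW twopi_gt0)// mulrC ler_pM2l ?twopi_gt0//.
  rewrite -exprM mulnC exprM (_ : 2^-1 ^+ 2 = 4^-1); first exact: hc.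
  by rewrite exprVn -natrX.
have rS k : rint (fun t => \sum_(j < k) nm (d j (cis t))).
  elim: k => [|k IH]; first by under eq_fun do rewrite big_ord0; exact: rint_cst.
  under eq_fun do rewrite big_ord_recr /=.
  by apply: rintD => //; have /L2_L1[] := hd k.
have IS k : RI (fun t => \sum_(j < k) nm (d j (cis t))) <= c * 2.
  apply: (@le_trans _ _ (c * (2 - 2^-1 ^+ k * 2))); last first.
    rewrite ler_wpM2l ?sqrtr_ge0// gerBl mulr_ge0// exprn_ge0// invr_ge0//.
  elim: k => [|k IH].
    under eq_fun do rewrite big_ord0.
    by rewrite RI_cst mul0r expr0 mul1r subrr mulr0.
  under eq_fun do rewrite big_ord_recr /=.
  rewrite (RID (rS k)); last by have /L2_L1[] := hd k.
  apply: (le_trans (lerD IH (N1d k))).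
  rewrite exprS -mulrDr ler_wpM2l ?sqrtr_ge0//; lra.
have mS k : measurable_fun (setT : set (measurableTypeR R)) (S k).
  apply/measurable_EFinP.
  rewrite /S /comp /=; elim: k => [|k IH].
    by under eq_fun do rewrite big_ord0; exact: measurable_cst.
  under eq_fun do rewrite big_ord_recr /=.
  by apply: measurable_funD => //; exact: (measurable_nm (L2_borel (hd k))).
have ndS t : {homo (S^~ t) : n m / (n <= m)%N >-> (n <= m)%E}.
  move=> n m nm'; rewrite lee_fin -!(big_mkord xpredT (fun j => nm (d j (cis t)))).
  rewrite [leRHS](big_cat_nat (n := n)) //= lerDl sumr_ge0// => i _; exact: nm_ge0.
pose Soo t := limn (S^~ t).
have cS t : S^~ t @ \oo --> Soo t by exact: ereal_nondecreasing_is_cvgn.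
have mSoo : measurable_fun (setT : set (measurableTypeR R)) Soo.
  by apply: (emeasurable_fun_cvg S) => // t _; exact: cS.
have ISoo : (\int[leb]_(t in D) Soo t <= (c * 2)%:E)%E.
  rewrite monotone_convergence //; last 3 first.
  - exact: mD.
  - by move=> n; exact: measurable_funTS.
  - by move=> n t _; rewrite lee_fin sumr_ge0// => i _; exact: nm_ge0.
  apply: lime_le.
    apply: ereal_nondecreasing_is_cvgn => n m nm'; apply: ge0_le_integral => //.
    - exact: mD.
    - by move=> t _; rewrite lee_fin sumr_ge0// => i _; exact: nm_ge0.
    - exact: measurable_funTS.
    - exact: measurable_funTS.
    - by move=> t _; exact: ndS.
  by apply: nearW => k; rewrite RI_EFin// lee_fin.
have Soo0 t : (0 <= Soo t)%E.
  by apply: lime_ge; [exact: cS|apply: nearW => n; rewrite lee_fin sumr_ge0// => i _; exact: nm_ge0].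
have iSoo : leb.-integrable D Soo.
  apply/integrableP; split; first exact: measurable_funTS.
  under eq_integral do rewrite gee0_abs//.
  by apply: (le_lt_trans ISoo); rewrite ltry.
pose good (z : T) := `[< cvgn (series (fun k => nm (d k z))) >].
have goodE t : good (cis t) = (Soo t < +oo)%E.
  apply/asboolP/idP.
    move=> /cvg_ex[l /= hl].
    have -> : Soo t = l%:E.
      apply/cvg_lim => //; apply: cvg_EFin; first exact: nearW.
      have : series (fun k => nm (d k (cis t))) @ \oo --> l by [].
      by rewrite seriesEord.
    by rewrite ltry.
  move=> fin; have fSoo : Soo t \is a fin_num by rewrite ge0_fin_numE.
  apply/cvg_ex; exists (fine (Soo t)); rewrite seriesEord /=.
  by have /fine_cvgP[] : S^~ t @ \oo --> (fine (Soo t))%:E by rewrite fineK.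
(* A Borel representative needs a value everywhere: 0 is taken on the null set where the increments
   are not summable. *)
pose f z : C := if good z then limn (fun k => Re (u k z)) +i* limn (fun k => Im (u k z)) else 0.
have cvf z : good z -> (fun k => nm (u k z - f z)) @ \oo --> (0 : R).
  by move=> gz; rewrite /f gz; apply: cvg_complex; apply/asboolP.
have mgood : measurable_fun (setT : set (measurableTypeR R)) (fun t : R => good (cis t)).
  apply: (measurable_fun_bool true); rewrite setTI.
  rewrite (_ : _ @^-1` _ = setT `&` [set t | (Soo t < +oo)%E]).
    exact: emeasurable_fun_infty_o.
  by rewrite setTI; apply/seteqP; split => t /=; rewrite goodE.
have aux (p : C -> R) : (forall z w, p (z - w) = p z - p w) ->
    (forall z, `|p z| <= nm z) -> p 0 = 0 ->
    (forall k, measurable_fun setT (fun t : R => p (u k (cis t)))) ->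
    measurable_fun setT (fun t : R => p (f (cis t))).
  move=> pB pn p0 mp.
  apply: (measurable_fun_cvg (h := fun k t => if good (cis t) then p (u k (cis t)) else 0)).
    by move=> k; apply: measurable_fun_ifT => //; exact: mp.
  move=> t _; have [gt|gt] := boolP (good (cis t)); last first.
    by rewrite /f (negbTE gt) p0; exact: cvg_cst.
  apply/cvgrPdist_le => e e0.
  have /cvgrPdist_le/(_ e e0) := cvf _ gt.
  apply: filterS => k; rewrite sub0r normrN ger0_norm ?nm_ge0//.
  by apply: le_trans; rewrite -pB nmBC; exact: pn.
have bf : borel f.
  split; apply: aux => //.
  - by move=> z w; rewrite ReD ReN.
  - exact: Re_le_nm.
  - by move=> k; case: (L2_borel (hu k)).
  - by move=> z w; rewrite ImD ImN.
  - exact: Im_le_nm.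
  - by move=> k; case: (L2_borel (hu k)).
have gae : aeT good.
  have := integrable_ae mD iSoo.
  by apply: filterS => t h Dt; rewrite goodE -ge0_fin_numE//; exact: h.
have key k : L2 (fun z => f z - u k z) /\ N2 (fun z => f z - u k z) <= (4^-1 : R) ^+ k.
  apply: (N2_fatou (u := fun m z => u (m + k)%N z - u k z)).
  - by move=> m; exact: L2B.
  - by apply: borelB => //; exact: L2_borel.
  - apply: aeTW gae _ => z gz.
    under eq_fun do rewrite opprB addrA subrK.
    by have := cvf _ gz; rewrite -(cvg_shiftn k).
  - by move=> m; apply: hc; rewrite leq_addl.
exists f; split; last by move=> k; have [] := key k.
have [h _] := key 0%N; have := L2D h (hu 0%N).
by under eq_fun do rewrite subrK.
Qed.

End L2Limits.

(** * Orthogonality of the exponentials, Fourier coefficients and Bessel's inequality *)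

Section Exponentials.
Context {R : realType}.
Local Notation C := R[i].
Local Notation T := (circle R).
Local Notation leb := (@lebesgue_measure R).
Local Notation D := (@angles R).
Local Notation nm := (@Normc.normc R).
Local Notation Re := (@complex.Re R).
Local Notation Im := (@complex.Im R).
Implicit Types (f g h : T -> C).

Lemma cisX (t : R) n : sval (cis t) ^+ n = cos (n%:R * t) +i* sin (n%:R * t).
Proof.
elim: n => [|n IH]; first by rewrite expr0 mul0r cos0 sin0.
rewrite exprS IH; apply: complex_ext; rewrite ?ReM ?ImM /= -addn1 natrD mulrDl mul1r.
  by rewrite cosD; ring.
by rewrite sinD; ring.
Qed.

Lemma cis2pi : sval (cis (2 * pi) : T) = 1.
Proof. by apply: complex_ext; rewrite /= mulrC mulr_natr ?cos2pi ?sin2pi. Qed.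

Lemma cis0 : sval (cis 0 : T) = 1.
Proof. by apply: complex_ext; rewrite /= ?cos0 ?sin0. Qed.

Lemma RI_derive (F f : R -> R) : (forall t : R, is_derive t 1 F (f t)) -> continuous f ->
  F 0 = F (2 * pi) -> RI f = 0.
Proof.
move=> dF cf F02; rewrite /RI /Rintegral.
have cF : continuous F by move=> t; apply/differentiable_continuous/derivable1_diffP; case: (dF t).
rewrite (_ : (\int[_]_(_ in _) _)%E = ((F (2 * pi))%:E - (F 0)%:E)%E).
  by rewrite F02 -EFinB subrr.
apply: continuous_FTC2; first exact: twopi_gt0.
- exact: continuous_subspaceT.
- split; first by move=> t _; case: (dF t).
    exact: cvg_at_right_filter (cF _).
  exact: cvg_at_left_filter (cF _).
- by move=> t _; rewrite derive1E; case: (dF t).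
Qed.

Lemma CI_expS n : CI (fun z : T => sval z ^+ n.+1) = 0.
Proof.
have n0 : n.+1%:R != 0 :> R by rewrite pnatr_eq0.
have e0 : sval (cis 0 : T) ^+ n.+1 = 1 by rewrite cis0 expr1n.
have e2 : sval (cis (2 * pi) : T) ^+ n.+1 = 1 by rewrite cis2pi expr1n.
apply: complex_ext; rewrite /CI /=.
  under [X in RI X]eq_fun do rewrite cisX /=.
  apply: (@RI_derive (fun t => n.+1%:R^-1 * sin (n.+1%:R * t))).
  - move=> t; apply: is_derive_eq; rewrite !scaler1 /= /GRing.scale /=.
    by field.
  - move=> t; apply: (@continuous_comp R R R (fun t => n.+1%:R * t) cos).
      exact: mulrl_continuous.
    exact: continuous_cos.
  - have := congr1 Im e0; have := congr1 Im e2; rewrite !cisX /= => -> ->.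
    by rewrite !mulr0.
under [X in RI X]eq_fun do rewrite cisX /=.
apply: (@RI_derive (fun t => - (n.+1%:R^-1 * cos (n.+1%:R * t)))).
- move=> t; apply: is_derive_eq; rewrite !scaler1 /= /GRing.scale /=.
  by field.
- move=> t; apply: (@continuous_comp R R R (fun t => n.+1%:R * t) sin).
    exact: mulrl_continuous.
  exact: continuous_sin.
- have := congr1 Re e0; have := congr1 Re e2; rewrite !cisX /= => -> ->.
  by [].
Qed.

Lemma circle_subn (z : T) m n : (m <= n)%N ->
  sval z ^+ n * (sval z ^+ m)^* = sval z ^+ (n - m).
Proof.
move=> mn; rewrite -{1}(subnK mn) exprD conjcX -mulrA -exprMn circleJ expr1n mulr1.
by [].
Qed.

Lemma CI_exp_mulJ m n :
  CI (fun z : T => sval z ^+ m * (sval z ^+ n)^*) = (m == n)%:R * (2 * pi)%:C.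
Proof.
have aux k l : (k < l)%N -> CI (fun z : T => sval z ^+ l * (sval z ^+ k)^*) = 0.
  move=> kl; under eq_fun do rewrite (circle_subn _ (ltnW kl)).
  by rewrite -(prednK (n := (l - k)%N)) ?subn_gt0//; exact: CI_expS.
case: (ltngtP m n) => [mn|nm'|->].
- rewrite mul0r -[LHS]conjCKc -CIJ; last first.
    by apply: L2_L1; apply: LinfM_L2; [exact/LinfX/Linf_sval|apply/Linf_L2/LinfJ/LinfX/Linf_sval].
  under eq_fun do rewrite conjcM conjCKc mulrC.
  by rewrite aux// conjC0.
- by rewrite mul0r aux.
- under eq_fun do rewrite circle_subn// subnn expr0.
  by rewrite mul1r CI_cst mul1r.
Qed.

(** The Fourier coefficient of index [n >= 0]; those of negative index are [cfm]. *)
Definition cf f n : C := (2 * pi)^-1%:C * CI (fun z => f z * (sval z ^+ n)^*).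
Definition pol (a : nat -> C) N (z : T) : C := \sum_(j < N) a j * sval z ^+ j.

Lemma Linf_expn n : Linf (fun z : T => sval z ^+ n).
Proof. exact/LinfX/Linf_sval. Qed.

Lemma Linf_pol a N : Linf (pol a N).
Proof.
by apply: Linf_sum => j; apply: LinfM; [exact: Linf_cst|exact: Linf_expn].
Qed.

Lemma twopiC_neq0 : (2 * pi)%:C != 0 :> C.
Proof. by rewrite eq_complex /= eqxx andbT gt_eqF// twopi_gt0. Qed.

Lemma cfE f n : CI (fun z => f z * (sval z ^+ n)^*) = (2 * pi)%:C * cf f n.
Proof. by rewrite /cf mulrA -rmorphM /= mulfV ?mul1r// gt_eqF// twopi_gt0. Qed.

Lemma L1_mul_expJ f n : L1 f -> L1 (fun z => f z * (sval z ^+ n)^*).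
Proof.
move=> hf; under eq_fun do rewrite mulrC.
by apply: LinfM_L1 => //; exact/LinfJ/Linf_expn.
Qed.

Lemma L1_mul_exp f n : L1 f -> L1 (fun z => f z * sval z ^+ n).
Proof.
by move=> hf; under eq_fun do rewrite mulrC; apply: LinfM_L1 => //; exact: Linf_expn.
Qed.

Lemma L2_mul_exp f n : L2 f -> L2 (fun z => f z * sval z ^+ n).
Proof.
by move=> hf; under eq_fun do rewrite mulrC; apply: LinfM_L2 => //; exact: Linf_expn.
Qed.

Lemma cf_pol a N n : cf (pol a N) n = if (n < N)%N then a n else 0.
Proof.
apply: (mulfI twopiC_neq0); rewrite -cfE.
under eq_fun do rewrite /pol mulr_suml.
rewrite CI_sum; last first.
  by move=> i; apply: L1_mul_expJ; apply/L1Z/L2_L1/Linf_L2/Linf_expn.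
transitivity (\sum_(i < N) a i * ((i == n :> nat)%:R * (2 * pi)%:C)).
  apply: eq_bigr => i _; under eq_fun do rewrite -mulrA.
  by rewrite CIZ ?CI_exp_mulJ//; apply/L1_mul_expJ/L2_L1/Linf_L2/Linf_expn.
case: ifPn => nN; last first.
  rewrite mulr0 big1// => i _; case: eqP => [e|_]; last by rewrite mul0r mulr0.
  by move: nN; rewrite -e ltn_ord.
rewrite (bigD1 (Ordinal nN)) //= eqxx mul1r big1 ?addr0 1?mulrC// => i /eqP h.
case: eqP => [e|_]; last by rewrite mul0r mulr0.
by case: h; apply: val_inj.
Qed.

Lemma CI_mul_polJ f a N : L1 f ->
  CI (fun z => f z * (pol a N z)^*) = (2 * pi)%:C * \sum_(j < N) (a j)^* * cf f j.
Proof.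
move=> hf; under eq_fun do rewrite /pol rmorph_sum mulr_sumr.
rewrite CI_sum; last first.
  move=> i; under eq_fun do rewrite rmorphM mulrCA.
  by apply/L1Z/L1_mul_expJ.
rewrite mulr_sumr; apply: eq_bigr => i _.
under eq_fun do rewrite rmorphM mulrCA.
by rewrite CIZ ?cfE 1?mulrCA//; exact: L1_mul_expJ.
Qed.

Lemma N2_pol a N : N2 (pol a N) = 2 * pi * \sum_(j < N) nm (a j) ^+ 2.
Proof.
apply: complexI; rewrite -CI_sqr CI_mul_polJ; last exact/L2_L1/Linf_L2/Linf_pol.
rewrite !realCM realC_sum; congr (_ * _); apply: eq_bigr => j _.
by rewrite cf_pol ltn_ord mulrC mulJ_nm.
Qed.

(** Pythagoras for the analytic partial sum of the Fourier series. The equality is kept, and not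
    only Bessel's inequality, since the case of no remaining norm is what shows that the mean of
    [psi] has modulus below 1. *)
Lemma N2_subpol f N : L2 f ->
  N2 (fun z => f z - pol (cf f) N z) = N2 f - 2 * pi * \sum_(j < N) nm (cf f j) ^+ 2.
Proof.
move=> hf; set p := pol (cf f) N; have hp : L2 p by exact/Linf_L2/Linf_pol.
apply: complexI; rewrite -CI_sqr.
have -> : (fun z => (f z - p z) * (f z - p z)^*) =
   (fun z => (f z * (f z)^* - f z * (p z)^*) - ((f z * (p z)^*)^* - p z * (p z)^*)).
  by apply/funext => z; rewrite conjcB conjcM conjCKc; ring.
have fp := L2_M hf (L2J hp); have ff := L2_M hf (L2J hf); have pp := L2_M hp (L2J hp).
rewrite CIB; [|exact: L1B|by apply: L1B => //; exact: L1J].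
rewrite !CIB//; last exact: L1J.
rewrite CIJ// !CI_sqr CI_mul_polJ; last exact: L2_L1.
rewrite N2_pol; set S := \sum_(j < N) nm _ ^+ 2.
have -> : \sum_(j < N) (cf f j)^* * cf f j = S%:C.
  by rewrite realC_sum; apply: eq_bigr => j _; rewrite mulrC mulJ_nm.
by rewrite -realCM conjC_realC subrr subr0 realCB.
Qed.

Lemma bessel f N : L2 f -> 2 * pi * \sum_(j < N) nm (cf f j) ^+ 2 <= N2 f.
Proof. by move=> hf; rewrite -subr_ge0 -N2_subpol// N2_ge0. Qed.

End Exponentials.

(** * The Poisson kernel and Abel sums *)

Section PoissonKernel.
Context {R : realType}.
Local Notation C := R[i].
Local Notation T := (circle R).
Local Notation leb := (@lebesgue_measure R).
Local Notation D := (@angles R).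
Local Notation nm := (@Normc.normc R).
Local Notation Re := (@complex.Re R).
Local Notation Im := (@complex.Im R).
Implicit Types (u f g h : T -> C) (z w : T) (r : R).

(** The Poisson kernel of radius [r], to be taken at [z conj(w)] for two points of the circle. *)
Definition Pk r (w : C) : R := (1 - r ^+ 2) / nm (1 - r%:C * w) ^+ 2.

Lemma Pk_C r (w : C) :
  (Pk r w)%:C = (1 - r ^+ 2)%:C * ((1 - r%:C * w)^-1 * ((1 - r%:C * w)^-1)^*).
Proof. by rewrite mulJ_nm nmV exprVn -realCM. Qed.

Lemma nm_rw r (w : C) : 0 <= r -> nm w = 1 -> nm (r%:C * w) = r.
Proof. by move=> r0 w1; rewrite nmM w1 mulr1 nm_realC ger0_norm. Qed.

Lemma nm_1Brw_ge r (w : C) : 0 <= r -> nm w = 1 -> 1 - r <= nm (1 - r%:C * w).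
Proof. by move=> r0 w1; rewrite -{1}(nm_rw r0 w1) -{1}(@nm1 R) nm_distl. Qed.

Lemma sqr_nm_1Brw r (w : C) : nm w = 1 ->
  nm (1 - r%:C * w) ^+ 2 = (1 - r) ^+ 2 + 2 * r * (1 - Re w).
Proof.
move=> w1; have : nm w ^+ 2 = 1 by rewrite w1 expr1n.
rewrite !sqr_nm; case: w w1 => a b _ /= h.
have -> : r * a - 0 * b = r * a by ring.
have -> : 0 - (r * b + 0 * a) = - (r * b) by ring.
have : b ^+ 2 = 1 - a ^+ 2 by rewrite -h; ring.
by move=> hb; rewrite sqrrN exprMn hb; ring.
Qed.

Lemma Pk_ge0 r (w : C) : 0 <= r < 1 -> 0 <= Pk r w.
Proof.
move=> /andP[r0 r1]; rewrite divr_ge0 ?sqr_ge0// subr_ge0.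
by rewrite expr_le1// ltW.
Qed.

Lemma Pk_le r (w : C) : 0 <= r < 1 -> nm w = 1 -> Pk r w <= (1 - r) ^- 2.
Proof.
move=> /andP[r0 r1] w1; rewrite /Pk -[leRHS]mul1r.
have d0 : 0 < 1 - r by rewrite subr_gt0.
apply: ler_pM; rewrite ?invr_ge0 ?sqr_ge0//.
- by rewrite subr_ge0 expr_le1// ltW.
- by rewrite gerBl sqr_ge0.
- have h := nm_1Brw_ge r0 w1.
  rewrite lef_pV2 ?posrE ?exprn_gt0// ?(lt_le_trans d0 h)//.
  by rewrite ler_sqr ?nnegrE ?nm_ge0 ?(ltW d0).
Qed.

Definition Kn r N (w : C) : C :=
  \sum_(n < N) (r%:C * w) ^+ n + \sum_(n < N) (r%:C * w^*) ^+ n.+1.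

Lemma sum_geom (x : C) N : 1 - x != 0 -> \sum_(n < N) x ^+ n = (1 - x ^+ N) / (1 - x).
Proof.
by move=> x1; rewrite -[1 - x ^+ N]opprB subrX1 -mulNr opprB mulrAC mulfV// mul1r.
Qed.

(** Each of the two geometric series leaves a tail of modulus at most [r^N / (1 - r)]. The bound
    does not depend on [w], so that it can be integrated against any L1 function. *)
Lemma Kn_Pk r N (w : C) : 0 <= r < 1 -> nm w = 1 ->
  nm (Kn r N w - (Pk r w)%:C) <= 2 * (1 - r)^-1 * r ^+ N.
Proof.
move=> /andP[r0 r1] w1; set x := r%:C * w.
have d0 : 0 < 1 - r by rewrite subr_gt0.
have xn : 1 - r <= nm (1 - x) by exact: nm_1Brw_ge.
have xp : 0 < nm (1 - x) by exact: lt_le_trans xn.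
have x0 : 1 - x != 0.
  by apply/eqP => h; move: xp; rewrite h nm0 ltxx.
have xJ : r%:C * w^* = x^* by rewrite /x conjcM conjC_realC.
have xJ0 : 1 - x^* != 0.
  by apply/eqP => h; move: xp; rewrite -nmJ conjcB conjC1 h nm0 ltxx.
have xx : x * x^* = (r ^+ 2)%:C by rewrite mulJ_nm nm_rw.
have -> : Kn r N w - (Pk r w)%:C = - (x ^+ N / (1 - x)) - (x^* ^+ N.+1 / (1 - x^*)).
  rewrite /Kn xJ sum_geom//.
  under eq_bigr do rewrite exprS.
  rewrite -mulr_sumr sum_geom// Pk_C -/x realCB -xx conjcV conjcB conjC1 exprS.
  by field; rewrite x0 xJ0.
apply: (le_trans (nmD _ _)); rewrite !nmN !nmM !nmV !nmX nmJ.
rewrite (_ : nm (1 - x^*) = nm (1 - x)); last by rewrite -[RHS]nmJ conjcB conjC1.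
rewrite /x (nm_rw r0 w1) -/x -mulrDl.
have h : (nm (1 - x))^-1 <= (1 - r)^-1 by rewrite lef_pV2 ?posrE.
apply: (@le_trans _ _ ((r ^+ N + r ^+ N.+1) * (1 - r)^-1)).
  by rewrite ler_wpM2l// addr_ge0// exprn_ge0.
rewrite -mulrA mulrCA mulrC ler_wpM2l ?invr_ge0 ?(ltW d0)//.
have : r ^+ N.+1 <= r ^+ N.
  by rewrite exprS ler_piMl ?exprn_ge0// ltW.
by move=> ?; lra.
Qed.

Lemma nm_circle_mulJ z w : nm (sval z * (sval w)^*) = 1.
Proof. by rewrite nmM nmJ !nm_circle mulr1. Qed.

Lemma borel_Pk r z : borel (fun w : T => (Pk r (sval z * (sval w)^*))%:C).
Proof.
have b1 : borel (fun w : T => (1 - r%:C * (sval z * (sval w)^*))^-1).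
  apply/borelV/borelB; first exact: borel_cst.
  apply: borelM; first exact: borel_cst.
  apply: borelM; [exact: borel_cst|exact/borelJ/borel_sval].
under eq_fun do rewrite Pk_C.
by apply: borelM; [exact: borel_cst|apply: borelM => //; exact: borelJ].
Qed.

Lemma Linf_Pk r z : 0 <= r < 1 -> Linf (fun w : T => (Pk r (sval z * (sval w)^*))%:C).
Proof.
move=> r01; apply: Linf_bound; first exact: borel_Pk.
exists ((1 - r) ^- 2); apply: aeT_all => w.
by rewrite nm_realC ger0_norm ?Pk_ge0// Pk_le// nm_circle_mulJ.
Qed.

Definition PI u r z : C :=
  (2 * pi)^-1%:C * CI (fun w => (Pk r (sval z * (sval w)^*))%:C * u w).

(** The Fourier coefficient of index [-n]. As [cf] and [cfm] share the index 0, the second sum of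
    [abel], a partial sum of the Fourier series with the factors [r^|n|], starts at 1. *)
Definition cfm u n : C := (2 * pi)^-1%:C * CI (fun w => u w * sval w ^+ n).

Definition abel u r N z : C :=
  \sum_(n < N) (r%:C * sval z) ^+ n * cf u n +
  \sum_(n < N) (r%:C * (sval z)^*) ^+ n.+1 * cfm u n.+1.

Lemma Linf_Kn r N z : Linf (fun w : T => Kn r N (sval z * (sval w)^*)).
Proof.
apply: LinfD; apply: Linf_sum => n; apply: LinfX; apply: LinfM.
- exact: Linf_cst.
- by apply: LinfM; [exact: Linf_cst|exact/LinfJ/Linf_sval].
- exact: Linf_cst.
- apply: LinfJ; by apply: LinfM; [exact: Linf_cst|exact/LinfJ/Linf_sval].
Qed.

Lemma abelE u r N z : L1 u ->
  abel u r N z = (2 * pi)^-1%:C * CI (fun w => Kn r N (sval z * (sval w)^*) * u w).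
Proof.
move=> hu.
have l1 n : L1 (fun w : T => (r%:C * sval z) ^+ n * (u w * (sval w ^+ n)^*)).
  by apply/L1Z/L1_mul_expJ.
have l2 n : L1 (fun w : T => (r%:C * (sval z)^*) ^+ n * (u w * sval w ^+ n)).
  by apply/L1Z/L1_mul_exp.
pose F1 n w := (r%:C * sval z) ^+ n * (u w * (sval w ^+ n)^*).
pose F2 n w := (r%:C * (sval z)^*) ^+ n * (u w * sval w ^+ n).
have -> : (fun w => Kn r N (sval z * (sval w)^*) * u w) =
    (fun w => \sum_(n < N) F1 n w + \sum_(n < N) F2 n.+1 w).
  apply/funext => w; rewrite /Kn mulrDl !mulr_suml; congr (_ + _); apply: eq_bigr => n _.
    by rewrite /F1 mulrA exprMn -conjcX mulrAC -mulrA.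
  by rewrite /F2 conjcM conjCKc [r%:C * (_ * _)]mulrA [(_ * sval w) ^+ _]exprMn -mulrA [sval w ^+ _ * _]mulrC.
have s1 : L1 (fun w => \sum_(n < N) F1 n w) by apply: L1_sum => n; exact: l1.
have s2 : L1 (fun w => \sum_(n < N) F2 n.+1 w) by apply: L1_sum => n; exact: l2.
rewrite (CID s1 s2) (@CI_sum _ _ _ (fun n : 'I_N => F1 n)); last by move=> n; exact: l1.
rewrite (@CI_sum _ _ _ (fun n : 'I_N => F2 n.+1)); last by move=> n; exact: l2.
rewrite mulrDr !mulr_sumr; congr (_ + _); apply: eq_bigr => n _.
  by rewrite (CIZ _ (L1_mul_expJ n hu)) mulrCA.
by rewrite (CIZ _ (L1_mul_exp n.+1 hu)) mulrCA.
Qed.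

Lemma nm_twopiV : nm ((2 * pi)^-1%:C : C) = (2 * pi)^-1.
Proof. by rewrite nm_realC ger0_norm// invr_ge0 ltW// twopi_gt0. Qed.

Lemma abel_PI u r N z : L1 u -> 0 <= r < 1 ->
  nm (abel u r N z - PI u r z) <= (2 * pi)^-1 * (2 * (1 - r)^-1 * r ^+ N * N1 u).
Proof.
move=> hu r01; have [bu ru] := hu.
have l1 := LinfM_L1 (Linf_Kn r N z) hu.
have l2 := LinfM_L1 (Linf_Pk z r01) hu.
rewrite abelE// /PI -mulrBr -CIB// nmM nm_twopiV ler_wpM2l ?invr_ge0 ?(ltW twopi_gt0)//.
apply: (le_trans (nm_CI (L1B l1 l2))).
rewrite /N1 -RIZ//; apply: RI_le; [by have [] := L1B l1 l2|exact: rintZ|] => t.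
rewrite -mulrBl nmM ler_wpM2r ?nm_ge0//.
by apply: Kn_Pk => //; exact: nm_circle_mulJ.
Qed.

Lemma cvg_geomr (c r : R) : 0 <= r < 1 -> (fun N => c * r ^+ N) @ \oo --> (0 : R).
Proof.
move=> /andP[r0 r1]; rewrite -[X in _ --> X](mulr0 c).
by apply: cvgM; [exact: cvg_cst|apply: cvg_expr; rewrite ger0_norm].
Qed.

Lemma exists_geom_lt (c r e : R) : 0 <= r < 1 -> 0 < e ->
  exists N0, forall N, (N0 <= N)%N -> c * r ^+ N < e.
Proof.
move=> r01 e0; have /cvgrPdist_lt/(_ e e0)[N0 _ h] := cvg_geomr c r01.
exists N0 => N /h /=; rewrite sub0r normrN; exact/le_lt_trans/ler_norm.
Qed.

Lemma cvg_abel u r z : L1 u -> 0 <= r < 1 ->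
  (fun N => nm (abel u r N z - PI u r z)) @ \oo --> (0 : R).
Proof.
move=> hu r01; pose c := (2 * pi)^-1 * (2 * (1 - r)^-1 * N1 u).
apply: (squeeze_cvgr _ (cvg_cst 0) (cvg_geomr c r01)).
apply: nearW => N; rewrite nm_ge0 /=; apply: (le_trans (abel_PI N z hu r01)).
by rewrite /c le_eqVlt; apply/orP; left; apply/eqP; ring.
Qed.

Lemma nm_le_lim (a : nat -> C) (l : C) (B : R) :
  (fun N => nm (a N - l)) @ \oo --> (0 : R) -> (forall N, nm (a N) <= B) -> nm l <= B.
Proof.
move=> h hB; apply/ler_addgt0Pr => e e0.
have /cvgrPdist_lt/(_ e e0)[N _ hN] := h.
have := hN N (leqnn N); rewrite /= sub0r normrN ger0_norm ?nm_ge0// => h1.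
have -> : l = a N - (a N - l) by ring.
by apply: (le_trans (nmD _ _)); rewrite nmN lerD// ltW.
Qed.

Lemma abel_cst1 r N z : abel (fun=> 1) r N.+1 z = 1.
Proof.
rewrite /abel big_ord_recl /= expr0 mul1r [X in _ + X + _]big1 => [|n _]; last first.
  rewrite /cf; under [X in CI X]eq_fun => w do rewrite mul1r.
  rewrite CIJ; last exact/L2_L1/Linf_L2/Linf_expn.
  by rewrite /bump /= add1n CI_expS conjC0 !mulr0.
rewrite [X in _ + X]big1 => [|n _]; last first.
  rewrite /cfm; under [X in CI X]eq_fun => w do rewrite mul1r.
  by rewrite CI_expS !mulr0.
rewrite !addr0 /cf; under eq_fun do rewrite expr0 conjC1 mulr1.
by rewrite CI_cst mul1r -realCM mulVf// gt_eqF// twopi_gt0.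
Qed.

(** The Poisson kernel has total mass one. This is read off the Abel sums of the constant 1, all of
    which equal 1 except the empty one; hence the shift by one in the limit. *)
Lemma PI_cst r z (c : C) : 0 <= r < 1 -> PI (fun=> c) r z = c.
Proof.
move=> r01; suff : PI (fun=> 1) r z = 1.
  have lP := L2_L1 (Linf_L2 (Linf_Pk z r01)).
  rewrite /PI; under eq_fun do rewrite mulr1.
  move=> h; under eq_fun do rewrite mulrC.
  by rewrite CIZ// mulrCA h mulr1.
apply/eqP; rewrite -subr_eq0; apply/eqP; apply: nm_eq0; apply/eqP.
rewrite eq_le nm_ge0 andbT.
have := cvg_abel z (L1_cst 1) r01; rewrite -(cvg_shiftn 1) => h.
apply: (@nm_le_lim (fun=> 0)) => [|N]; last by rewrite nm0.
rewrite (_ : (fun _ => _) =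
  (fun N => nm (abel (fun=> 1) r (N + 1) z - PI (fun=> 1) r z)))//.
by apply/funext => N; rewrite addn1 abel_cst1 sub0r nmN nmBC.
Qed.

Lemma PI_sub u r z c : L1 u -> 0 <= r < 1 ->
  nm (PI u r z - c) <= (2 * pi)^-1 *
    RI (fun t => Pk r (sval z * (sval (cis t))^*) * nm (u (cis t) - c)).
Proof.
move=> hu r01.
have l1 := LinfM_L1 (Linf_Pk z r01) hu.
have l2 := LinfM_L1 (Linf_Pk z r01) (L1_cst c).
rewrite -{1}(PI_cst z c r01) /PI -mulrBr -CIB// nmM nm_twopiV.
rewrite ler_wpM2l ?invr_ge0 ?(ltW twopi_gt0)//.
apply: (le_trans (nm_CI (L1B l1 l2))).
rewrite /N1 le_eqVlt; apply/orP; left; apply/eqP; congr RI; apply/funext => t.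
by rewrite -mulrBr nmM nm_realC ger0_norm// Pk_ge0.
Qed.

End PoissonKernel.

(** * Poisson integrals at Lebesgue points *)

Section PoissonAverages.
Context {R : realType}.
Local Notation C := R[i].
Local Notation T := (circle R).
Local Notation leb := (@lebesgue_measure R).
Local Notation D := (@angles R).
Local Notation nm := (@Normc.normc R).
Local Notation Re := (@complex.Re R).
Local Notation Im := (@complex.Im R).
Implicit Types (u f g h : T -> C) (z w : T) (r t s : R).

(** The derivative of the sine at 0 is 1, so the quotient [sin x / x] is at least 1/2 near 0. *)
Lemma sin_ge_half : exists2 e : R, 0 < e & forall x : R, `|x| < e -> x ^+ 2 / 4 <= sin x ^+ 2.
Proof.
have [/cvg_ex[l hl] hd] := is_derive_sin (0 : R).
have : (fun h : R => h^-1 *: ((sin \o shift (0:R)) (h *: 1) - sin 0)) @ (0 : R)^' --> (1 : R).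
  rewrite -[X in _ --> X](@cos0 R) -hd /derive.
  by apply/cvg_ex; exists l.
move=> /cvgrPdist_lt/(_ (1/2)) /(_ ltac:(lra)).
rewrite /dnbhs /within /= => /nbhs_ballP[e e0 he].
exists e => // x xe; have [->|x0] := eqVneq x 0; first by rewrite sin0 expr0n /= mul0r.
have := he x; rewrite /ball /= sub0r normrN => /(_ xe x0).
rewrite /shift /= /GRing.scale /= mulr1 addr0 sin0 subr0.
move=> h; have h2 : 1/2 <= x^-1 * sin x by move: h; rewrite ltr_norml => /andP[]; lra.
have -> : sin x = x * (x^-1 * sin x) by rewrite mulrA mulfV ?mul1r.
rewrite exprMn ler_wpM2l ?sqr_ge0//.
have -> : 4^-1 = (1/2) ^+ 2 :> R by rewrite expr2; lra.
by rewrite ler_sqr ?nnegrE//; lra.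
Qed.

Lemma one_sub_cos t : 1 - cos t = 2 * sin (t / 2) ^+ 2.
Proof.
rewrite {1}(_ : t = (t / 2) *+ 2); last by rewrite mulr2n -splitr.
by rewrite cos_mulr2n; have := cos2Dsin2 (t / 2); rewrite !mulr2n; lra.
Qed.

(** Here [t] is a difference of two angles, whose modulus may exceed [pi]; that case is reflected to
    [2 pi - |t|], which lies between [m] and [pi]. *)
Lemma cos_away (m t : R) : 0 < m -> m <= pi -> m <= `|t| -> `|t| <= 2 * pi - m ->
  cos t <= cos m.
Proof.
move=> m0 mpi mt tm.
have -> : cos t = cos `|t| by case: (ger0P t) => // _; rewrite cosN.
have [tp|tp] := leP `|t| pi.
  rewrite leNgt ltr_cos ?in_itv /= ?normr_ge0 ?tp ?(ltW m0) ?mpi//.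
  by rewrite -leNgt.
have -> : cos `|t| = cos (2 * pi - `|t|).
  by rewrite (_ : 2 * pi - `|t| = - `|t| + pi *+ 2) ?cosD2pi ?cosN// mulr2n; ring.
rewrite leNgt ltr_cos ?in_itv /=; first by rewrite -leNgt; lra.
- by apply/andP; split; lra.
- by rewrite (ltW m0).
Qed.

Lemma cos_lt1 (m : R) : 0 < m -> m <= pi -> cos m < 1.
Proof.
by move=> m0 mpi; rewrite -(@cos0 R) ltr_cos ?in_itv /= ?lexx ?pi_ge0 ?mpi ?(ltW m0).
Qed.

Lemma Pk_angle r t s : 0 <= r -> Pk r (sval (cis t) * (sval (cis s))^*) =
  (1 - r ^+ 2) / ((1 - r) ^+ 2 + 2 * r * (1 - cos (t - s))).
Proof.
move=> r0; rewrite /Pk sqr_nm_1Brw ?nm_circle_mulJ//.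
by rewrite ReM /= cosB mulrN opprK.
Qed.

(** With [x = t - s] one has [1 - cos x = 2 sin(x / 2)^2 >= x^2 / 8], the origin of the 8, while
    [2 r >= 1] and [1 - r^2 <= 2 (1 - r)]. *)
Lemma Pk_near r t s e : 2^-1 <= r < 1 -> `|(t - s) / 2| < e ->
  (forall x : R, `|x| < e -> x ^+ 2 / 4 <= sin x ^+ 2) ->
  Pk r (sval (cis t) * (sval (cis s))^*) <= 2 * (1 - r) / ((1 - r) ^+ 2 + (t - s) ^+ 2 / 8).
Proof.
move=> /andP[r2 r1] tse hs; rewrite Pk_angle; last by lra.
have d0 : 0 < 1 - r by rewrite subr_gt0.
rewrite one_sub_cos; have := hs _ tse; set S := sin _ ^+ 2 => hS.
have d2 : 0 < (1 - r) ^+ 2 by rewrite exprn_gt0.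
have t2 : 0 <= (t - s) ^+ 2 by rewrite sqr_ge0.
have S0 : 0 <= S by rewrite sqr_ge0.
have hS' : (t - s) ^+ 2 / 16 <= S.
  by move: hS; rewrite exprMn; lra.
apply: ler_pM.
- by nra.
- by rewrite invr_ge0; nra.
- by nra.
- by rewrite lef_pV2 ?posrE; nra.
Qed.

Lemma Pk_far r t s m : 2^-1 <= r < 1 -> cos (t - s) <= m -> m < 1 ->
  Pk r (sval (cis t) * (sval (cis s))^*) <= 2 * (1 - r) / (1 - m).
Proof.
move=> /andP[r2 r1] cm m1; rewrite Pk_angle; last by lra.
have d0 : 0 < 1 - r by rewrite subr_gt0.
apply: ler_pM.
- by nra.
- by rewrite invr_ge0; nra.
- by nra.
- by rewrite lef_pV2 ?posrE; nra.
Qed.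

(* Dyadic majorant: on [2^(j-1) d <= |x| < 2^j d] the left side is at most
   [4 ^+ 3 / (4^j d)]. *)
Lemma dyadic_bound (d x : R) N : 0 < d -> `|x| < 2 ^+ N * d ->
  2 * d / (d ^+ 2 + x ^+ 2 / 8) <=
  \sum_(j < N.+1) 4 ^+ 3 / (4 ^+ j * d) * ((`|x| < 2 ^+ j * d)%R : nat)%:R.
Proof.
move=> d0; elim: N => [|N IH] xN.
  rewrite big_ord1 xN expr0 mul1r mulr1.
  have x2 := sqr_ge0 x.
  rewrite ler_pdivrMr; last by nra.
  rewrite mulrAC ler_pdivlMr//; nra.
rewrite big_ord_recr /=.
have [xN'|xN'] := ltP `|x| (2 ^+ N * d).
  apply: (le_trans (IH xN')); rewrite lerDl mulr_ge0// divr_ge0 ?exprn_ge0// mulr_ge0 ?exprn_ge0//.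
  exact: ltW.
rewrite xN mulr1 -[leLHS]add0r lerD//.
  by apply: sumr_ge0 => j _; rewrite mulr_ge0// divr_ge0 ?exprn_ge0// mulr_ge0 ?exprn_ge0 ?(ltW d0).
have p4 : 0 < 4 ^+ N :> R by rewrite exprn_gt0.
have h : 4 ^+ N * d ^+ 2 <= x ^+ 2.
  have -> : 4 = 2 ^+ 2 :> R by rewrite -natrX.
  rewrite -exprM mulnC exprM -exprMn -[x ^+ 2]real_normK ?num_real//.
  by rewrite ler_sqr ?nnegrE// mulr_ge0 ?exprn_ge0// ltW.
have d2 : 0 < d ^+ 2 by rewrite exprn_gt0.
rewrite ler_pdivrMr; last by nra.
rewrite mulrAC ler_pdivlMr; last by rewrite mulr_gt0// exprn_gt0.
rewrite exprS; nra.
Qed.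

Definition ball_ind t (x : R) s : R := ((`|t - s| < x)%R : nat)%:R.

(** The integral over the interval of radius [x] about [t] is [o(x)]. For [phi s = |v s - v t|] this
    says that [t] is a Lebesgue point of [v]. *)
Definition small_avg (phi : R -> R) t : Prop :=
  forall e : R, 0 < e -> exists2 eta : R, 0 < eta &
    forall x, 0 < x -> x <= eta -> RI (fun s => phi s * ball_ind t x s) <= e * x.

Lemma measurable_ball_ind t (x : R) : measurable_fun setT (ball_ind t x).
Proof.
rewrite (_ : ball_ind t x = \1_(ball t x)); last first.
  apply/funext => s; rewrite /ball_ind indicE.
  by have -> : (s \in (ball t x : set R)) = (`|t - s| < x) by apply/idP/idP; rewrite inE.
apply/measurable_indicP; exact: measurable_ball.
Qed.

Lemma rint_mul_ball phi t (x : R) : measurable_fun setT phi -> rint phi ->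
  rint (fun s => phi s * ball_ind t x s).
Proof.
move=> mp rp; apply: (rint_le _ (rint_norm rp)).
  by apply: measurable_funM => //; exact: measurable_ball_ind.
by move=> s; rewrite normrM /ball_ind; case: ltP => _; rewrite ?normr1 ?normr0 ?mulr1// mulr0.
Qed.

(** Close to [t] the kernel is dominated by a combination of indicators of dyadic intervals, on each
    of which the average of [phi] is small. Away from [t] it is at most a multiple of [1 - r], which
    tends to 0. *)
Lemma poisson_average phi t (e : R) : measurable_fun setT phi -> rint phi ->
  (forall s, 0 <= phi s) -> 0 < t < 2 * pi -> small_avg phi t -> 0 < e ->
  exists2 r0 : R, 0 <= r0 < 1 & forall r, r0 < r < 1 ->
    RI (fun s => Pk r (sval (cis t) * (sval (cis s))^*) * phi s) <= e.
Proof.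
move=> mp rp p0 /andP[t0 t2] avg e0.
have [h h0 hs] := sin_ge_half.
(* Against the factor [4^3 / (4^j (1 - r))] of [dyadic_bound], the interval of radius [2^j (1 - r)]
   then contributes at most [(e / 4) 2^-j], and all of them together at most [e / 2]. *)
have e256 : 0 < e / 4 ^+ 4 by rewrite divr_gt0// exprn_gt0.
have [eta eta0 heta] := avg _ e256.
(* Below [m] both the averages and the sine bound are under control. The distance of [t] to the
   endpoints is included so that [m <= pi] and [|t - s| <= 2 pi - m], as [cos_away] requires. *)
pose m := Num.min (Num.min eta h) (Num.min t (2 * pi - t)).
have m0 : 0 < m by rewrite !lt_min eta0 h0 t0 subr_gt0.
have [m_eta m_h] : m <= eta /\ m <= h by rewrite !ge_min !lexx !orbT.
have [m_t m_t2] : m <= t /\ m <= 2 * pi - t by rewrite !ge_min !lexx !orbT.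
have mpi : m <= pi by lra.
have c1 := cos_lt1 m0 mpi.
have I0 : 0 <= RI phi by exact: RI_ge0.
pose K := 2 * RI phi / (1 - cos m).
have K0 : 0 <= K by rewrite divr_ge0 ?mulr_ge0// subr_ge0 ltW.
(* For [r > 1 - q] the far part, at most [(1 - r) K], does not exceed [e / 2]. *)
pose q := e / 2 / (K + 1).
have q0 : 0 < q by rewrite !divr_gt0// ltr_wpDl.
exists (Num.max 2^-1 (1 - q)).
  by rewrite le_max gt_max; apply/andP; split; [lra|apply/andP; split; lra].
move=> r /andP[]; rewrite gt_max => /andP[r2 rq] r1.
have d0 : 0 < 1 - r by rewrite subr_gt0.
have r21 : 2^-1 <= r < 1 by rewrite (ltW r2).
have [N hN] : exists N, m < 2 ^+ N * (1 - r).
  have h2 : 0 <= (2^-1 : R) < 1 by apply/andP; split; lra.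
  have [N0 hN0] := exists_geom_lt m h2 d0.
  exists N0; have := hN0 N0 (leqnn _).
  by rewrite exprVn ltr_pdivrMr ?exprn_gt0// mulrC.
(* The largest dyadic radii may exceed [eta]; cutting them at [m] changes nothing where
   [|t - s| < m]. *)
pose x j := Num.min (2 ^+ j * (1 - r)) m.
have x0 j : 0 < x j by rewrite lt_min m0 mulr_gt0// exprn_gt0.
have xeta j : x j <= eta by rewrite ge_min m_eta orbT.
pose B s := \sum_(j < N.+1) 4 ^+ 3 / (4 ^+ j * (1 - r)) * (phi s * ball_ind t (x j) s) +
  2 * (1 - r) / (1 - cos m) * phi s.
have rB1 j : rint (fun s => 4 ^+ 3 / (4 ^+ j * (1 - r)) * (phi s * ball_ind t (x j) s)).
  by apply/rintZ/rint_mul_ball.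
have rBs n : rint (fun s => \sum_(j < n) 4 ^+ 3 / (4 ^+ j * (1 - r)) * (phi s * ball_ind t (x j) s)).
  elim: n => [|n IH]; first by under eq_fun do rewrite big_ord0; exact: rint_cst.
  by under eq_fun do rewrite big_ord_recr /=; exact: rintD.
have r01 : 0 <= r < 1 by apply/andP; split; lra.
apply: (@le_trans _ _ (RI B)).
  apply: RI_le_ae.
  - apply: (rint_le _ (rintZ ((1 - r) ^- 2) rp)).
      apply: measurable_funM => //.
      by have [] := borel_Pk r (cis t).
    move=> s; rewrite normrM !ger0_norm ?Pk_ge0//.
    by rewrite ler_wpM2r// Pk_le// nm_circle_mulJ.
  - by apply: rintD; [exact: rBs|exact: rintZ].
  - apply: aeW => s; rewrite /angles /= in_itv /= => /andP[s0 s2].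
    rewrite /B.
    have far0 : 0 <= 2 * (1 - r) / (1 - cos m) * phi s.
      by rewrite mulr_ge0// divr_ge0 ?mulr_ge0 ?(ltW d0)// subr_ge0 ltW.
    have near0 : 0 <= \sum_(j < N.+1) 4 ^+ 3 / (4 ^+ j * (1 - r)) * (phi s * ball_ind t (x j) s).
      apply: sumr_ge0 => j _; rewrite mulr_ge0//.
        by rewrite divr_ge0 ?exprn_ge0// mulr_ge0 ?exprn_ge0 ?(ltW d0).
      by rewrite mulr_ge0// /ball_ind ler0n.
    have [tsm|tsm] := ltP `|t - s| m.
      rewrite -[leLHS]addr0 lerD//.
      have -> : \sum_(j < N.+1) 4 ^+ 3 / (4 ^+ j * (1 - r)) * (phi s * ball_ind t (x j) s) =
          (\sum_(j < N.+1) 4 ^+ 3 / (4 ^+ j * (1 - r)) * ((`|t - s| < 2 ^+ j * (1 - r))%R : nat)%:R) * phi s.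
        rewrite mulr_suml; apply: eq_bigr => j _.
        by rewrite /ball_ind lt_min tsm andbT -[RHS]mulrA; congr (_ * _); exact: mulrC.
      rewrite ler_wpM2r//.
      apply: le_trans (dyadic_bound d0 (lt_trans tsm hN)).
      apply: (Pk_near r21 _ hs).
      rewrite normrM [`|2^-1|]ger0_norm//; have := normr_ge0 (t - s); lra.
    rewrite -[leLHS]add0r lerD// ler_wpM2r//.
    apply: (Pk_far r21 _ c1); apply: cos_away => //.
    by rewrite ler_norml; apply/andP; split; lra.
have RIs n : RI (fun s => \sum_(j < n) 4 ^+ 3 / (4 ^+ j * (1 - r)) * (phi s * ball_ind t (x j) s))
    <= e / 4 * (2 - 2 * 2^-1 ^+ n).
  elim: n => [|n IH].
    under eq_fun do rewrite big_ord0.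
    by rewrite RI_cst mul0r expr0 mulr1 subrr mulr0.
  under eq_fun do rewrite big_ord_recr /=.
  rewrite (RID (rBs n) (rB1 n)) RIZ; last exact: rint_mul_ball.
  apply: (@le_trans _ _ (e / 4 * (2 - 2 * 2^-1 ^+ n) + e / 4 * 2^-1 ^+ n)); last first.
    rewrite exprS -mulrDr ler_wpM2l//; first by lra.
    by lra.
  apply: lerD => //.
  have h1 : RI (fun s => phi s * ball_ind t (x n) s) <= e / 4 ^+ 4 * (2 ^+ n * (1 - r)).
    apply: (le_trans (heta _ (x0 n) (xeta n))).
    by rewrite ler_wpM2l ?(ltW e256)// ge_min lexx.
  have c0 : 0 <= 4 ^+ 3 / (4 ^+ n * (1 - r)) by rewrite divr_ge0 ?exprn_ge0// mulr_ge0 ?exprn_ge0 ?(ltW d0).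
  apply: (le_trans (ler_wpM2l c0 h1)); rewrite le_eqVlt; apply/orP; left; apply/eqP.
  have -> : 4 = 2 * 2 :> R by rewrite -natrM.
  rewrite !exprMn exprVn; field.
  by rewrite expf_neq0 ?pnatr_eq0//= gt_eqF.
rewrite /B (RID (rBs _)); last exact: rintZ.
rewrite RIZ//.
have h2 : 2 * (1 - r) / (1 - cos m) * RI phi <= e / 2.
  have -> : 2 * (1 - r) / (1 - cos m) * RI phi = (1 - r) * K by rewrite /K; ring.
  apply: (@le_trans _ _ (q * (K + 1))); last by rewrite /q divfK// gt_eqF// ltr_wpDl.
  by apply: ler_pM; lra.
have h3 : e / 4 * (2 - 2 * 2^-1 ^+ N.+1) <= e / 2.
  have : 0 <= e / 4 * (2 * 2^-1 ^+ N.+1) by rewrite !mulr_ge0 ?exprn_ge0//; lra.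
  by lra.
by have := RIs N.+1; lra.
Qed.

End PoissonAverages.

(** * Radial limits almost everywhere *)

Section FatouTheorem.
Context {R : realType}.
Local Notation C := R[i].
Local Notation T := (circle R).
Local Notation leb := (@lebesgue_measure R).
Local Notation D := (@angles R).
Local Notation nm := (@Normc.normc R).
Local Notation Re := (@complex.Re R).
Local Notation Im := (@complex.Im R).
Implicit Types (u f g h : T -> C) (z w : T) (r t s : R).

Lemma poisson_pointwise u t (e : R) : L1 u -> 0 < t < 2 * pi ->
  small_avg (fun s => nm (u (cis s) - u (cis t))) t -> 0 < e ->
  exists2 r0 : R, 0 <= r0 < 1 & forall r, r0 < r < 1 ->
    nm (PI u r (cis t) - u (cis t)) <= e.
Proof.
move=> hu t0 sa e0.
have [bd rd] := L1B hu (L1_cst (u (cis t))).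
have [r0 r01 h] := poisson_average (measurable_nm bd) rd (fun s => nm_ge0 _) t0 sa
  (mulr_gt0 twopi_gt0 e0).
exists r0 => // r /andP[r0r r1].
have r01' : 0 <= r < 1.
  by case/andP: r01 => r00 _; rewrite r1 andbT (le_trans r00)// ltW.
apply: (le_trans (PI_sub (cis t) (u (cis t)) hu r01')).
by rewrite ler_pdivrMl ?twopi_gt0// h// r0r.
Qed.

(** Lebesgue's differentiation theorem. Since [v] is integrable on the interval of angles only, it
    is extended by 0; therefore [t] is an interior point and the radii stay below its distance to
    the endpoints. *)
Lemma lebesgue_small_avg (v : R -> R) : measurable_fun setT v -> rint v ->
  {ae leb, forall t, 0 < t < 2 * pi -> small_avg (fun s => `|v s - v t|) t}.
Proof.
move=> mv rv.
have mDR : measurable (D : set R) by exact: measurable_itv.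
have loc : locally_integrable setT (v \_ D) by apply: integrable_locally_restrict.
apply: filterS (lebesgue_differentiation loc) => t lt /andP[t0 t2] e e0.
have Dt : t \in D by rewrite inE /angles /= in_itv /= !ltW.
(* The interval of radius [x] has length [2 x], so an average below [e / 2] is an integral below
   [e x]. *)
have e2 : 0 < e / 2 by rewrite divr_gt0.
have : \forall x \near (0 : R)^'+, (davg (v \_ D) t x < (e / 2)%:E)%E.
  exact: (lt _ (@nbhs_open_ereal_lt R 0 (fun=> e / 2) e2)).
rewrite /at_right /within /= => /nbhs_ballP[d d0 hd].
exists (Num.min (d / 2) (Num.min t (2 * pi - t))).
  by rewrite !lt_min divr_gt0// t0 subr_gt0.
move=> x x0; rewrite !le_min => /and3P[xd xt xt2].
have xdd : x < d by lra.
have := hd x; rewrite /ball /= sub0r normrN (gtr0_norm x0) => /(_ xdd x0).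
rewrite /davg /iavg lebesgue_measure_ball ?(ltW x0)// inver mulrn_eq0 /= gt_eqF//.
rewrite lte_pdivrMl; last by rewrite mulrn_wgt0.
move=> hI.
have sub : ball t x `<=` D.
  move=> s; rewrite /ball /= ltr_norml => /andP[h1 h2].
  by rewrite /angles /= in_itv /=; apply/andP; split; lra.
have -> : RI (fun s => `|v s - v t| * ball_ind t x s) =
    (\int[leb]_(s in ball t x) `|v s - v t|)%R.
  have -> : (ball t x : set R) = D `&` ball t x.
    by rewrite setIC; apply/esym/setIidPl.
  rewrite Rintegral_mkcondr; congr RI; apply/funext => s.
  rewrite patchE /ball_ind.
  have -> : (s \in (ball t x : set R)) = (`|t - s| < x) by apply/idP/idP; rewrite inE.
  by case: ltP => _; rewrite ?mulr1 ?mulr0.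
have E : (\int[leb]_(s in ball t x) (`|v s - v t|)%:E)%E =
   (\int[leb]_(y in ball t x) `|((center ((v \_ D) t) \o v \_ D) y)%:E|)%E.
  apply: eq_integral => s; rewrite inE => hs.
  have Ds : s \in D by rewrite inE; exact: sub.
  by rewrite /= /shift !patchE Dt Ds.
rewrite /Rintegral E -[leRHS]/(fine (e * x)%:E) fine_le//.
- rewrite ge0_fin_numE; last exact: integral_ge0.
  by apply: (lt_trans hI); rewrite -EFinM ltry.
- apply: (le_trans (ltW hI)); rewrite -EFinM lee_fin le_eqVlt; apply/orP; left; apply/eqP.
  by rewrite mulr2n; field.
Qed.

Lemma ae_interior : {ae leb, forall t, D t -> 0 < t < 2 * pi}.
Proof.
have h (a : R) : {ae leb, forall t, t != a}.
  exists [set a]; split; [exact: measurable_set1|exact: lebesgue_measure_set1|].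
  by move=> t /= /negP; rewrite negbK => /eqP.
apply: filterS2 (h 0) (h (2 * pi)) => t t0 t2.
by rewrite /angles /= in_itv /= => /andP[a b]; rewrite !lt_neqAle a b eq_sym t0 t2.
Qed.

Lemma small_avg_le (p q : R -> R) t : measurable_fun setT p -> measurable_fun setT q ->
  rint p -> rint q -> (forall s, p s <= q s) -> small_avg q t -> small_avg p t.
Proof.
move=> mp mq rp rq pq sq e e0; have [eta eta0 h] := sq e e0.
exists eta => // x x0 xe; apply: le_trans (h x x0 xe).
apply: RI_le; [exact: rint_mul_ball|exact: rint_mul_ball|] => s.
by rewrite ler_wpM2r// /ball_ind ler0n.
Qed.

Lemma small_avgD (p q : R -> R) t : measurable_fun setT p -> measurable_fun setT q ->
  rint p -> rint q -> small_avg p t -> small_avg q t ->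
  small_avg (fun s => p s + q s) t.
Proof.
move=> mp mq rp rq sp sq e e0.
have e2 : 0 < e / 2 by rewrite divr_gt0.
have [a a0 ha] := sp _ e2; have [b b0 hb] := sq _ e2.
exists (Num.min a b); first by rewrite lt_min a0.
move=> x x0; rewrite le_min => /andP[xa xb].
under eq_fun do rewrite mulrDl.
rewrite RID; [|exact: rint_mul_ball..].
by have := ha x x0 xa; have := hb x x0 xb; lra.
Qed.

(** Fatou's theorem, valid at the common Lebesgue points of the real and the imaginary part of
    [u]. *)
Theorem poisson_ae u : L1 u ->
  aeT (fun z => forall e : R, 0 < e -> exists2 r0 : R, 0 <= r0 < 1 & forall r, r0 < r < 1 ->
    nm (PI u r z - u z) <= e).
Proof.
move=> hu; have [[u1 u2] _] := hu.
apply: filterS3 ae_interior (lebesgue_small_avg u1 (L1_Re hu)) (lebesgue_small_avg u2 (L1_Im hu)).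
move=> t hin hR hI Dt e e0; have t02 := hin Dt.
apply: poisson_pointwise => //.
have [bd rd] := L1B hu (L1_cst (u (cis t))).
have mR : measurable_fun setT (fun s => `|Re (u (cis s)) - Re (u (cis t))|).
  by apply: measurableT_comp => //; apply: measurable_funB => //; exact: measurable_cst.
have mI : measurable_fun setT (fun s => `|Im (u (cis s)) - Im (u (cis t))|).
  by apply: measurableT_comp => //; apply: measurable_funB => //; exact: measurable_cst.
have rR : rint (fun s => `|Re (u (cis s)) - Re (u (cis t))|).
  by apply: rint_norm; apply: rintB; [exact: L1_Re|exact: rint_cst].
have rI : rint (fun s => `|Im (u (cis s)) - Im (u (cis t))|).
  by apply: rint_norm; apply: rintB; [exact: L1_Im|exact: rint_cst].
apply: (small_avg_le _ _ rd (rintD rR rI)).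
- exact: (measurable_nm bd).
- exact: measurable_funD.
- by move=> s; apply: (le_trans (nm_le_ReIm _)); rewrite ReD ImD ReN ImN.
- by apply: small_avgD => //; [exact: hR|exact: hI].
Qed.

(** All Abel sums vanish, hence so do the Poisson integrals, and [u] is their radial limit almost
    everywhere. *)
Lemma L1_uniqueness u : L1 u ->
  (forall n, CI (fun z => u z * (sval z ^+ n)^*) = 0) ->
  (forall n, CI (fun z => u z * sval z ^+ n.+1) = 0) -> eqT u (fun=> 0).
Proof.
move=> hu h1 h2; apply: aeTW (poisson_ae hu) _ => z hz.
apply: nm_eq0; apply/eqP; rewrite eq_le nm_ge0 andbT.
apply/ler_addgt0Pr => e e0; rewrite add0r.
have [r0 /andP[r00 r01] h] := hz e e0.
pose r := (r0 + 1) / 2; have r1 : r0 < r < 1 by rewrite /r; apply/andP; split; lra.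
have := h r r1.
have -> : PI u r z = 0.
  apply: nm_eq0; apply/eqP; rewrite eq_le nm_ge0 andbT.
  have r01' : 0 <= r < 1 by case/andP: r1 => ? ?; apply/andP; split; lra.
  apply: (@nm_le_lim _ (fun N => abel u r N z)); first exact: cvg_abel.
  move=> N; rewrite /abel !big1 ?addr0 ?nm0// => n _.
    by rewrite /cfm h2 !mulr0.
  by rewrite /cf h1 !mulr0.
by rewrite sub0r nmN.
Qed.

(** Radii of balls in [C^o] are positive elements of [C], hence real; this passes to real radii and
    the real-valued modulus. *)
Lemma cvg_CP {X : Type} (F : set_system X) {FF : Filter F} (u : X -> C) (l : C) :
  (u x : C^o) @[x --> F] --> (l : C^o) <->
  (forall e : R, 0 < e -> \forall x \near F, nm (l - u x) < e).
Proof.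
split.
  move=> /cvgrPdist_lt h e e0.
  have e0C : 0 < e%:C :> C by rewrite ltcR.
  by apply: filterS (h _ e0C) => x; rewrite normrE_nm ltcR.
move=> h; apply/cvgrPdist_lt => e e0.
have [e1 e2] : complex.Im e = 0 /\ 0 < Re e by move: e0; rewrite ltcE /= => /andP[/eqP ? ?].
have eE : e = (Re e)%:C by apply: complex_ext.
by apply: filterS (h _ e2) => x; rewrite normrE_nm eE ltcR.
Qed.

Lemma cvg_nmP (u : nat -> C) (l : C) :
  (u n : C^o) @[n --> \oo] --> (l : C^o) <-> (fun n => nm (u n - l)) @ \oo --> (0 : R).
Proof.
split.
  move=> /cvg_CP h; apply/cvgrPdist_lt => e e0; apply: filterS (h e e0) => n.
  by rewrite sub0r normrN ger0_norm ?nm_ge0// nmBC.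
move=> /cvgrPdist_lt h; apply/cvg_CP => e e0; apply: filterS (h e e0) => n.
by rewrite sub0r normrN ger0_norm ?nm_ge0// nmBC.
Qed.

Lemma borel_lim (u : nat -> T -> C) f : (forall k, borel (u k)) ->
  (forall z, (fun k => nm (u k z - f z)) @ \oo --> (0 : R)) -> borel f.
Proof.
move=> bu cu.
have aux (p : C -> R) : (forall z w : C, p (z - w) = p z - p w) ->
    (forall z : C, `|p z| <= nm z) ->
    (forall k, measurable_fun setT (fun t : R => p (u k (cis t)))) ->
    measurable_fun setT (fun t : R => p (f (cis t))).
  move=> pB pn mp.
  apply: (measurable_fun_cvg (h := fun k t => p (u k (cis t)))); first by [].
  move=> t _; apply/cvgrPdist_le => e e0.
  have /cvgrPdist_le/(_ e e0) := cu (cis t).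
  apply: filterS => k; rewrite sub0r normrN ger0_norm ?nm_ge0//.
  by apply: le_trans; rewrite -pB nmBC; exact: pn.
split; apply: aux.
- by move=> z w; rewrite ReD ReN.
- exact: Re_le_nm.
- by move=> k; case: (bu k).
- by move=> z w; rewrite ImD ImN.
- exact: Im_le_nm.
- by move=> k; case: (bu k).
Qed.

End FatouTheorem.

(** * H2 as the space of L2 functions without negative Fourier coefficients *)

Section HardyCharacterization.
Context {R : realType}.
Local Notation C := R[i].
Local Notation T := (circle R).
Local Notation leb := (@lebesgue_measure R).
Local Notation D := (@angles R).
Local Notation nm := (@Normc.normc R).
Local Notation Re := (@complex.Re R).
Local Notation Im := (@complex.Im R).
Implicit Types (u f g h : T -> C) (z w : T) (r t s : R).

(** The Fourier side of [H2]. The integral against [z^(n+1)] is [2 pi] times the coefficient of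
    index [-(n+1)], so index 0 is left free. *)
Definition an f := L2 f /\ forall n, CI (fun z => f z * sval z ^+ n.+1) = 0.

Lemma an_L2 f : an f -> L2 f. Proof. by case. Qed.

Definition approx_by_pol f := forall e : R, 0 < e ->
  exists a N, N2 (fun z => f z - pol a N z) <= e.

Lemma CI_pol_exp a N n : CI (fun z => pol a N z * sval z ^+ n.+1) = 0.
Proof.
under eq_fun do rewrite /pol mulr_suml.
rewrite (@CI_sum _ _ _ (fun (j : 'I_N) (z : T) => a j * sval z ^+ j * sval z ^+ n.+1)).
  apply: big1 => j _; under eq_fun do rewrite -mulrA -exprD addnS.
  by rewrite CIZ ?CI_expS ?mulr0//; exact/L2_L1/Linf_L2/Linf_expn.
by move=> j; apply/L1_mul_exp/L1Z/L2_L1/Linf_L2/Linf_expn.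
Qed.

Lemma approx_an f : L2 f -> approx_by_pol f -> an f.
Proof.
move=> hf ap; split => // n; apply: CI_mul_eq0_closed => //.
  exact/Linf_L2/Linf_expn.
move=> e e0; have [a [N h]] := ap e e0; exists (pol a N); split.
- exact/Linf_L2/Linf_pol.
- rewrite (_ : N2 _ = N2 (fun z => f z - pol a N z))//.
  by congr RI; apply/funext => t; rewrite nmBC.
- exact: CI_pol_exp.
Qed.

Lemma tail_small (b : nat -> R) (B : R) : (forall n, 0 <= b n) ->
  (forall N, \sum_(j < N) b j <= B) ->
  forall e : R, 0 < e -> exists N, forall M, (N <= M)%N -> \sum_(j < M) b j - \sum_(j < N) b j <= e.
Proof.
move=> b0 hB e e0; pose S := [set x : R | exists N, x = \sum_(j < N) b j].
have hS : has_sup S.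
  split; first by exists 0; exists 0%N; rewrite big_ord0.
  by exists B => _ [N ->].
have [_ [N ->] hN] := sup_adherent e0 hS.
exists N => M _; have : \sum_(j < M) b j <= sup S.
  by apply: ub_le_sup; [case: hS|exists M].
by move=> h; lra.
Qed.

(** A sequence of radii increasing to 1, by which radial limits enter theorems on sequences such as
    Fatou's lemma. *)
Definition rk k : R := 1 - k.+2%:R^-1.

Lemma rk01 k : 0 <= rk k < 1.
Proof.
by rewrite /rk subr_ge0 invf_le1 ?ler1n ?ltr0n//= gtrBl invr_gt0 ltr0n.
Qed.

Lemma cvg_rk : rk @ \oo --> (1 : R).
Proof.
rewrite /rk -[X in _ --> X](subr0 1); apply: cvgB; first exact: cvg_cst.
have := @cvg_harmonic R; rewrite -(cvg_shiftS).
by apply: cvg_trans; apply: near_eq_cvg; apply: nearW => n /=.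
Qed.

Lemma realCX (x : R) n : (x ^+ n)%:C = x%:C ^+ n :> C.
Proof. exact: rmorphXn. Qed.

Lemma cvg_rkX j : (fun k => rk k ^+ j) @ \oo --> (1 : R).
Proof.
elim: j => [|j IH]; first by under eq_fun do rewrite expr0; exact: cvg_cst.
under eq_fun do rewrite exprS.
have : (fun k => rk k * rk k ^+ j) @ \oo --> (1 * 1 : R).
  by apply: cvgM => //; exact: cvg_rk.
by rewrite mulr1.
Qed.

Lemma squeeze_add (x p q : nat -> R) : (forall k, 0 <= x k <= p k + q k) ->
  p @ \oo --> (0 : R) -> q @ \oo --> (0 : R) -> x @ \oo --> (0 : R).
Proof.
move=> h /cvgrPdist_lt hp /cvgrPdist_lt hq; apply/cvgrPdist_lt => e e0.
have e2 : 0 < e / 2 by rewrite divr_gt0.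
apply: filterS2 (hp _ e2) (hq _ e2) => k; rewrite !sub0r !normrN => h1 h2.
have /andP[x0 xpq] := h k; rewrite ger0_norm//.
have := ler_norm (p k); have := ler_norm (q k); lra.
Qed.

Lemma rk_at_left (P : R -> Prop) : (\forall r \near (1 : R)^'-, P r) ->
  \forall k \near \oo, P (rk k).
Proof.
rewrite /at_left /within /= => /nbhs_ballP[e e0 h].
have /cvgrPdist_lt/(_ e e0) := cvg_rk; apply: filterS => k hk.
by apply: h => //; case/andP: (rk01 k).
Qed.

Lemma cvg_sum_ord N (u : nat -> nat -> R) (l : nat -> R) :
  (forall j, u j @ \oo --> l j) ->
  (fun k => \sum_(j < N) u j k) @ \oo --> \sum_(j < N) l j.
Proof.
move=> h; elim: N => [|N IH].
  by rewrite big_ord0; under eq_fun do rewrite big_ord0; exact: cvg_cst.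
rewrite big_ord_recr /=; under eq_fun do rewrite big_ord_recr /=.
exact: cvgD.
Qed.

Lemma sum_ord_tail (V : zmodType) (x : nat -> V) N M : (N <= M)%N ->
  \sum_(j < M) x j - \sum_(j < N) x j = \sum_(j < M) (if (N <= j)%N then x j else 0).
Proof.
move=> /subnKC <-; elim: (M - N)%N => [|k IH].
  by rewrite addn0 subrr big1// => j _; rewrite leqNgt ltn_ord.
by rewrite addnS !big_ord_recr /= leq_addr -IH addrAC.
Qed.

Lemma cvg_nm_unique (x : nat -> C) (l1 l2 : C) :
  (fun N => nm (x N - l1)) @ \oo --> (0 : R) ->
  (fun N => nm (x N - l2)) @ \oo --> (0 : R) -> l1 = l2.
Proof.
move=> c1 c2; apply/eqP; rewrite -subr_eq0; apply/eqP/nm_eq0/eqP.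
rewrite eq_le nm_ge0 andbT.
apply: (@nm_le_lim _ (fun=> 0)) => [|N]; last by rewrite nm0.
apply: squeeze_add c1 c2 => N; rewrite nm_ge0 /=.
rewrite sub0r nmN (_ : l1 - l2 = - (x N - l1) + (x N - l2)); last by ring.
by apply: (le_trans (nmD _ _)); rewrite nmN.
Qed.

(** * Power series in the disc, their dilates and their boundary functions *)

Section PowerSeries.
Variables (F : C -> C) (a : nat -> C).
Hypothesis Fa : forall z : C, `|z| < 1 ->
  series (fun n => a n * z ^+ n : C^o) @ \oo --> (F z : C^o).

(** A term is a difference of consecutive partial sums, which from [N0] on lie within 1 of the
    limit: this gives the 2. The finitely many remaining terms are added to the bound. *)
Lemma pseries_coef_bound rho : 0 <= rho < 1 ->
  exists2 K : R, 0 <= K & forall n, nm (a n) * rho ^+ n <= K.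
Proof.
move=> /andP[r0 r1].
have z1 : `|rho%:C : C| < 1 by rewrite normrE_nm ltcR nm_realC ger0_norm.
have /cvg_nmP h := Fa z1.
have /cvgrPdist_lt/(_ 1 ltr01)[N0 _ hN] := h.
have hN' n : (N0 <= n)%N -> nm (a n) * rho ^+ n <= 2.
  move=> Nn; have h1 := hN n Nn; have h2 := hN n.+1 (leqW Nn).
  move: h1 h2; rewrite !sub0r !normrN !ger0_norm ?nm_ge0// => h1 h2.
  have -> : nm (a n) * rho ^+ n = nm (a n * rho%:C ^+ n).
    by rewrite nmM nmX nm_realC ger0_norm.
  have -> : a n * rho%:C ^+ n =
     (series (fun n => a n * rho%:C ^+ n : C^o) n.+1 - F rho%:C) -
     (series (fun n => a n * rho%:C ^+ n : C^o) n - F rho%:C).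
    by rewrite !seriesEnat /= big_nat_recr //=; ring.
  by apply: (le_trans (nmD _ _)); rewrite nmN; lra.
exists (2 + \sum_(j < N0) nm (a j) * rho ^+ j).
  by rewrite addr_ge0// sumr_ge0// => j _; rewrite mulr_ge0 ?nm_ge0 ?exprn_ge0.
move=> n; have s0 (P : pred 'I_N0) : 0 <= \sum_(j < N0 | P j) nm (a j) * rho ^+ j.
  by rewrite sumr_ge0// => j _; rewrite mulr_ge0 ?nm_ge0 ?exprn_ge0.
have [Nn|nN] := leqP N0 n.
  by rewrite -[leLHS]addr0 lerD ?s0// hN'.
rewrite (bigD1 (Ordinal nN)) //= addrCA lerDl addr_ge0//.
Qed.

Definition Fr r (z : T) : C := F (r%:C * sval z).
Definition ar r n : C := a n * r%:C ^+ n.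

Lemma pol_ar r N z : pol (ar r) N z = series (fun n => a n * (r%:C * sval z) ^+ n : C^o) N.
Proof.
rewrite seriesEord /= /pol; apply: eq_bigr => j _.
by rewrite /ar -mulrA -exprMn.
Qed.

Lemma pol_Fr r z : 0 <= r < 1 -> (fun N => nm (pol (ar r) N z - Fr r z)) @ \oo --> (0 : R).
Proof.
move=> /andP[r0 r1].
have z1 : `|r%:C * sval z| < 1 by rewrite normrE_nm ltcR nm_rw ?nm_circle.
have /cvg_nmP := Fa z1.
by under [X in _ -> X @ _ --> _]eq_fun do rewrite pol_ar.
Qed.

Lemma borel_Fr r : 0 <= r < 1 -> borel (Fr r).
Proof.
move=> r01; apply: (borel_lim (u := fun N => pol (ar r) N)).
  by move=> k; exact/Linf_borel/Linf_pol.
by move=> z; exact: pol_Fr.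
Qed.

(** The coefficients are bounded by [K rho^-n] at a radius [rho] halfway between [r] and 1, so the
    terms at radius [r] decay like [(r / rho)^n], uniformly on the circle. *)
Lemma pol_Fr_unif r : 0 <= r < 1 -> exists K q : R, [/\ 0 <= K, 0 <= q < 1 &
  forall N z, nm (pol (ar r) N z - Fr r z) <= K * q ^+ N].
Proof.
move=> /andP[r0 r1]; pose rho := (r + 1) / 2.
have rho01 : 0 <= rho < 1 by rewrite /rho; apply/andP; split; lra.
have rhop : 0 < rho by rewrite /rho; lra.
have [K K0 hK] := pseries_coef_bound rho01.
pose q := r / rho.
have q0 : 0 <= q by rewrite divr_ge0// ltW.
have q1 : q < 1 by rewrite ltr_pdivrMr// mul1r /rho; lra.
have q1' : 0 < 1 - q by rewrite subr_gt0.
have hq n : nm (ar r n) <= K * q ^+ n.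
  rewrite /ar nmM nmX nm_realC ger0_norm//.
  have -> : r = rho * q by rewrite /q mulrC divfK// gt_eqF.
  by rewrite exprMn mulrA ler_wpM2r ?exprn_ge0.
exists (K / (1 - q)), q; split; [by rewrite divr_ge0// ltW|by rewrite q0|].
move=> N z; have step M : nm (pol (ar r) (N + M) z - pol (ar r) N z) <=
    K / (1 - q) * (q ^+ N - q ^+ (N + M)).
  elim: M => [|M IH]; first by rewrite addn0 !subrr nm0 mulr0.
  rewrite addnS /pol big_ord_recr /= -/(pol _ _ _).
  rewrite addrAC; apply: (le_trans (nmD _ _)); apply: (le_trans (lerD IH (lexx _))).
  rewrite nmM nmX nm_circle expr1n mulr1.
  apply: (le_trans (lerD (lexx _) (hq _))).
  rewrite exprS le_eqVlt; apply/orP; left; apply/eqP; field.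
  by rewrite gt_eqF.
rewrite nmBC; apply: (@nm_le_lim _ (fun M => pol (ar r) (M + N) z - pol (ar r) N z)).
  have := pol_Fr z (r := r); rewrite r0 r1 => /(_ isT).
  rewrite -(cvg_shiftn N) => h.
  rewrite (_ : (fun _ => _) = (fun M => nm (pol (ar r) (M + N) z - Fr r z)))//.
  apply/funext => M; congr nm; ring.
move=> M; rewrite addnC; apply: (le_trans (step M)).
by rewrite ler_wpM2l ?divr_ge0 ?(ltW q1')// gerBl exprn_ge0.
Qed.

Lemma L2_Fr r : 0 <= r < 1 -> L2 (Fr r).
Proof.
move=> r01; have [K [q [K0 q01 h]]] := pol_Fr_unif r01.
apply/Linf_L2/Linf_bound; first exact: borel_Fr.
exists K; apply: aeT_all => z; have := h 0%N z.
by rewrite /pol big_ord0 sub0r nmN expr0 mulr1.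
Qed.

Lemma N2_unif f (K : R) : L2 f -> (forall z, nm (f z) <= K) -> N2 f <= K ^+ 2 * (2 * pi).
Proof.
move=> [bf rf] h; rewrite -RI_cst; apply: RI_le => //; first exact: rint_cst.
by move=> t; have := h (cis t); have := nm_ge0 (f (cis t)); nra.
Qed.

Lemma cf_Fr r n : 0 <= r < 1 -> cf (Fr r) n = ar r n.
Proof.
move=> r01; have [K [q [K0 q01 h]]] := pol_Fr_unif r01.
apply/eqP; rewrite -subr_eq0; apply/eqP/nm_eq0/eqP; rewrite eq_le nm_ge0 andbT.
apply/ler_addgt0Pr => e e0; rewrite add0r.
have [N0 hN] := exists_geom_lt K q01 e0.
have := hN (maxn N0 n.+1) (leq_maxl _ _); set N := maxn _ _ => hKN.
have <- : cf (pol (ar r) N) n = ar r n by rewrite cf_pol /N leq_max leqnn orbT.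
have lF := L2_Fr r01; have lp : L2 (pol (ar r) N) by exact/Linf_L2/Linf_pol.
rewrite /cf -mulrBr -CIB; [|exact/L1_mul_expJ/L2_L1..].
rewrite nmM nm_twopiV ler_pdivrMl ?twopi_gt0//.
have l1 : L1 (fun z => Fr r z * (sval z ^+ n)^* - pol (ar r) N z * (sval z ^+ n)^*).
  by apply: L1B; exact/L1_mul_expJ/L2_L1.
apply: (le_trans (nm_CI l1)).
have -> : 2 * pi * e = RI (fun=> e) by rewrite RI_cst mulrC.
apply: RI_le; [by case: l1|exact: rint_cst|] => t.
rewrite -mulrBl nmM nmJ nmX nm_circle expr1n mulr1 nmBC.
by apply: (le_trans (h N (cis t))); exact: ltW.
Qed.

(** Bessel's inequality for the dilates; for a fixed number of terms the radius can then tend to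
    1. *)
Lemma coef_summable (M : R) : (forall r, 0 <= r < 1 -> N2 (Fr r) <= M) ->
  forall N, 2 * pi * \sum_(j < N) nm (a j) ^+ 2 <= M.
Proof.
move=> hM N; rewrite mulr_sumr.
have cv : (fun k => \sum_(j < N) (2 * pi * (nm (a j) * rk k ^+ j) ^+ 2)) @ \oo -->
    \sum_(j < N) (2 * pi * nm (a j) ^+ 2).
  apply: (@cvg_sum_ord N (fun j k => 2 * pi * (nm (a j) * rk k ^+ j) ^+ 2)
    (fun j => 2 * pi * nm (a j) ^+ 2)) => j; apply: cvgM; first exact: cvg_cst.
  have c1 : (fun k => nm (a j) * rk k ^+ j) @ \oo --> nm (a j).
    rewrite -[X in _ --> X](mulr1 (nm (a j))).
    by apply: cvgM; [exact: cvg_cst|exact: cvg_rkX].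
  by rewrite expr2; exact: cvgM.
rewrite -(cvg_lim _ cv)//; apply: limr_le; first by apply/cvg_ex; eexists; exact: cv.
apply: nearW => k; rewrite -mulr_sumr; apply: le_trans (hM _ (rk01 k)).
apply: le_trans (bessel N (L2_Fr (rk01 k))); rewrite le_eqVlt; apply/orP; left; apply/eqP; congr (_ * _).
apply: eq_bigr => j _; rewrite cf_Fr ?rk01// /ar nmM nmX nm_realC ger0_norm//.
by case/andP: (rk01 k).
Qed.

(** The tail of the squared coefficients bounds the distance of a dilate to its polynomial of length
    [N], uniformly in the radius. Fatou's lemma is applied along the partial sums at a fixed radius,
    and then along the radii. *)
Lemma boundary_approx f (M : R) : borel f ->
  (forall r, 0 <= r < 1 -> N2 (Fr r) <= M) ->
  aeT (fun z => (F (r%:C * sval z) : C^o) @[r --> (1 : R)^'-] --> (f z : C^o)) ->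
  L2 f /\ approx_by_pol f.
Proof.
move=> bf hM cf.
have hS N := coef_summable hM N.
have cv : aeT (fun z => (fun k => nm (Fr (rk k) z - f z)) @ \oo --> (0 : R)).
  apply: aeTW cf _ => z /cvg_CP h; apply/cvgrPdist_lt => e e0.
  apply: filterS (rk_at_left (h e e0)) => k.
  by rewrite sub0r normrN ger0_norm ?nm_ge0// nmBC.
have [lf _] := N2_fatou (fun k => L2_Fr (rk01 k)) bf cv (fun k => hM _ (rk01 k)).
split => // e e0.
have p2 : 0 < e / (2 * pi) by rewrite divr_gt0 ?twopi_gt0.
have hS' N : \sum_(j < N) nm (a j) ^+ 2 <= M / (2 * pi).
  by rewrite ler_pdivlMr ?twopi_gt0// mulrC.
have [N hN] := tail_small (fun n => sqr_ge0 (nm (a n))) hS' p2.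
exists a, N.
have polM k M' : (N <= M')%N ->
    N2 (fun z => pol (ar (rk k)) M' z - pol (ar (rk k)) N z) <= e.
  move=> NM; pose b n := if (N <= n)%N then ar (rk k) n else 0.
  have -> : (fun z => pol (ar (rk k)) M' z - pol (ar (rk k)) N z) = pol b M'.
    apply/funext => z; rewrite /pol (sum_ord_tail (fun j => ar (rk k) j * sval z ^+ j) NM).
    by apply: eq_bigr => j _; rewrite /b; case: ifP => //; rewrite mul0r.
  rewrite N2_pol mulrC -ler_pdivlMr ?twopi_gt0//; apply: le_trans (hN M' NM).
  rewrite (sum_ord_tail (fun j => nm (a j) ^+ 2) NM); apply: ler_sum => j _.
  rewrite /b; case: ifP => _; last by rewrite nm0 expr0n.
  rewrite ler_sqr ?nnegrE ?nm_ge0// /ar nmM nmX nm_realC.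
  have /andP[k0 k1] := rk01 k.
  by rewrite ger0_norm// ler_piMr ?nm_ge0// exprn_ile1// ltW.
have polF k : L2 (fun z => Fr (rk k) z - pol (ar (rk k)) N z) /\
    N2 (fun z => Fr (rk k) z - pol (ar (rk k)) N z) <= e.
  apply: (N2_fatou (u := fun M' z => pol (ar (rk k)) (M' + N) z - pol (ar (rk k)) N z)).
  - by move=> M'; apply: L2B; exact/Linf_L2/Linf_pol.
  - by apply: borelB; [exact/borel_Fr/rk01|exact/Linf_borel/Linf_pol].
  - apply: aeT_all => z; have := pol_Fr z (rk01 k); rewrite -(cvg_shiftn N) => h.
    rewrite (_ : (fun _ => _) = (fun M => nm (pol (ar (rk k)) (M + N) z - Fr (rk k) z)))//.
    by apply/funext => M'; congr nm; ring.
  - by move=> M'; apply: polM; rewrite leq_addl.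
have [] := N2_fatou (u := fun k z => Fr (rk k) z - pol (ar (rk k)) N z)
  (f := fun z => f z - pol a N z) (B := e).
- by move=> k; case: (polF k).
- by apply: borelB => //; exact/Linf_borel/Linf_pol.
- have cvp z : (fun k => nm (pol (ar (rk k)) N z - pol a N z)) @ \oo --> (0 : R).
    have cs : (fun k => \sum_(j < N) nm (a j) * (1 - rk k ^+ j)) @ \oo -->
        \sum_(j < N) nm (a j) * (1 - 1 ^+ j).
      apply: (@cvg_sum_ord N (fun j k => nm (a j) * (1 - rk k ^+ j))
        (fun j => nm (a j) * (1 - 1 ^+ j))) => j; apply: cvgM; first exact: cvg_cst.
      apply: cvgB; first exact: cvg_cst.
      by rewrite expr1n; exact: cvg_rkX.
    move: cs; rewrite [X in _ --> X]big1 => [cs|j _]; last by rewrite expr1n subrr mulr0.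
    apply: (squeeze_cvgr _ (cvg_cst 0) cs).
    apply: nearW => k; rewrite nm_ge0 /= /pol -sumrB.
    apply: (le_trans (nm_sum _ _ _)); apply: ler_sum => j _.
    rewrite -mulrBl nmM nmX nm_circle expr1n mulr1 /ar.
    have -> : a j * (rk k)%:C ^+ j - a j = - (a j * (1 - rk k ^+ j)%:C).
      by rewrite (realCB 1 (rk k ^+ j)) realCX; ring.
    rewrite nmN nmM nm_realC ger0_norm// subr_ge0.
    by have /andP[k0 k1] := rk01 k; rewrite exprn_ile1// ltW.
  apply: aeTW cv _ => z cz.
  apply: squeeze_add cz (cvp z) => k; rewrite nm_ge0 /=.
  apply: le_trans (_ : nm ((Fr (rk k) z - f z) - (pol (ar (rk k)) N z - pol a N z)) <= _).
    by rewrite le_eqVlt; apply/orP; left; apply/eqP; congr nm; ring.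
  by apply: (le_trans (nmD _ _)); rewrite nmN.
- by move=> k; case: (polF k).
- by [].
Qed.

End PowerSeries.

Lemma H2_approx f : H2 f -> L2 f /\ approx_by_pol f.
Proof.
move=> [F [[a Fa] [M hM] [bf cf]]].
apply: (boundary_approx Fa bf (M := M)) => // r r01.
have := hM r r01; rewrite -lee_fin; apply: le_trans.
rewrite -RI_EFin; first by [].
by case: (L2_Fr Fa r01).
Qed.

Lemma H2_an f : H2 f -> an f.
Proof. by move=> /H2_approx[h1 h2]; exact: approx_an. Qed.

Lemma abel_an f r N z : an f -> abel f r N z = pol (fun n => cf f n * r%:C ^+ n) N z.
Proof.
move=> [lf hf]; rewrite /abel [X in _ + X]big1 ?addr0 => [|n _]; last first.
  by rewrite /cfm hf !mulr0.
by apply: eq_bigr => n _; rewrite exprMn; ring.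
Qed.

(** The Fourier coefficients serve as Taylor coefficients. As those of negative index vanish, the
    dilates are the Poisson integrals of [f], whose radial limits are known; the means are bounded
    by Bessel's inequality and Fatou's lemma. *)
Lemma an_H2 f : an f -> H2 f.
Proof.
move=> hf; have [lf fn] := hf; pose a := cf f.
have b0 := sqr_ge0.
have bs N : \sum_(j < N) nm (a j) ^+ 2 <= N2 f / (2 * pi).
  by rewrite ler_pdivlMr ?twopi_gt0// mulrC bessel.
pose K := 1 + N2 f / (2 * pi).
have aK n : nm (a n) <= K.
  have : nm (a n) ^+ 2 <= N2 f / (2 * pi).
    apply: le_trans (bs n.+1); rewrite big_ord_recr /= lerDr.
    by rewrite sumr_ge0// => j _; rewrite sqr_ge0.
  by have := nm_ge0 (a n); rewrite /K; nra.
pose u (z : C) k := \sum_(n < k) a n * z ^+ n.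
pose F (z : C) : C := limn (fun k => Re (u z k)) +i* limn (fun k => Im (u z k)).
have cF (z : C) : nm z < 1 -> (fun k => nm (u z k - F z)) @ \oo --> (0 : R).
  move=> z1; apply: cvg_complex.
  have gc : cvgn (series (fun k => K * nm z ^+ k)).
    have -> : (fun k => K * nm z ^+ k) = geometric K (nm z) by apply/funext.
    by apply: is_cvg_geometric_series; rewrite ger0_norm ?nm_ge0.
  apply: series_le_cvg gc => n.
  - exact: nm_ge0.
  - by rewrite mulr_ge0 ?exprn_ge0 ?nm_ge0// (le_trans (nm_ge0 (a n))).
  - rewrite /u big_ord_recr /= addrAC subrr add0r nmM nmX.
    by rewrite ler_wpM2r ?exprn_ge0 ?nm_ge0.
have PIF r z : 0 <= r < 1 -> F (r%:C * sval z) = PI f r z.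
  move=> r01; have /andP[r0 r1] := r01.
  have c1 := cvg_abel z (L2_L1 lf) r01.
  have z1 : nm (r%:C * sval z) < 1 by rewrite nm_rw ?nm_circle.
  have c2 := cF _ z1.
  apply: (cvg_nm_unique c2); apply: cvg_trans c1; apply: near_eq_cvg; apply: nearW => N.
  congr (nm (_ - _)); rewrite abel_an//; apply: eq_bigr => n _.
  by rewrite /a exprMn mulrA.
exists F; split.
- exists a => z; rewrite normrE_nm ltcR => z1; apply/cvg_nmP.
  have := cF z z1; rewrite /series /=.
  by under [X in _ -> X @ _ --> _]eq_fun do rewrite big_mkord.
- exists (N2 f) => r r01.
  have [] := N2_fatou (u := fun N z => pol (fun n => a n * r%:C ^+ n) N z)
    (f := fun z => F (r%:C * sval z)) (B := N2 f).
  + by move=> k; exact/Linf_L2/Linf_pol.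
  + apply: (borel_lim (u := fun N z => abel f r N z)).
      move=> k; rewrite (_ : (fun z => _) = pol (fun n => cf f n * r%:C ^+ n) k).
        exact/Linf_borel/Linf_pol.
      by apply/funext => z; rewrite abel_an.
    by move=> z; rewrite PIF//; exact: (cvg_abel z (L2_L1 lf) r01).
  + apply: aeT_all => z; rewrite PIF//.
    have := cvg_abel z (L2_L1 lf) r01.
    by under eq_fun do rewrite abel_an//.
  + move=> k; rewrite N2_pol; apply: le_trans (bessel k lf).
    rewrite ler_pM2l ?twopi_gt0//; apply: ler_sum => j _.
    rewrite ler_sqr ?nnegrE ?nm_ge0// nmM nmX nm_realC.
    have /andP[k0 k1] := r01.
    by rewrite ger0_norm// ler_piMr ?nm_ge0// exprn_ile1// ltW.
  by move=> [_ rF] h; rewrite RI_EFin// lee_fin.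
- split; first exact: L2_borel.
  apply: aeTW (poisson_ae (L2_L1 lf)) _ => z hz.
  apply/cvg_CP => e e0.
  have e2 : 0 < e / 2 by rewrite divr_gt0.
  have [r0 /andP[r00 r01] h] := hz _ e2.
  rewrite /at_left /within /=; apply/nbhs_ballP; exists (1 - r0).
    by rewrite /= subr_gt0.
  move=> r; rewrite /ball /= ltr_norml => /andP[_ hr] r1.
  have r0r : r0 < r by lra.
  rewrite PIF; last by rewrite r1 andbT ltW// (le_lt_trans r00).
  rewrite nmBC; apply: (@le_lt_trans _ _ (e / 2)); last by lra.
  by apply: h; rewrite r0r.
Qed.

Lemma H2P f : H2 f <-> an f.
Proof. by split; [exact: H2_an|exact: an_H2]. Qed.

Lemma an_approx f : an f -> approx_by_pol f.
Proof. by move=> /an_H2/H2_approx[]. Qed.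

Lemma Hinf_an f : Hinf f -> Linf f /\ an f.
Proof.
move=> [F [[a Fa] [M hM] [bf cf]]].
(* A crude bound suffices: one radius at which [F] is within 1 of its radial limit. *)
have hb : aeT (fun z => nm (f z) <= M + 1).
  apply: aeTW cf _ => z /cvg_CP/(_ 1 ltr01)/rk_at_left[k _ /(_ k (leqnn _)) /= h].
  have z1 : `|(rk k)%:C * sval z| < 1.
    by rewrite normrE_nm ltcR nm_rw ?nm_circle//; case/andP: (rk01 k).
  have := hM _ z1; rewrite normrE_nm lecR => h2.
  have -> : f z = (f z - F ((rk k)%:C * sval z)) + F ((rk k)%:C * sval z) by ring.
  by apply: (le_trans (nmD _ _)); rewrite addrC lerD// ltW.
split; first by apply: Linf_bound => //; exists (M + 1).
have [] := boundary_approx Fa bf (M := (Num.max M 0) ^+ 2 * (2 * pi)) => //.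
  move=> r r01; apply: N2_unif; first exact: (L2_Fr Fa).
  move=> z; have /andP[r0 r1] := r01.
  have z1 : `|r%:C * sval z| < 1 by rewrite normrE_nm ltcR nm_rw ?nm_circle.
  by have := hM _ z1; rewrite normrE_nm lecR le_max => ->.
exact: approx_an.
Qed.

End HardyCharacterization.

(** * Products of analytic functions and Toeplitz kernels on the Fourier side *)

Section Beurling.
Context {R : realType}.
Local Notation C := R[i].
Local Notation T := (circle R).
Local Notation leb := (@lebesgue_measure R).
Local Notation D := (@angles R).
Local Notation nm := (@Normc.normc R).
Local Notation Re := (@complex.Re R).
Local Notation Im := (@complex.Im R).
Implicit Types (u f g h p q : T -> C) (z w : T) (r t s : R) (P Q : {poly C}).

Lemma conjcN (c : C) : (- c)^* = - c^*.
Proof. exact: rmorphN. Qed.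

Lemma Re_realC (x : R) : Re x%:C = x.
Proof. by []. Qed.

Lemma L2_eqT f g : L2 f -> borel g -> eqT f g -> L2 g.
Proof.
move=> [bf rf] bg fg; split => //.
apply: (rint_le_ae (measurable_sqr_nm bg) rf).
by apply: filterS (aeT_ae fg) => t h Dt; rewrite -h// ger0_norm// sqr_ge0.
Qed.

Lemma an_eqT f g : an f -> borel g -> eqT f g -> an g.
Proof.
move=> [lf hf] bg fg; have lg := L2_eqT lf bg fg; split => // n.
rewrite -(hf n); apply: eqT_CI.
- exact/L1_borel/L1_mul_exp/L2_L1.
- exact/L1_borel/L1_mul_exp/L2_L1.
- by apply: aeTW fg _ => z ->.
Qed.

Lemma anD f g : an f -> an g -> an (fun z => f z + g z).
Proof.
move=> [lf hf] [lg hg]; split => [|n]; first exact: L2D.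
under eq_fun do rewrite mulrDl.
by rewrite CID ?hf ?hg ?addr0//; exact/L1_mul_exp/L2_L1.
Qed.

Lemma anZ c f : an f -> an (fun z => c * f z).
Proof.
move=> [lf hf]; split => [|n]; first exact: L2Z.
under eq_fun do rewrite -mulrA.
by rewrite CIZ ?hf ?mulr0//; exact/L1_mul_exp/L2_L1.
Qed.

(** The same functions as [pol], now with the ring operations of [{poly C}], which the extremal
    problem uses. *)
Definition pe P z : C := P.[sval z].

Lemma pe_pol P : pe P = pol (fun i => P`_i) (size P).
Proof. by apply/funext => z; rewrite /pe horner_coef. Qed.

Lemma pol_pe a N : pol a N = pe (\poly_(j < N) a j).
Proof. by apply/funext => z; rewrite /pe horner_poly. Qed.

Lemma pe_1DXM P z : pe (1 + 'X * P) z = 1 + sval z * pe P z.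
Proof. by rewrite /pe hornerD -polyC1 hornerC hornerM hornerX. Qed.

Lemma pe_XM P z : pe ('X * P) z = sval z * pe P z.
Proof. by rewrite /pe hornerM hornerX. Qed.

Lemma peD P Q z : pe (P + Q) z = pe P z + pe Q z.
Proof. exact: hornerD. Qed.

Lemma peZ c P z : pe (c *: P) z = c * pe P z.
Proof. exact: hornerZ. Qed.

Lemma Linf_pe P : Linf (pe P).
Proof. by rewrite pe_pol; exact: Linf_pol. Qed.

Lemma L2_pe P : L2 (pe P). Proof. exact/Linf_L2/Linf_pe. Qed.

Lemma an_pe P : an (pe P).
Proof. by rewrite pe_pol; split; [exact/Linf_L2/Linf_pol|exact: CI_pol_exp]. Qed.

Lemma an_cst c : an (fun _ : T => c).
Proof.
rewrite (_ : (fun=> c) = pe c%:P); first exact: an_pe.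
by apply/funext => z; rewrite /pe hornerC.
Qed.

Lemma an_approx_pe f (e : R) : an f -> 0 < e -> exists P, N2 (fun z => f z - pe P z) <= e.
Proof.
move=> hf e0; have [a [N h]] := an_approx hf e0.
by exists (\poly_(j < N) a j); rewrite -pol_pe.
Qed.

Lemma N2_sub_sym f g : N2 (fun z => f z - g z) = N2 (fun z => g z - f z).
Proof. by congr RI; apply/funext => t; rewrite nmBC. Qed.

Lemma CI_pe_mul f P (c : C) : L1 f ->
  (forall i, CI (fun z => f z * sval z ^+ i) = 0) -> CI (fun z => pe P z * f z) = 0.
Proof.
move=> lf h; have -> : (fun z => pe P z * f z) =
    (fun z => \sum_(i < size P) P`_i * (f z * sval z ^+ i)).
  apply/funext => z; rewrite pe_pol /pol mulr_suml; apply: eq_bigr => i _.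
  by rewrite -mulrA [sval z ^+ i * _]mulrC.
rewrite (@CI_sum _ _ _ (fun (i : 'I_(size P)) z => P`_i * (f z * sval z ^+ i))).
  by apply: big1 => i _; rewrite CIZ ?h ?mulr0//; exact: L1_mul_exp.
by move=> i; exact/L1Z/L1_mul_exp.
Qed.

(** If [f] is a polynomial, the integral is a combination of negative coefficients of [g]; density
    gives the rest. Neither factor is bounded, and the product is merely in L1. *)
Lemma CI_an_mul f g n : an f -> an g -> CI (fun z => f z * g z * sval z ^+ n.+1) = 0.
Proof.
move=> hf hg; have [lg gn] := hg; have lgn := L2_mul_exp n.+1 lg.
under eq_fun do rewrite -mulrA.
apply: (CI_mul_eq0_closed (an_L2 hf) lgn) => e e0.
have [P hP] := an_approx_pe hf e0.
exists (pe P); split; [exact: L2_pe|by rewrite N2_sub_sym|].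
apply: (CI_pe_mul _ 0); first exact: L2_L1.
by move=> i; under eq_fun do rewrite -mulrA -exprD addSn; exact: gn.
Qed.

Lemma an_mul f g : Linf f -> an f -> an g -> an (fun z => f z * g z).
Proof.
move=> bf hf hg; split; first by apply: LinfM_L2 => //; exact: an_L2.
by move=> n; exact: CI_an_mul.
Qed.

Lemma an_sval : an (fun z : T => sval z).
Proof.
by have := an_pe 'X; rewrite /pe; under eq_fun do rewrite hornerX.
Qed.

Lemma anX f n : Linf f -> an f -> an (fun z => f z ^+ n).
Proof.
move=> bf hf; elim: n => [|n IH].
  by under eq_fun do rewrite expr0; exact: an_cst.
by under eq_fun do rewrite exprS; exact: an_mul.
Qed.

Lemma an_exp n : an (fun z : T => sval z ^+ n).
Proof. by apply: anX; [exact: Linf_sval|exact: an_sval]. Qed.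

Lemma an_closed f : L2 f -> (forall e : R, 0 < e -> exists2 g, an g & N2 (fun z => g z - f z) <= e) ->
  an f.
Proof.
move=> lf h; split => // n; apply: (CI_mul_eq0_closed lf).
  exact/Linf_L2/Linf_expn.
by move=> e e0; have [g [lg gn] hg] := h e e0; exists g.
Qed.

Lemma inner_prodE f g :
  inner_prod f g = ((2 * pi)^-1)%:C * CI (fun z => f z * (g z)^*).
Proof. by []. Qed.

(* [coan f] says that [f] belongs to $\overline{z H^2}$. *)
Definition coan f := L2 f /\ forall n, CI (fun z => f z * (sval z ^+ n)^*) = 0.

Lemma conj_sval_mulX z n : (sval z)^* * sval z ^+ n.+1 = sval z ^+ n.
Proof. by rewrite exprS mulrA [_^* * _]mulrC circleJ mul1r. Qed.

Lemma coanP f : coan f -> an (fun z => (sval z)^* * (f z)^*).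
Proof.
move=> [lf hf]; split.
  by apply: LinfM_L2; [exact/LinfJ/Linf_sval|exact: L2J].
move=> n; rewrite -[LHS]conjCKc -CIJ.
  rewrite (_ : (fun _ => _) = (fun z => f z * (sval z ^+ n)^*)) ?hf ?conjC0//.
  by apply/funext => z; rewrite -(conj_sval_mulX z n) !conjcM !conjCKc; ring.
apply/L1_mul_exp/L2_L1.
by apply: LinfM_L2; [exact/LinfJ/Linf_sval|exact: L2J].
Qed.

Lemma an_coan p : an p -> coan (fun z => (sval z * p z)^*).
Proof.
move=> [lp hp]; have lzp : L2 (fun z => sval z * p z).
  by apply: LinfM_L2 => //; exact: Linf_sval.
split; first exact: L2J.
move=> n; rewrite -[LHS]conjCKc -CIJ; last exact/L1_mul_expJ/L2_L1/L2J.
rewrite (_ : (fun _ => _) = (fun z => p z * sval z ^+ n.+1)) ?hp ?conjC0//.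
by apply/funext => z; rewrite conjcM !conjCKc exprS; ring.
Qed.

Lemma coan_eqT f g : coan f -> borel g -> eqT f g -> coan g.
Proof.
move=> [lf hf] bg fg; have lg := L2_eqT lf bg fg; split => // n.
rewrite -(hf n); apply: eqT_CI.
- exact/L1_borel/L1_mul_expJ/L2_L1.
- exact/L1_borel/L1_mul_expJ/L2_L1.
- by apply: aeTW fg _ => z ->.
Qed.

(** [T_g f = 0] says that [g f] is orthogonal to [H2], and by density of polynomials it is enough to
    test against the exponentials. *)
Lemma ker_toeplitzP g f : Linf g ->
  ker_toeplitz g f <-> an f /\ coan (fun z => g z * f z).
Proof.
move=> bg; split.
  move=> [/H2P hf [_ h]]; split => //; have lgf := LinfM_L2 bg (an_L2 hf).
  split => // n; have := h _ (an_H2 (an_exp n)).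
  rewrite inner_prodE => /eqP; rewrite mulf_eq0 => /orP[|/eqP].
    by rewrite eq_complex /= eqxx andbT gt_eqF// invr_gt0 twopi_gt0.
  by under eq_fun do rewrite subr0.
move=> [hf [lgf h]]; split; first exact: an_H2.
split.
  exact/an_H2/an_cst.
move=> w /H2P hw; rewrite inner_prodE; under eq_fun do rewrite subr0 mulrC.
rewrite (CI_mul_eq0_closed (L2J (an_L2 hw)) lgf) ?mulr0// => e e0.
have [P hP] := an_approx_pe hw e0.
exists (fun z => (pe P z)^*); split; first exact/L2J/L2_pe.
  rewrite (_ : N2 _ = N2 (fun z => w z - pe P z))//.
  by congr RI; apply/funext => t; rewrite -conjcB nmJ nmBC.
rewrite -[LHS]conjCKc -CIJ; last by apply: L2_M => //; exact/L2J/L2_pe.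
rewrite (_ : (fun _ => _) = (fun z => pe P z * (g z * f z)^*)); last first.
  by apply/funext => z; rewrite conjcM conjCKc.
rewrite (CI_pe_mul _ 0) ?conjC0//; first exact/L2_L1/L2J.
move=> i; rewrite -[LHS]conjCKc -CIJ; last exact/L1_mul_exp/L2_L1/L2J.
under eq_fun do rewrite conjcM conjCKc.
by rewrite h conjC0.
Qed.

Lemma N2_expand f g : L2 f -> L2 g ->
  N2 (fun z => f z + g z) = N2 f + N2 g + 2 * Re (CI (fun z => f z * (g z)^*)).
Proof.
move=> lf lg; have [_ rf] := lf; have [_ rg] := lg.
have rfg := L1_Re (L2_M lf (L2J lg)).
rewrite /N2 /= -RIZ// -RID// -RID; [|exact: rintD|exact: rintZ].
congr RI; apply/funext => t; rewrite !sqr_nm.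
by case: (f (cis t)) => a b; case: (g (cis t)) => c d /=; ring.
Qed.

(** * Beurling's extremal problem *)

Section Minimisation.
Variable p : T -> C.
Hypothesis hp : an p.

Let lp : L2 p := an_L2 hp.

(** The competitors: multiples of [p] by polynomials with constant term 1, a normalisation built
    into the form [1 + 'X * P]. *)
Definition qf P z : C := pe (1 + 'X * P) z * p z.

Lemma L2_qf P : L2 (qf P).
Proof. by apply: LinfM_L2 => //; exact: Linf_pe. Qed.

Let S : set R := [set x | exists P, x = N2 (qf P)].

Lemma S_inf : has_inf S.
Proof.
split; first by exists (N2 (qf 0)); exists 0.
by exists 0 => _ [P ->]; exact: N2_ge0.
Qed.

Let d : R := inf S.

Lemma d_le P : d <= N2 (qf P).
Proof. by apply: ge_inf; [case: S_inf|exists P]. Qed.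

(** The excess [4^-k / 4] turns the bound of [midpoint] into the rate [4^-k] that [riesz_fischer]
    asks for. *)
Lemma minimising k : exists P, N2 (qf P) < d + 4^-1 ^+ k / 4.
Proof.
have e0 : 0 < 4^-1 ^+ k / 4 :> R by rewrite divr_gt0// exprn_gt0// invr_gt0.
by have [_ [P ->] h] := inf_adherent e0 S_inf; exists P.
Qed.

(** First variation at a near-minimiser: adding [- t c h], where [c] is the integral in question and
    [t = 1 / (N2 h + 1)], yields another competitor, and the norm cannot drop by more than [e]. The
    summand 1 covers [h = 0]. *)
Lemma qf_orth P (e : R) Q : N2 (qf P) <= d + e ->
  nm (CI (fun z => qf P z * (pe ('X * Q) z * p z)^*)) ^+ 2 <=
  e * (N2 (fun z => pe ('X * Q) z * p z) + 1).
Proof.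
move=> hP; set h := fun z => pe ('X * Q) z * p z.
have lh : L2 h by apply: LinfM_L2 => //; exact: Linf_pe.
set c := CI _; set t := (N2 h + 1)^-1.
have H0 := N2_ge0 h.
have H1 : 0 < N2 h + 1 by rewrite ltr_wpDl.
have t0 : 0 < t by rewrite invr_gt0.
have Ht : N2 h * t = 1 - t by rewrite /t; field; rewrite gt_eqF.
have := d_le (P + (- (t%:C * c)) *: Q).
have -> : qf (P + (- (t%:C * c)) *: Q) = (fun z => qf P z + - (t%:C * c) * h z).
  by apply/funext => z; rewrite /qf /h !pe_1DXM pe_XM peD peZ; ring.
rewrite (N2_expand (L2_qf P) (L2Z _ lh)).
rewrite N2Z// nmN nmM nm_realC (gtr0_norm t0).
have -> : CI (fun z => qf P z * (- (t%:C * c) * h z)^*) = - (t%:C * (nm c ^+ 2)%:C).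
  have -> : (fun z => qf P z * (- (t%:C * c) * h z)^*) =
     (fun z => - (t%:C * c^*) * (qf P z * (h z)^*)).
    apply/funext => z; rewrite conjcM conjcN conjcM conjC_realC; ring.
  rewrite CIZ; last by apply: L2_M; [exact: L2_qf|exact: L2J].
  by rewrite -/c -mulJ_nm; ring.
rewrite -realCM ReN Re_realC exprMn.
set x := nm c ^+ 2 => hd.
have x0 : 0 <= x by rewrite sqr_ge0.
have hd2 : 2 * (t * x) <= e + t ^+ 2 * x * N2 h.
  by lra.
have : t ^+ 2 * x * N2 h = t * x - t ^+ 2 * x.
  by transitivity (t * x * (N2 h * t)); [ring|rewrite Ht; ring].
move=> E; rewrite E in hd2.
have t2 : 0 <= t ^+ 2 * x by rewrite mulr_ge0// sqr_ge0.
have : t * x <= e by lra.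
by rewrite /t ler_pdivrMl// [_ * e]mulrC.
Qed.

(** The parallelogram law: the mean of two competitors is again one, so its squared norm is at least
    [d]. Near-minimisers are therefore close to each other. *)
Lemma midpoint P Q : N2 (fun z => qf P z - qf Q z) <= 2 * N2 (qf P) + 2 * N2 (qf Q) - 4 * d.
Proof.
have lP := L2_qf P; have lQ := L2_qf Q.
have := d_le ((2^-1)%:C *: (P + Q)).
have -> : qf ((2^-1)%:C *: (P + Q)) = (fun z => (2^-1)%:C * (qf P z + qf Q z)).
  have two : (2^-1)%:C * 2 = 1 :> C.
    have -> : 2 = (2 : R)%:C by rewrite rmorphD.
    by rewrite -realCM mulVf.
  apply/funext => z; rewrite /qf !pe_1DXM peZ peD.
  rewrite -[X in (X + _) * _]two; ring.
rewrite N2Z; last exact: L2D.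
rewrite nm_realC ger0_norm// N2_expand//.
rewrite (N2_expand lP (L2N lQ)) (_ : N2 (fun z => - qf Q z) = N2 (qf Q)); last first.
  by congr RI; apply/funext => t; rewrite nmN.
have -> : CI (fun z => qf P z * (- qf Q z)^*) = - CI (fun z => qf P z * (qf Q z)^*).
  rewrite -CIN; last by apply: L2_M => //; exact: L2J.
  congr CI; apply/funext => z.
  by rewrite conjcN mulrN.
by rewrite ReN exprVn; lra.
Qed.

(** The minimiser is an L2 limit of competitors and need not be one itself, so its orthogonality to
    [z Q p] is obtained from [qf_orth] in the limit. *)
Lemma extremal : exists w : T -> C, [/\ L2 w,
  forall e : R, 0 < e -> exists P, N2 (fun z => w z - qf P z) <= e &
  forall Q, CI (fun z => w z * (pe ('X * Q) z * p z)^*) = 0].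
Proof.
have [Pk hPk] := choice minimising.
have e0 k : 0 < 4^-1 ^+ k :> R by rewrite exprn_gt0// invr_gt0.
have [w [lw hw]] : exists f, L2 f /\
    forall k, N2 (fun z => f z - qf (Pk k) z) <= (4^-1 : R) ^+ k.
  apply: riesz_fischer; first by move=> k; exact: L2_qf.
  move=> k m km; apply: (le_trans (midpoint _ _)).
  have : 4^-1 ^+ m <= 4^-1 ^+ k :> R.
    by rewrite ler_wiXn2l ?invr_ge0// invf_le1// ler1n.
  by have := hPk k; have := hPk m; have := e0 k; lra.
have small (e : R) : 0 < e -> exists k, 4^-1 ^+ k <= e :> R.
  move=> ep; have r01 : 0 <= (4^-1 : R) < 1 by apply/andP; split; lra.
  have [k hk] := exists_geom_lt 1 r01 ep.
  by exists k; have := hk k (leqnn k); rewrite mul1r; exact: ltW.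
exists w; split => // [e ep|Q].
  by have [k hk] := small e ep; exists (Pk k); exact: le_trans (hw k) hk.
set h := fun z => pe ('X * Q) z * p z.
have lh : L2 h by apply: LinfM_L2 => //; exact: Linf_pe.
apply/nm_eq0/eqP; rewrite -sqrf_eq0 eq_le sqr_ge0 andbT.
apply/ler_addgt0Pr => e ep; rewrite add0r.
have H0 := N2_ge0 h; have H1 : 0 < 4 * (N2 h + 1) by rewrite mulr_gt0// ltr_wpDl.
have [k hk] := small _ (divr_gt0 ep H1).
have lhJ := L2J lh.
have E : CI (fun z => w z * (h z)^*) =
    CI (fun z => (w z - qf (Pk k) z) * (h z)^*) + CI (fun z => qf (Pk k) z * (h z)^*).
  rewrite -CID; [|apply: L2_M => //; exact/L2B/L2_qf|apply: L2_M => //; exact: L2_qf].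
  by congr CI; apply/funext => z; ring.
rewrite E; set A := CI (fun z => _ * _); set B := CI (fun z => qf _ z * _).
have hA : nm A ^+ 2 <= 4^-1 ^+ k * N2 h.
  apply: (le_trans (nm_CI_mul (L2B lw (L2_qf (Pk k))) lhJ)).
  have -> : N2 (fun z => (h z)^*) = N2 h by congr RI; apply/funext => t; rewrite nmJ.
  by rewrite ler_wpM2r.
have hB : nm B ^+ 2 <= 4^-1 ^+ k / 4 * (N2 h + 1) by apply/qf_orth/ltW/hPk.
have hAB : nm (A + B) ^+ 2 <= 2 * nm A ^+ 2 + 2 * nm B ^+ 2.
  have := nmD A B; have := nm_ge0 (A + B); have := nm_ge0 A; have := nm_ge0 B.
  move=> b0 a0 ab0 ab; have := sqr_ge0 (nm A - nm B).
  have : nm (A + B) ^+ 2 <= (nm A + nm B) ^+ 2 by rewrite ler_sqr ?nnegrE ?addr_ge0.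
  by nra.
apply: (le_trans hAB).
move: hk; rewrite ler_pdivlMr// => hk.
have p0 := ltW (e0 k); have := mulr_ge0 p0 H0.
by lra.
Qed.

End Minimisation.

End Beurling.

(** * Inner factors, cyclic functions and maximal vectors *)

Section InnerFactor.
Context {R : realType}.
Local Notation C := R[i].
Local Notation T := (circle R).
Local Notation leb := (@lebesgue_measure R).
Local Notation D := (@angles R).
Local Notation nm := (@Normc.normc R).
Local Notation Re := (@complex.Re R).
Local Notation Im := (@complex.Im R).
Implicit Types (u f g h p q : T -> C) (z w : T) (r t s : R) (P Q : {poly C}).

Lemma N2_eq0 f : L2 f -> N2 f = 0 -> eqT f (fun=> 0).
Proof.
move=> [bf rf] h; have := RI_eq0_ae rf (fun t => sqr_ge0 _) h.
apply: filterS => t ht Dt; apply/nm_eq0/eqP; rewrite -sqrf_eq0; apply/eqP; exact: ht.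
Qed.

Lemma N2_small_eq0 f : L2 f -> (forall e : R, 0 < e -> N2 f <= e) -> eqT f (fun=> 0).
Proof.
move=> lf h; apply: N2_eq0 => //; apply/eqP; rewrite eq_le N2_ge0 andbT.
by apply/ler_addgt0Pr => e e0; rewrite add0r h.
Qed.

Lemma aeT_False : ~ aeT (fun _ : T => False).
Proof.
move=> hF; have : N2 (fun _ : T => 1 : C) <= N2 (fun _ : T => 0 : C).
  by apply: N2_le; [exact: L2_cst|exact: L2_cst|exact: aeTW hF _].
rewrite /N2 nm1 nm0 !RI_cst expr1n expr0n /= mul0r mul1r => h.
by have := lt_le_trans twopi_gt0 h; rewrite ltxx.
Qed.

(** The index [m] is the order of the zero of [p] at the origin. All competitors of the extremal
    problem share this coefficient, which keeps their norms away from 0 even if [p] vanishes at the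
    origin. *)
Lemma first_coef p : an p -> ~ eqT p (fun=> 0) -> exists m,
  CI (fun z => p z * (sval z ^+ m)^*) <> 0 /\
  forall n, (n < m)%N -> CI (fun z => p z * (sval z ^+ n)^*) = 0.
Proof.
move=> [lp hp] p0.
have [m hm] : exists m, CI (fun z => p z * (sval z ^+ m)^*) != 0.
  apply: contrapT => h; apply: p0; apply: L1_uniqueness => //; first exact: L2_L1.
  move=> n; apply/eqP; apply: contrapT => /negP hn; apply: h; by exists n.
have ex : exists m, CI (fun z => p z * (sval z ^+ m)^*) != 0 by exists m.
case: (ex_minnP ex) => m' hm' mn.
exists m'; split; first by apply/eqP.
move=> n nm'; apply/eqP; apply: contraTT nm' => hn; rewrite -leqNgt; exact: mn.
Qed.

(** Multiplication by [z P] moves coefficients up by at least one, so coefficient [m] of the product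
    is made of coefficients of [p] below [m]: they vanish by assumption, or by analyticity if the
    index is negative. *)
Lemma CI_shift_low p m P : an p ->
  (forall n, (n < m)%N -> CI (fun z => p z * (sval z ^+ n)^*) = 0) ->
  CI (fun z => pe ('X * P) z * p z * (sval z ^+ m)^*) = 0.
Proof.
move=> [lp hp] h.
have -> : (fun z => pe ('X * P) z * p z * (sval z ^+ m)^*) =
    (fun z => pe P z * (sval z * p z * (sval z ^+ m)^*)).
  by apply/funext => z; rewrite pe_XM; ring.
apply: (CI_pe_mul _ 0).
  apply/L1_mul_expJ; apply: LinfM_L1; [exact: Linf_sval|exact: L2_L1].
move=> i; have [im|mi] := ltnP i m.
  rewrite (_ : (fun _ => _) = (fun z => p z * (sval z ^+ (m - i.+1))^*)); last first.
    apply/funext => z.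
    have -> : p z * (sval z ^+ (m - i.+1))^* =
        (sval z ^+ i.+1 * (sval z ^+ i.+1)^*) * p z * (sval z ^+ (m - i.+1))^*.
      by rewrite circle_subn// subnn expr0 mul1r.
    have -> : sval z ^+ m = sval z ^+ i.+1 * sval z ^+ (m - i.+1).
      by rewrite -exprD subnKC.
    by rewrite conjcM !exprS; ring.
  by apply: h; rewrite ltn_subrL /= (leq_ltn_trans _ im).
rewrite (_ : (fun _ => _) = (fun z => p z * sval z ^+ (i - m).+1)); first exact: hp.
apply/funext => z.
rewrite -subSn// -(circle_subn z (leqW mi)) exprS; ring.
Qed.

(** The minimiser [w] is orthogonal to [z Q p] for all polynomials [Q], hence in the limit to
    [z^(n+1) w]. So [|w|^2] has no Fourier coefficient besides its mean and is constant; [I] is [w]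
    normalised. Orthogonality to [z^(n+1) p] says that [conj(I) p] has no negative coefficients. *)
Theorem beurling p : an p -> ~ eqT p (fun=> 0) -> exists I : T -> C,
  [/\ an I, aeT (fun z => nm (I z) = 1),
      forall e : R, 0 < e -> exists P, N2 (fun z => I z - pe P z * p z) <= e
    & an (fun z => (I z)^* * p z)].
Proof.
move=> hp p0; have lp := an_L2 hp.
have [w [lw wap worth]] := extremal hp.
have hqf P : an (qf p P) by apply: an_mul => //; [exact: Linf_pe|exact: an_pe].
have hw : an w.
  apply: an_closed => // e e0; have [P hP] := wap e e0; exists (qf p P) => //.
  by rewrite N2_sub_sym.
have lww : L1 (fun z => w z * (w z)^*) by apply: L2_M => //; exact: L2J.
have ww n : CI (fun z => w z * (w z)^* * (sval z ^+ n.+1)^*) = 0.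
  have lwn : L2 (fun z => w z * (sval z ^+ n.+1)^*).
    under eq_fun do rewrite mulrC.
    by apply: LinfM_L2 => //; exact/LinfJ/Linf_expn.
  rewrite (_ : (fun _ => _) = (fun z => (w z)^* * (w z * (sval z ^+ n.+1)^*))); last first.
    by apply/funext => z; ring.
  apply: CI_mul_eq0_closed => // [|e e0]; first exact: L2J.
  have [P hP] := wap e e0; exists (fun z => (qf p P z)^*); split.
  - exact/L2J/(an_L2 (hqf P)).
  - rewrite (_ : N2 _ = N2 (fun z => w z - qf p P z))//.
    by congr RI; apply/funext => t; rewrite -conjcB nmJ nmBC.
  - rewrite -[RHS](worth ('X^n * (1 + 'X * P))); congr CI; apply/funext => z.
    rewrite /qf pe_XM.
    have -> : pe ('X^n * (1 + 'X * P)) z = sval z ^+ n * pe (1 + 'X * P) z.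
      by rewrite /pe hornerM hornerXn.
    by rewrite exprS !conjcM; ring.
have wwp n : CI (fun z => w z * (w z)^* * sval z ^+ n.+1) = 0.
  rewrite -[LHS]conjCKc -CIJ; last exact: L1_mul_exp.
  rewrite -[RHS]conjC0 -(ww n); congr (_^*); congr CI; apply/funext => z.
  by rewrite !conjcM conjCKc; ring.
pose c := N2 w / (2 * pi).
have c0 : 0 <= c by rewrite divr_ge0 ?N2_ge0// ltW// twopi_gt0.
have wc : aeT (fun z => nm (w z) ^+ 2 = c).
  have h : eqT (fun z => w z * (w z)^* - c%:C) (fun=> 0).
    apply: L1_uniqueness; first by apply: L1B => //; exact: L1_cst.
      case=> [|n].
        under eq_fun do rewrite expr0 conjC1 mulr1.
        rewrite CIB//; last exact: L1_cst.
        by rewrite CI_sqr CI_cst -realCM /c divfK ?subrr// gt_eqF// twopi_gt0.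
      under eq_fun do rewrite mulrBl.
      rewrite CIB; [|exact: L1_mul_expJ|exact/L1_mul_expJ/L1_cst].
      rewrite ww sub0r CIZ; last exact/L1J/L2_L1/Linf_L2/Linf_expn.
      by rewrite CIJ ?CI_expS ?conjC0 ?mulr0 ?oppr0//; exact/L2_L1/Linf_L2/Linf_expn.
    move=> n; under eq_fun do rewrite mulrBl.
    rewrite CIB; [|exact: L1_mul_exp|exact/L1_mul_exp/L1_cst].
    rewrite wwp sub0r CIZ; last exact/L2_L1/Linf_L2/Linf_expn.
    by rewrite CI_expS mulr0 oppr0.
  by apply: aeTW h _ => z /eqP; rewrite mulJ_nm subr_eq0 => /eqP/complexI.
(* If [w] were 0, competitors would have arbitrarily small norm, although all of them have the
   nonzero coefficient of index [m] in common with [p]. *)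
have cp : 0 < c.
  rewrite lt0r c0 andbT; apply/eqP => cz.
  have N20 : N2 w = 0.
    move: cz => /eqP; rewrite /c mulf_eq0 => /orP[/eqP//|].
    by rewrite invr_eq0 gt_eqF// twopi_gt0.
  have [m [hm hlow]] := first_coef hp p0; apply: hm.
  apply/nm_eq0/eqP; rewrite -sqrf_eq0 eq_le sqr_ge0 andbT.
  apply/ler_addgt0Pr => e e0; rewrite add0r.
  have e2 : 0 < e / (2 * (2 * pi)) by rewrite divr_gt0 ?mulr_gt0 ?pi_gt0.
  have [P hP] := wap _ e2.
  have lq := an_L2 (hqf P).
  have -> : CI (fun z => p z * (sval z ^+ m)^*) = CI (fun z => qf p P z * (sval z ^+ m)^*).
    rewrite (_ : (fun z => qf p P z * _) =
      (fun z => p z * (sval z ^+ m)^* + pe ('X * P) z * p z * (sval z ^+ m)^*)); last first.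
      by apply/funext => z; rewrite /qf pe_1DXM pe_XM; ring.
    rewrite CID; last 2 first.
    - exact/L1_mul_expJ/L2_L1.
    - by apply/L1_mul_expJ; apply: LinfM_L1; [exact: Linf_pe|exact: L2_L1].
    by rewrite CI_shift_low ?addr0.
  have lJ : L2 (fun z : T => (sval z ^+ m)^*) by exact/L2J/Linf_L2/Linf_expn.
  apply: (le_trans (nm_CI_mul lq lJ)).
  have -> : N2 (fun z : T => (sval z ^+ m)^*) = 2 * pi.
    rewrite -[RHS]mul1r -RI_cst; congr RI; apply/funext => t.
    by rewrite nmJ nmX nm_circle !expr1n.
  have : N2 (qf p P) <= 2 * (e / (2 * (2 * pi))) + 2 * N2 w.
    rewrite (_ : N2 (qf p P) = N2 (fun z => (qf p P z - w z) + w z)); last first.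
      by congr RI; apply/funext => t; rewrite subrK.
    apply: (le_trans (N2D (L2B lq lw) lw)).
    by rewrite lerD2r ler_wpM2l// N2_sub_sym.
  rewrite N20 mulr0 addr0 => h.
  apply: (le_trans (ler_wpM2r (ltW twopi_gt0) h)).
  have E (x : R) : x != 0 -> 2 * (e / (2 * x)) * x = e by move=> xn; field.
  by rewrite E ?lexx// gt_eqF// twopi_gt0.
pose b := Num.sqrt c; have b0 : 0 < b by rewrite sqrtr_gt0.
have bb : b ^+ 2 = c by rewrite sqr_sqrtr.
pose I z := (b^-1)%:C * w z.
have lI : L2 I by exact: L2Z.
have I1 : aeT (fun z => nm (I z) = 1).
  apply: aeTW wc _ => z hz; rewrite /I nmM nm_realC ger0_norm ?invr_ge0 ?(ltW b0)//.
  have -> : nm (w z) = b by rewrite /b -hz sqrtr_sqr ger0_norm ?nm_ge0.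
  by rewrite mulVf// gt_eqF.
have bI : Linf I.
  by apply: Linf_bound; [exact: L2_borel|exists 1; apply: aeTW I1 _ => z ->].
exists I; split => //; first exact: anZ.
- move=> e e0; have e2 : 0 < c * e by rewrite mulr_gt0.
  have [P hP] := wap _ e2.
  exists ((b^-1)%:C *: (1 + 'X * P)).
  have -> : (fun z => I z - pe ((b^-1)%:C *: (1 + 'X * P)) z * p z) =
     (fun z => (b^-1)%:C * (w z - qf p P z)).
    by apply/funext => z; rewrite peZ /I /qf; ring.
  rewrite N2Z; last exact/L2B/(an_L2 (hqf P)).
  rewrite nm_realC ger0_norm ?invr_ge0 ?(ltW b0)// exprVn bb.
  by rewrite ler_pdivrMl.
- split; first by apply: LinfM_L2 => //; exact: LinfJ.
  move=> n; rewrite -[LHS]conjCKc -CIJ; last first.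
    by apply/L1_mul_exp; apply: LinfM_L1; [exact: LinfJ|exact: L2_L1].
  rewrite (_ : (fun _ => _) =
      (fun z => (b^-1)%:C * (w z * (pe ('X * 'X^n) z * p z)^*))); last first.
    apply/funext => z.
    have -> : pe ('X * 'X^n) z = sval z ^+ n.+1.
      by rewrite pe_XM /pe hornerXn exprS.
    by rewrite /I !conjcM !conjCKc; ring.
  rewrite CIZ; first by rewrite worth mulr0 conjC0.
  apply: L2_M => //; apply/L2J; apply: LinfM_L2 => //; exact: Linf_pe.
Qed.

Lemma borel_zero_ind p : borel p -> borel (fun z => if p z == 0 then 1 else 0 : C).
Proof.
move=> bp; have mq := measurable_sqr_nm bp.
have mb : measurable_fun setT (fun t : R => p (cis t) == 0).
  rewrite (_ : (fun t : R => _) = (fun t : R => nm (p (cis t)) ^+ 2 == 0)).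
    by apply: measurable_fun_eqr => //; exact: measurable_cst.
  apply/funext => t; rewrite sqrf_eq0; apply/eqP/eqP => [->|/nm_eq0//].
  exact: nm0.
split.
  rewrite (_ : (fun t : R => _) = (fun t : R => if p (cis t) == 0 then 1 else 0 : R)).
    by apply: measurable_fun_ifT => //; exact: measurable_cst.
  by apply/funext => t; case: ifP.
rewrite (_ : (fun t : R => _) = (fun=> 0 : R)); first exact: measurable_cst.
by apply/funext => t; case: ifP.
Qed.

(** All multiples of [p] vanish on the zero set of [p], and so does almost everywhere their L2 limit
    [I], which has modulus 1; the zero set is therefore null. *)
Lemma an_neq0_ae p : an p -> ~ eqT p (fun=> 0) -> aeT (fun z => p z <> 0).
Proof.
move=> hp p0; have [I [hI I1 Iap _]] := beurling hp p0.
pose chi z : C := if p z == 0 then 1 else 0.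
have bchi : borel chi by exact/borel_zero_ind/L2_borel/an_L2.
have lchi : Linf chi.
  apply: Linf_bound => //; exists 1; apply: aeT_all => z.
  by rewrite /chi; case: ifP => _; rewrite ?nm1 ?nm0 ?ler01.
have lc : L2 (fun z => chi z * I z) by apply: LinfM_L2 => //; exact: an_L2.
have h : eqT (fun z => chi z * I z) (fun=> 0).
  apply: N2_small_eq0 => // e e0; have [P hP] := Iap e e0.
  apply: le_trans hP; apply: N2_le => //.
    apply: L2B; first exact: an_L2.
    by apply: LinfM_L2; [exact: Linf_pe|exact: an_L2].
  apply: aeT_all => z; rewrite /chi; case: eqP => [->|_].
    by rewrite mul1r mulr0 subr0.
  by rewrite mul0r nm0 nm_ge0.
apply: aeT_and h I1 _ => z hz Iz pz; move: hz; rewrite /chi pz eqxx mul1r => hz.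
by move: Iz; rewrite hz nm0 => /eqP; rewrite eq_sym oner_eq0.
Qed.

(* [cyclic p] is outerness of [p] in Beurling's sense; bounded analytic
   multipliers are allowed so that the notion is stable under composition. *)
Definition cyclic p := forall e : R, 0 < e ->
  exists u, [/\ Linf u, an u & N2 (fun z => u z * p z - 1) <= e].

(** Analyticity of [I] removes the coefficients of negative index, that of its conjugate those of
    positive index. *)
Lemma an_const I : Linf I -> an I -> an (fun z => (I z)^*) ->
  exists c : C, eqT I (fun=> c).
Proof.
move=> bI [lI hI] [_ hJ]; exists (cf I 0).
have lc := L1_cst (cf I 0).
have h : eqT (fun z => I z - cf I 0) (fun=> 0).
  apply: L1_uniqueness; first by apply: L1B => //; exact: L2_L1.
    case=> [|n].
      under eq_fun do rewrite expr0 conjC1 mulr1.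
      rewrite CIB//; last exact: L2_L1.
      rewrite CI_cst mulrC -cfE; under [X in _ - CI X]eq_fun do rewrite expr0 conjC1 mulr1.
      by rewrite subrr.
    under eq_fun do rewrite mulrBl.
    rewrite CIB; [|exact/L1_mul_expJ/L2_L1|exact: L1_mul_expJ].
    rewrite CIZ; last exact/L1J/L2_L1/Linf_L2/Linf_expn.
    rewrite CIJ ?CI_expS ?conjC0 ?mulr0 ?subr0; last exact/L2_L1/Linf_L2/Linf_expn.
    rewrite -[LHS]conjCKc -CIJ; last exact/L1_mul_expJ/L2_L1.
    under eq_fun do rewrite conjcM conjCKc.
    by rewrite hJ conjC0.
  move=> n; under eq_fun do rewrite mulrBl.
  rewrite CIB; [|exact/L1_mul_exp/L2_L1|exact: L1_mul_exp].
  rewrite CIZ; last exact/L2_L1/Linf_L2/Linf_expn.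
  by rewrite CI_expS mulr0 subr0.
by apply: aeTW h _ => z /eqP; rewrite subr_eq0 => /eqP.
Qed.

(* If [p = I p0] with [I] inner, then [kI] lies in [ker T_g] and [k] in
   [ker T_(gI)]; maximality puts [kI] in [ker T_(gI)], which forces the
   conjugate of [I] to be analytic, hence [I] to be constant. *)
Theorem maximal_cyclic g k : Linf g -> ~ eqT g (fun=> 0) -> maximal_vector g k ->
  let p := fun z => (sval z)^* * (g z * k z)^* in an p /\ cyclic p.
Proof.
move=> bg g0 [/H2P hk k0 [_ kg kmin]] p.
have [_ cgk] := (ker_toeplitzP k bg).1 kg.
have hp : an p by exact: coanP.
split => //.
have kn0 := an_neq0_ae hk k0.
(* [k] vanishes almost nowhere, so [p = 0] would make [g] vanish. *)
have p0 : ~ eqT p (fun=> 0).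
  move=> h; apply: g0; apply: aeT_and h kn0 _ => z /eqP.
  rewrite /p mulf_eq0 => /orP[/eqP h|/eqP h] kz.
    have := nm_circle z; rewrite -nmJ h nm0 => /eqP; by rewrite eq_sym oner_eq0.
  have : g z * k z = 0 by rewrite -[LHS]conjCKc h conjC0.
  by move=> /eqP; rewrite mulf_eq0 => /orP[/eqP//|/eqP].
have gkE z : g z * k z = (sval z * p z)^*.
  by rewrite /p mulrA circleJ mul1r conjCKc.
move: p hp p0 gkE => {}p hp p0 gkE.
have [I [hI I1 Iap hIp]] := beurling hp p0.
have bI : Linf I.
  by apply: Linf_bound; [exact/L2_borel/an_L2|exists 1; apply: aeTW I1 _ => z ->].
have II : aeT (fun z => I z * (I z)^* = 1).
  by apply: aeTW I1 _ => z h; rewrite mulJ_nm h expr1n.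
have bgI := LinfM bg bI.
have kgI : ker_toeplitz (fun z => g z * I z) k.
  apply/(ker_toeplitzP _ bgI); split => //.
  rewrite (_ : (fun z => _) = (fun z => (sval z * ((I z)^* * p z))^*)); first exact: an_coan.
  apply/funext => z; rewrite mulrAC gkE !conjcM conjCKc; ring.
have kIg : ker_toeplitz g (fun z => I z * k z).
  have hIk : an (fun z => I z * k z) by exact: an_mul.
  apply/(ker_toeplitzP _ bg); split => //.
  rewrite (_ : (fun z => _) = (fun z => (sval z * ((I z)^* * p z))^*)); first exact: an_coan.
  apply/funext => z; rewrite mulrCA gkE !conjcM conjCKc; ring.
have := kmin _ bgI kgI _ kIg.
move=> /(ker_toeplitzP _ bgI)[_ /coanP].
rewrite (_ : (fun z => _) = (fun z => (I z)^* * ((I z)^* * p z))); last first.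
  apply/funext => z.
  have -> : g z * I z * (I z * k z) = (sval z * p z)^* * I z * I z by rewrite -gkE; ring.
  rewrite !conjcM !conjCKc.
  transitivity ((sval z * (sval z)^*) * ((I z)^* * ((I z)^* * p z))); first by ring.
  by rewrite circleJ mul1r.
move=> hIIp.
(* Multiplying [I - P p] by the unimodular [conj(I)^2] turns the approximation of [I] by [P p] into
   one of [conj(I)] by [P conj(I)^2 p], which is analytic. *)
have hJ : an (fun z => (I z)^*).
  apply: an_closed => [|e e0]; first exact/L2J/an_L2.
  have [P hP] := Iap e e0.
  exists (fun z => pe P z * ((I z)^* * ((I z)^* * p z))).
    by apply: an_mul => //; [exact: Linf_pe|exact: an_pe].
  apply: le_trans hP; apply: N2_le.
  - apply: L2B; last exact/L2J/an_L2.
    by apply: LinfM_L2; [exact: Linf_pe|exact: an_L2].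
  - apply: L2B; first exact: an_L2.
    by apply: LinfM_L2; [exact: Linf_pe|exact: an_L2].
  - apply: aeT_and II I1 _ => z h1 h2.
    rewrite (_ : _ - _ = - ((I z)^* * (I z)^* * (I z - pe P z * p z))); last first.
      rewrite -[X in _ - X]mulr1 -h1; ring.
    by rewrite nmN !nmM nmJ h2 !mul1r.
have [c hc] := an_const bI hI hJ.
have cc : nm c = 1.
  apply: contrapT => h.
  by apply: aeT_False; apply: (aeT_and hc I1) => z ->.
(* Since [I] is a unimodular constant [c], the functions [conj(c) P p] approximate 1. *)
move=> e e0; have [P hP] := Iap e e0.
exists (pe (c^* *: P)); split; [exact: Linf_pe|exact: an_pe|].
apply: le_trans hP; apply: N2_le.
- apply: L2B; last exact: L2_cst.
  by apply: LinfM_L2; [exact: Linf_pe|exact: an_L2].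
- apply: L2B; first exact: an_L2.
  by apply: LinfM_L2; [exact: Linf_pe|exact: an_L2].
- apply: aeTW hc _ => z ->.
  have c1 : c * c^* = 1 by rewrite mulJ_nm cc expr1n.
  rewrite peZ (_ : _ - 1 = - (c^* * (c - pe P z * p z))); last by rewrite -c1; ring.
  by rewrite nmN nmM nmJ cc mul1r.
Qed.

Theorem cyclic_maximal g k : Linf g -> an k -> ~ eqT k (fun=> 0) ->
  let p := fun z => (sval z)^* * (g z * k z)^* in
  an p -> cyclic p -> maximal_vector g k.
Proof.
move=> bg hk k0 p hp cp; have kn0 := an_neq0_ae hk k0.
have gkE z : g z * k z = (sval z * p z)^*.
  by rewrite /p mulrA circleJ mul1r conjCKc.
have kg : ker_toeplitz g k.
  apply/(ker_toeplitzP _ bg); split => //.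
  rewrite (_ : (fun z => _) = (fun z => (sval z * p z)^*)); first exact: an_coan.
  by apply/funext => z; rewrite gkE.
have p0 : ~ eqT p (fun=> 0).
  move=> h.
  have : eqT (fun _ : T => 1) (fun=> 0).
    apply: N2_small_eq0; first exact: L2_cst.
    move=> e e0; have [u [bu hu hN]] := cp e e0.
    apply: le_trans hN; apply: N2_le; first exact: L2_cst.
      by apply: L2B; [apply: LinfM_L2 => //; exact: an_L2|exact: L2_cst].
    by apply: aeTW h _ => z ->; rewrite mulr0 sub0r nmN.
  move=> h1; apply: k0; apply: aeTW h1 _ => z /eqP.
  by rewrite oner_eq0.
have pn0 := an_neq0_ae hp p0.
split => //; first exact: an_H2.
split => //; first by exists g.
move=> h bh /(ker_toeplitzP _ bh)[_ /coanP hq] f /(ker_toeplitzP _ bg)[hf /coanP hr].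
apply/(ker_toeplitzP _ bh); split => //.
set q := (fun z => _) in hq; set r := (fun z => _) in hr.
have lhf := LinfM_L2 bh (an_L2 hf).
pose v z := (sval z)^* * (h z * f z)^*.
have lv : L2 v by apply: LinfM_L2; [exact/LinfJ/Linf_sval|exact: L2J].
have hv : an v.
  split => // n; have lvn := L2_mul_exp n.+1 lv.
  rewrite -[RHS](_ : CI (fun z => 1 * (v z * sval z ^+ n.+1)) = 0); last first.
    (* Both [p v] and [q r] equal [conj(z)^2 conj(g h k f)]. Hence [u p v = (u q) r] has no negative
       coefficients, and [u p] tends to 1. *)
    apply: (CI_mul_eq0_closed (L2_cst 1) lvn) => e e0.
    have [u [bu hu hN]] := cp e e0.
    exists (fun z => u z * p z); split => //.
      by apply: LinfM_L2 => //; exact: an_L2.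
    rewrite -(CI_an_mul n (an_mul bu hu hq) hr); apply: eqT_CI.
    - apply: borelM; first by apply: borelM; [exact: Linf_borel|exact/L2_borel/an_L2].
      exact: L2_borel.
    - apply: borelM; last exact/Linf_borel/Linf_expn.
      apply: borelM; last exact/L2_borel/an_L2.
      by apply: borelM; [exact: Linf_borel|exact/L2_borel/an_L2].
    - apply: aeT_all => z; rewrite /p /v /q /r !conjcM; ring.
  by congr CI; apply/funext => z; rewrite mul1r.
have := an_coan hv.
rewrite (_ : (fun z => _) = (fun z => h z * f z))//.
by apply/funext => z; rewrite /v mulrA circleJ mul1r conjCKc.
Qed.

End InnerFactor.

(** * A measurable choice of the angle *)

Section Argument.
Context {R : realType}.
Local Notation C := R[i].
Local Notation T := (circle R).
Local Notation D := (@angles R).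
Local Notation nm := (@Normc.normc R).
Local Notation Re := (@complex.Re R).
Local Notation Im := (@complex.Im R).
Implicit Types (z w : T) (r t s : R).

(* Half-angle formula: the cotangent of [t / 2] is [sin t / (1 - cos t)]. *)
Definition arg z : R :=
  if Re (sval z) == 1 then 0 else pi - 2 * atan (Im (sval z) / (1 - Re (sval z))).

Lemma circle_ReIm z : Re (sval z) ^+ 2 + Im (sval z) ^+ 2 = 1.
Proof. by rewrite -sqr_nm nm_circle expr1n. Qed.

Lemma cis_arg z : cis (arg z) = z.
Proof.
apply: val_inj; have := circle_ReIm z; rewrite /arg.
set x := Re _; set y := Im _ => xy.
apply: complex_ext; rewrite -/x -/y /=; case: eqP => x1.
- by rewrite cos0 x1.
- set a := atan _.
  have x1' : 1 - x != 0 by rewrite subr_eq0 eq_sym; apply/eqP.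
  have ha : cos a ^+ 2 = (1 - x) / 2.
    rewrite /a cos_atan exprVn sqr_sqrtr; last by rewrite addr_ge0// sqr_ge0.
    have -> : 1 + (y / (1 - x)) ^+ 2 = 2 / (1 - x).
      have y2 : y ^+ 2 = 1 - x ^+ 2 by rewrite -xy; ring.
      by rewrite expr_div_n y2; field.
    by rewrite invf_div.
  rewrite cosB cospi sinpi mul0r addr0 mulN1r.
  by rewrite mulrC mulr_natr cos_mulr2n ha mulr2n; lra.
- by rewrite sin0; move: xy; rewrite x1 expr1n => h; apply/eqP; rewrite eq_sym -sqrf_eq0; apply/eqP; lra.
- set a := atan _.
  have x1' : 1 - x != 0 by rewrite subr_eq0 eq_sym; apply/eqP.
  have ha : cos a ^+ 2 = (1 - x) / 2.
    rewrite /a cos_atan exprVn sqr_sqrtr; last by rewrite addr_ge0// sqr_ge0.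
    have -> : 1 + (y / (1 - x)) ^+ 2 = 2 / (1 - x).
      have y2 : y ^+ 2 = 1 - x ^+ 2 by rewrite -xy; ring.
      by rewrite expr_div_n y2; field.
    by rewrite invf_div.
  have ca : cos a != 0.
    by rewrite -sqrf_eq0 ha mulf_neq0// invr_eq0 pnatr_eq0.
  have sa : sin a = y / (1 - x) * cos a.
    by rewrite -[y / _]atanK -/a /tan divfK.
  rewrite sinB cospi sinpi mul0r add0r mulN1r opprK.
  rewrite [2 * a]mulrC mulr_natr sin_mulr2n sa mulrCA -expr2 ha mulr2n; field.
  exact: x1'.
Qed.

Lemma arg_ge0 z : 0 <= arg z < 2 * pi.
Proof.
rewrite /arg; case: eqP => _; first by rewrite lexx twopi_gt0.
by have := atan_gtNpi2 (Im (sval z) / (1 - Re (sval z)));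
  have := atan_ltpi2 (Im (sval z) / (1 - Re (sval z))); move=> h1 h2;
  apply/andP; split; lra.
Qed.

(** The difference of the two angles has cosine 1 and modulus below [2 pi]; if it were not 0,
    [cos_away] would make its cosine less than 1. *)
Lemma arg_cis t : 0 <= t < 2 * pi -> arg (cis t) = t.
Proof.
move=> /andP[t0 t2]; set s := arg _; have /andP[s0 s2] := arg_ge0 (cis t).
have e := congr1 sval (cis_arg (cis t)); rewrite -/s in s0 s2 e.
have c1 : cos (s - t) = 1.
  have ec := congr1 Re e; have es := congr1 Im e; rewrite /= in ec es.
  by rewrite cosB ec es -!expr2 cos2Dsin2.
apply/eqP; rewrite -subr_eq0; apply: contraT => st.
have n0 : 0 < `|s - t| by rewrite normr_gt0.
have n2 : `|s - t| < 2 * pi by rewrite ltr_norml; apply/andP; split; lra.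
pose m := Num.min `|s - t| (2 * pi - `|s - t|).
have m0 : 0 < m by rewrite lt_min n0 subr_gt0.
have [m1 m2] : m <= `|s - t| /\ m <= 2 * pi - `|s - t| by rewrite !ge_min !lexx !orbT.
have mpi : m <= pi by lra.
have h1 : m <= `|s - t| by [].
have h2 : `|s - t| <= 2 * pi - m by lra.
have := cos_away m0 mpi h1 h2; rewrite c1 => h.
by have := lt_le_trans (cos_lt1 m0 mpi) h; rewrite ltxx.
Qed.

Lemma measurable_arg (phi : T -> T) : borel (fun z => sval (phi z)) ->
  measurable_fun setT (fun t : R => arg (phi (cis t))).
Proof.
move=> [b1 b2]; apply: measurable_fun_ifT.
- by apply: measurable_fun_eqr => //; exact: measurable_cst.
- exact: measurable_cst.
- apply: measurable_funB; first exact: measurable_cst.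
  apply: measurable_funM; first exact: measurable_cst.
  apply: (measurableT_comp (f := atan)).
    by apply: continuous_measurable_fun => x; exact: continuous_atan.
  apply: measurable_funM => //; apply: (measurableT_comp measurable_invr).
  by apply: measurable_funB => //; exact: measurable_cst.
Qed.

(** [borel] is a condition on functions of the angle, so the composition is taken through the
    measurable angle of [phi]. *)
Lemma borel_comp (phi : T -> T) (f : T -> C) : borel (fun z => sval (phi z)) ->
  borel f -> borel (fun z => f (phi z)).
Proof.
move=> bphi [f1 f2]; have ma := measurable_arg bphi; split.
  rewrite (_ : (fun t : R => _) = (fun t => Re (f (cis t))) \o (fun t => arg (phi (cis t)))).
    exact: measurableT_comp.
  by apply/funext => t /=; rewrite cis_arg.
rewrite (_ : (fun t : R => _) = (fun t => Im (f (cis t))) \o (fun t => arg (phi (cis t)))).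
  exact: measurableT_comp.
by apply/funext => t /=; rewrite cis_arg.
Qed.

End Argument.

(** * Composition with a nonconstant inner function *)

Section InnerComposition.
Context {R : realType}.
Local Notation C := R[i].
Local Notation T := (circle R).
Local Notation leb := (@lebesgue_measure R).
Local Notation D := (@angles R).
Local Notation nm := (@Normc.normc R).
Local Notation Re := (@complex.Re R).
Local Notation Im := (@complex.Im R).
Implicit Types (u f g h p q : T -> C) (z w : T) (r t s : R) (P Q : {poly C}).

Variable psi : T -> T.
Hypothesis hpsi : inner_function psi.
Hypothesis psi_nc : nonconstant psi.

Let ps z : C := sval (psi z).

Lemma an_psi : an ps. Proof. by have [] := Hinf_an hpsi. Qed.
Lemma Linf_psi : Linf ps. Proof. by have [] := Hinf_an hpsi. Qed.
Lemma borel_psi : borel ps. Proof. exact: Linf_borel Linf_psi. Qed.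

Let a : C := cf ps 0.

(** If [|a| >= 1], the mean already accounts for the whole squared norm [2 pi] of [psi], and [psi]
    equals [a] almost everywhere. *)
Lemma nm_psi0 : nm a < 1.
Proof.
rewrite ltNge; apply/negP => h; apply: psi_nc; exists a.
have lps := Linf_L2 Linf_psi.
have e : N2 (fun z => ps z - pol (cf ps) 1 z) <= 0.
  rewrite N2_subpol// big_ord1 subr_le0.
  have -> : N2 ps = 2 * pi * 1.
    rewrite mulr1 -[RHS]mul1r -RI_cst; congr RI; apply/funext => t.
    by rewrite nm_circle expr1n.
  rewrite ler_pM2l ?twopi_gt0// -/a; have := nm_ge0 a; nra.
have e0 : N2 (fun z => ps z - pol (cf ps) 1 z) = 0.
  by apply/eqP; rewrite eq_le e N2_ge0.
have lp : L2 (fun z => ps z - pol (cf ps) 1 z) by apply: L2B => //; exact/Linf_L2/Linf_pol.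
apply: aeTW (N2_eq0 lp e0) _ => z /eqP; rewrite subr_eq0 => /eqP.
by rewrite /pol big_ord1 expr0 mulr1.
Qed.

(** The mean, being evaluation at the origin, is multiplicative. With [g] approximated by
    polynomials: [f - cf f 0] integrates to 0 against [z^i], for [i = 0] by the choice of the
    constant and for [i > 0] by analyticity. *)
Lemma CI_an_prod f g : Linf f -> an f -> an g ->
  CI (fun z => f z * g z) = cf f 0 * CI g.
Proof.
move=> bf hf hg; have lf := an_L2 hf; have lg := an_L2 hg.
have h : CI (fun z => g z * (f z - cf f 0)) = 0.
  have lfc : L2 (fun z => f z - cf f 0) by apply: L2B => //; exact: L2_cst.
  apply: (CI_mul_eq0_closed lg lfc) => e e0.
  have [P hP] := an_approx_pe hg e0.
  exists (pe P); split; [exact: L2_pe|by rewrite N2_sub_sym|].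
  apply: (CI_pe_mul _ 0); first exact: L2_L1.
  move=> i; under eq_fun do rewrite mulrBl.
  rewrite CIB; [|exact/L1_mul_exp/L2_L1|exact/L1_mul_exp/L1_cst].
  rewrite CIZ; last exact/L2_L1/Linf_L2/Linf_expn.
  case: i => [|i]; last by case: hf => _ ->; rewrite CI_expS mulr0 subr0.
  under eq_fun do rewrite expr0 mulr1.
  under [X in _ - _ * CI X]eq_fun do rewrite expr0.
  rewrite CI_cst mul1r mulrC -cfE.
  by under [X in _ - CI X]eq_fun do rewrite expr0 conjC1 mulr1; rewrite subrr.
have l1 : L1 (fun z => g z * f z) by exact: L2_M.
apply/eqP; rewrite -subr_eq0 -h -CIZ; last exact: L2_L1.
apply/eqP; rewrite -CIB; [|by under eq_fun do rewrite mulrC|exact/L1Z/L2_L1].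
by congr CI; apply/funext => z; ring.
Qed.

(** Up to conjugation, these are the Fourier coefficients of the image of Lebesgue measure under
    [psi]. They are those of a Poisson kernel at the point [a] of the disc. *)
Lemma CI_psiX n : CI (fun z => ps z ^+ n) = a ^+ n * (2 * pi)%:C.
Proof.
elim: n => [|n IH].
  by under eq_fun do rewrite expr0; rewrite CI_cst expr0.
under eq_fun do rewrite exprS.
rewrite CI_an_prod ?IH ?exprS ?mulrA//; [exact: Linf_psi|exact: an_psi|].
by apply: anX; [exact: Linf_psi|exact: an_psi].
Qed.

(** The two geometric series in [|a|] of [abel_psi_bound] give [2 / (1 - |a|)]; the summand 1 makes
    the constant visibly at least 1, as the extension of the angle map by the identity requires. *)
Definition distortion : R := 1 + 2 * (1 - nm a)^-1.

Lemma distortion_ge1 : 1 <= distortion.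
Proof. by rewrite lerDl mulr_ge0// invr_ge0 subr_ge0 ltW// nm_psi0. Qed.

Definition tau t : R := arg (psi (cis t)).

Lemma measurable_tau : measurable_fun setT tau.
Proof. exact: measurable_arg borel_psi. Qed.

Lemma cis_tau t : cis (tau t) = psi (cis t).
Proof. exact: cis_arg. Qed.

Lemma tau_in t : 0 <= tau t < 2 * pi.
Proof. exact: arg_ge0. Qed.

(** [psi - 1] is analytic and not zero, so [psi] takes the value 1 on a null set only. This removes
    the angle 0, an end of the interval, which [PI_ind_lim] does not cover. *)
Lemma arg_psi_gt0 : aeT (fun z => 0 < arg (psi z)).
Proof.
have h : an (fun z => ps z + -1) by apply: anD; [exact: an_psi|exact: an_cst].
have n0 : ~ eqT (fun z => ps z + -1) (fun=> 0).
  move=> e; apply: psi_nc; exists 1; apply: aeTW e _ => z /eqP.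
  by rewrite subr_eq0 => /eqP.
apply: aeTW (an_neq0_ae h n0) _ => z hz; have /andP[a0 _] := arg_ge0 (psi z).
rewrite lt0r a0 andbT; apply/eqP => az; apply: hz.
by rewrite /ps -(cis_arg (psi z)) az cis0 subrr.
Qed.

(** Integrated term by term, the Abel sum at [psi] produces the means [a^n] and their conjugates, a
    summable family. The bound is independent of [r] and [N], which allows both limits to be
    taken. *)
Lemma abel_psi_bound u r N (M : R) : L1 u -> N1 u <= M -> 0 <= r < 1 ->
  nm (CI (fun z => abel u r N (psi z))) <= distortion * M.
Proof.
move=> lu hM r01; have /andP[r0 r1] := r01.
have M0 : 0 <= M := le_trans (N1_ge0 u) hM.
have tp := twopi_gt0 (R := R).
have p1 n : L1 (fun z => ps z ^+ n) by apply/L2_L1/Linf_L2/LinfX/Linf_psi.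
have cfb n : nm (cf u n) <= (2 * pi)^-1 * M.
  rewrite /cf nmM nm_twopiV ler_wpM2l ?invr_ge0 ?(ltW tp)//.
  apply: (le_trans (nm_CI (L1_mul_expJ n lu))); apply: le_trans hM.
  rewrite le_eqVlt; apply/orP; left; apply/eqP; congr RI; apply/funext => t.
  by rewrite nmM nmJ nmX nm_circle expr1n mulr1.
have cfmb n : nm (cfm u n) <= (2 * pi)^-1 * M.
  rewrite /cfm nmM nm_twopiV ler_wpM2l ?invr_ge0 ?(ltW tp)//.
  apply: (le_trans (nm_CI (L1_mul_exp n lu))); apply: le_trans hM.
  rewrite le_eqVlt; apply/orP; left; apply/eqP; congr RI; apply/funext => t.
  by rewrite nmM nmX nm_circle expr1n mulr1.
pose F1 n z := (r%:C ^+ n * cf u n) * ps z ^+ n.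
pose F2 n z := (r%:C ^+ n * cfm u n) * (ps z ^+ n)^*.
have l1 n : L1 (F1 n) by exact: L1Z.
have l2 n : L1 (F2 n) by apply/L1Z/L1J.
have -> : (fun z => abel u r N (psi z)) =
    (fun z => \sum_(n < N) F1 n z + \sum_(n < N) F2 n.+1 z).
  apply/funext => z; rewrite /abel; congr (_ + _); apply: eq_bigr => n _.
    by rewrite /F1 exprMn; ring.
  by rewrite /F2 [(_ * _^*) ^+ _]exprMn conjcX; ring.
have s1 : L1 (fun z => \sum_(n < N) F1 n z) by apply: L1_sum => n; exact: l1.
have s2 : L1 (fun z => \sum_(n < N) F2 n.+1 z) by apply: L1_sum => n; exact: l2.
rewrite (CID s1 s2) (@CI_sum _ _ _ (fun n : 'I_N => F1 n)); last by move=> n; exact: l1.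
rewrite (@CI_sum _ _ _ (fun n : 'I_N => F2 n.+1)); last by move=> n; exact: l2.
have rn n : r ^+ n <= 1 by rewrite exprn_ile1// ltW.
have b1 n : nm (CI (F1 n)) <= M * nm a ^+ n.
  rewrite /F1 CIZ// CI_psiX nmM [nm (_ * cf _ _)]nmM [nm (_ * (2 * pi)%:C)]nmM.
  rewrite !nmX !nm_realC (ger0_norm r0) (gtr0_norm tp).
  have h1 : r ^+ n * nm (cf u n) <= 1 * ((2 * pi)^-1 * M).
    by apply: ler_pM; rewrite ?nm_ge0 ?exprn_ge0.
  have h2 : 0 <= nm a ^+ n * (2 * pi) by rewrite mulr_ge0 ?exprn_ge0 ?nm_ge0// ltW.
  apply: (le_trans (ler_wpM2r h2 h1)).
  have E (x y : R) : x != 0 -> 1 * (x^-1 * M) * (y * x) = M * y by move=> xn; field.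
  by rewrite E// gt_eqF.
have b2 n : nm (CI (F2 n)) <= M * nm a ^+ n.
  rewrite /F2 CIZ; last exact: L1J.
  rewrite CIJ// CI_psiX nmM nmJ [nm (_ * cfm _ _)]nmM [nm (_ * (2 * pi)%:C)]nmM.
  rewrite !nmX !nm_realC (ger0_norm r0) (gtr0_norm tp).
  have h1 : r ^+ n * nm (cfm u n) <= 1 * ((2 * pi)^-1 * M).
    by apply: ler_pM; rewrite ?nm_ge0 ?exprn_ge0.
  have h2 : 0 <= nm a ^+ n * (2 * pi) by rewrite mulr_ge0 ?exprn_ge0 ?nm_ge0// ltW.
  apply: (le_trans (ler_wpM2r h2 h1)).
  have E (x y : R) : x != 0 -> 1 * (x^-1 * M) * (y * x) = M * y by move=> xn; field.
  by rewrite E// gt_eqF.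
have a1 := nm_psi0; have a0 := nm_ge0 a.
have a1' : 0 < 1 - nm a by rewrite subr_gt0.
have geo K : \sum_(n < K) nm a ^+ n <= (1 - nm a)^-1.
  have E : (1 - nm a) * \sum_(n < K) nm a ^+ n = 1 - nm a ^+ K.
    by rewrite -[1 - nm a ^+ K]opprB subrX1 -mulNr opprB.
  by rewrite -[leRHS]mul1r ler_pdivlMr// mulrC E gerBl exprn_ge0.
apply: (le_trans (nmD _ _)).
have g1 : nm (\sum_(n < N) CI (F1 n)) <= M * (1 - nm a)^-1.
  apply: (le_trans (nm_sum _ _ _)).
  apply: (@le_trans _ _ (\sum_(n < N) M * nm a ^+ n)); first by apply: ler_sum.
  by rewrite -mulr_sumr ler_wpM2l.
have g2 : nm (\sum_(n < N) CI (F2 n.+1)) <= M * (1 - nm a)^-1.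
  apply: (le_trans (nm_sum _ _ _)).
  apply: (@le_trans _ _ (\sum_(n < N) M * nm a ^+ n)).
    apply: ler_sum => n _; apply: (le_trans (b2 _)).
    by rewrite ler_wpM2l// exprS ler_piMl ?exprn_ge0// ltW.
  by rewrite -mulr_sumr ler_wpM2l.
apply: (le_trans (lerD g1 g2)); rewrite /distortion mulrDl mul1r.
by rewrite -[leLHS]add0r lerD// mulrC; lra.
Qed.

Definition ind (U : set R) z : C := (\1_U (arg z))%:C.

Lemma ind01 U z : 0 <= (\1_U (arg z) : R) <= 1.
Proof. by rewrite indicE; case: (_ \in _); rewrite ?lexx ler01. Qed.

Lemma borel_ind U : measurable U -> borel (ind U).
Proof.
move=> mU; have mi : measurable_fun setT (fun t : R => \1_U (arg (cis t)) : R).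
  have m1 : measurable_fun setT (\1_U : R -> R) by exact/measurable_indicP.
  exact: (measurableT_comp m1 (measurable_arg (phi := id) borel_sval)).
by split => //=; exact: measurable_cst.
Qed.

Lemma Linf_ind U : measurable U -> Linf (ind U).
Proof.
move=> mU; apply: Linf_bound; first exact: borel_ind.
exists 1; apply: aeT_all => z; rewrite nm_realC.
by have /andP[i0 i1] := ind01 U z; rewrite ger0_norm.
Qed.

Lemma PI_ind U r z : measurable U -> 0 <= r < 1 ->
  exists2 x : R, 0 <= x <= 1 & PI (ind U) r z = x%:C.
Proof.
move=> mU r01.
pose k t := Pk r (sval z * (sval (cis t))^*).
have rk' : rint k by have := L1_Re (L2_L1 (Linf_L2 (Linf_Pk z r01))).
have k0 t : 0 <= k t by exact: Pk_ge0.
have tp := twopi_gt0 (R := R).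
have kI : (2 * pi)^-1 * RI k = 1.
  have E : CI (fun w => (Pk r (sval z * (sval w)^*))%:C * 1) = (RI k)%:C.
    apply: complex_ext => /=; first by congr RI; apply/funext => t; rewrite mulr1 mul0r subr0.
    rewrite (_ : (fun _ => _) = fun=> 0) ?RI_cst ?mul0r//.
    by apply/funext => t; rewrite mulr0 ?mul0r addr0.
  by have := PI_cst z 1 r01; rewrite /PI E -realCM => /complexI.
have li := LinfM_L1 (Linf_Pk z r01) (L2_L1 (Linf_L2 (Linf_ind mU))).
have rki : rint (fun t => k t * \1_U (arg (cis t))).
  have := L1_Re li; rewrite /ind.
  by under [in rint _]eq_fun do rewrite -realCM /=.
exists ((2 * pi)^-1 * RI (fun t => k t * \1_U (arg (cis t)))).
  apply/andP; split.
    rewrite mulr_ge0 ?invr_ge0 ?(ltW tp)//; apply: RI_ge0 => t.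
    by rewrite mulr_ge0//; case/andP: (ind01 U (cis t)).
  rewrite -[leRHS]kI ler_wpM2l ?invr_ge0 ?(ltW tp)//; apply: RI_le => // t.
  by rewrite ler_piMr//; case/andP: (ind01 U (cis t)).
rewrite /PI realCM; congr (_ * _); apply: complex_ext => /=.
  by congr RI; apply/funext => t; rewrite mulr0 subr0.
rewrite (_ : (fun _ => _) = fun=> 0) ?RI_cst ?mul0r//.
by apply/funext => t; rewrite mulr0 mul0r addr0.
Qed.

(** The limit holds at each point of [U] with positive angle and not just at almost every one: a
    null set of exceptions could not be pulled back by [psi] at this stage. The indicator is
    constant near the point, so the averages vanish for small radii. *)
Lemma PI_ind_lim U z (e : R) : open U -> U (arg z) -> 0 < arg z -> 0 < e ->
  exists2 r0 : R, 0 <= r0 < 1 & forall r, r0 < r < 1 -> nm (PI (ind U) r z - 1) <= e.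
Proof.
move=> oU Uz z0 e0; have mU := open_measurable oU.
have li := L2_L1 (Linf_L2 (Linf_ind mU)).
set t := arg z in Uz z0; have /andP[_ t2] := arg_ge0 z.
have zE : z = cis t by rewrite cis_arg.
have iz : ind U (cis t) = 1.
  by rewrite -zE /ind indicE -/t mem_set.
have t02 : 0 < t < 2 * pi by rewrite z0.
have sa : small_avg (fun s => nm (ind U (cis s) - ind U (cis t))) t.
  move=> e' e'0; have /nbhs_ballP[d d0 hd] := open_nbhs_nbhs (conj oU Uz).
  exists (Num.min d (Num.min t (2 * pi - t))).
    by rewrite !lt_min d0 z0 subr_gt0.
  move=> x x0; rewrite !le_min => /and3P[xd xt xt2].
  rewrite (_ : (fun s => _) = fun=> 0); first by rewrite RI_cst mul0r mulr_ge0// ltW.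
  apply/funext => s; rewrite /ball_ind; case: ltP => [ts|_]; last by rewrite mulr0.
  have Us : U s by apply: hd; rewrite /ball /= (lt_le_trans ts).
  have s02 : 0 <= s < 2 * pi.
    by move: ts; rewrite ltr_norml => /andP[h1 h2]; apply/andP; split; lra.
  rewrite iz /ind arg_cis// indicE mem_set//.
  by rewrite subrr nm0 mul0r.
have [r0 r01 h] := poisson_pointwise li t02 sa e0.
by exists r0 => // r hr; have := h r hr; rewrite iz -zE.
Qed.

(** The Poisson integrals of the indicator have values in [[0, 1]], so that [N2] of their
    composition with [psi] is at most its integral. That integral is bounded through the Abel sums,
    and Fatou's lemma lets the radius tend to 1. *)
Lemma N2_ind_psi U : open U -> N2 (fun z => ind U (psi z)) <= distortion * N1 (ind U).
Proof.
move=> oU; have mU := open_measurable oU.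
have li := L2_L1 (Linf_L2 (Linf_ind mU)).
have bi : borel (fun z => ind U (psi z)) by apply: borel_comp; [exact: borel_psi|exact: borel_ind].
pose v k z := PI (ind U) (rk k) (psi z).
have hv k z := PI_ind (psi z) mU (rk01 k).
have bv k : borel (v k).
  apply: (borel_lim (u := fun N z => abel (ind U) (rk k) N (psi z))).
    move=> N; apply: (borel_comp borel_psi (f := abel (ind U) (rk k) N)).
    apply: borelD; apply: borel_sum => n; apply: borelM; try exact: borel_cst.
      by apply/borelX/borelM; [exact: borel_cst|exact: borel_sval].
    by apply/borelX/borelM; [exact: borel_cst|exact/borelJ/borel_sval].
  by move=> z; exact: (cvg_abel (psi z) li (rk01 k)).
have v1 k z : nm (v k z) <= 1.
  by rewrite /v; have [x /andP[x0 x1] ->] := hv k z; rewrite nm_realC ger0_norm.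
have lv k : Linf (v k) by apply: Linf_bound => //; exists 1; exact: aeT_all.
have Iv k : N2 (v k) <= distortion * N1 (ind U).
  apply: (@le_trans _ _ (nm (CI (v k)))).
    apply: le_trans (le_trans (ler_norm _) (Re_le_nm _)).
    have [_ r2] := Linf_L2 (lv k).
    apply: RI_le => //; first exact: (L1_Re (L2_L1 (Linf_L2 (lv k)))).
    move=> t; have [x /andP[x0 x1] E] := hv k (cis t).
    rewrite /v E nm_realC ger0_norm// Re_realC; nra.
  apply/ler_addgt0Pr => e e0.
  have tp := twopi_gt0 (R := R).
  pose K := 2 * (1 - rk k)^-1 * N1 (ind U).
  have [N0 hN] := exists_geom_lt K (rk01 k) e0.
  have lab : L1 (fun z => abel (ind U) (rk k) N0 (psi z)).
    have Lp := Linf_psi.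
    apply/L2_L1/Linf_L2/LinfD; apply: Linf_sum => n; apply: LinfM; try exact: Linf_cst.
      by apply/LinfX/LinfM; [exact: Linf_cst|].
    by apply/LinfX/LinfM; [exact: Linf_cst|exact: LinfJ].
  have lvk := L2_L1 (Linf_L2 (lv k)).
  have -> : CI (v k) = CI (fun z => abel (ind U) (rk k) N0 (psi z)) -
      CI (fun z => abel (ind U) (rk k) N0 (psi z) - v k z).
    by rewrite CIB//; ring.
  apply: (le_trans (nmD _ _)); rewrite nmN; apply: lerD.
    exact: (abel_psi_bound _ li (lexx _) (rk01 k)).
  apply: (le_trans (nm_CI (L1B lab lvk))).
  apply: (@le_trans _ _ (RI (fun=> (2 * pi)^-1 * e))); last first.
    by rewrite RI_cst mulrAC mulVf ?mul1r// gt_eqF.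
  apply: RI_le; [by case: (L1B lab lvk)|exact: rint_cst|] => t.
  apply: (le_trans (abel_PI N0 (psi (cis t)) li (rk01 k))).
  rewrite ler_wpM2l ?invr_ge0 ?(ltW tp)//.
  have := hN N0 (leqnn _); rewrite /K mulrAC; exact: ltW.
(* The factor [ind U (psi z)] disposes of the points outside [U], where the Poisson integrals need
   not tend to 0, for instance on the boundary of [U]. *)
have [] := N2_fatou (u := fun k z => v k z * ind U (psi z)) (f := fun z => ind U (psi z))
  (B := distortion * N1 (ind U)) => //.
- move=> k; apply: LinfM_L2 => //.
  have lip : Linf (fun z => ind U (psi z)).
    apply: Linf_bound => //; exists 1; apply: aeT_all => z; rewrite nm_realC.
    by have /andP[i0 i1] := ind01 U (psi z); rewrite ger0_norm.
  exact: Linf_L2.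
- apply: aeTW arg_psi_gt0 _ => z az.
  have [Uz|nU] := pselect (U (arg (psi z))); last first.
    rewrite (_ : (fun _ => _) = fun=> 0); first exact: cvg_cst.
    by apply/funext => k; rewrite /ind indicE memNset// mulr0 subrr nm0.
  have iz : ind U (psi z) = 1 by rewrite /ind indicE mem_set.
  apply/cvgrPdist_lt => e e0; have e2 : 0 < e / 2 by rewrite divr_gt0.
  have [r0 /andP[r00 r01] h] := PI_ind_lim oU Uz az e2.
  have dr : 0 < 1 - r0 by rewrite subr_gt0.
  have /cvgrPdist_lt/(_ _ dr) := @cvg_rk R; apply: filterS => k hk.
  have /andP[k0 k1] := rk01 (R := R) k.
  rewrite iz mulr1 sub0r normrN ger0_norm ?nm_ge0//.
  apply: (@le_lt_trans _ _ (e / 2)); last by lra.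
  apply: h; rewrite k1 andbT.
  by move: hk; rewrite ltr_norml => /andP[_ h]; lra.
- move=> k; apply: le_trans (Iv k).
  have lip : Linf (fun z => ind U (psi z)).
    apply: Linf_bound => //; exists 1; apply: aeT_all => z; rewrite nm_realC.
    by have /andP[i0 i1] := ind01 U (psi z); rewrite ger0_norm.
  apply: N2_le; [by apply: LinfM_L2 => //; exact: Linf_L2|exact: Linf_L2|].
  apply: aeT_all => z; rewrite nmM ler_piMr ?nm_ge0// nm_realC.
  by have /andP[i0 i1] := ind01 U (psi z); rewrite ger0_norm.
Qed.


Lemma fin_num_lebD E : measurable E -> leb (E `&` D) \is a fin_num.
Proof.
move=> mE; rewrite ge0_fin_numE//.
apply: (@le_lt_trans _ _ (leb D)); last by rewrite leb_angles ltry.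
by apply: le_measure; rewrite ?inE; [apply: measurableI => //; exact: mD|exact: mD|move=> t []].
Qed.

Lemma RI_indic E : measurable E -> RI (\1_E : R -> R) = fine (leb (E `&` D)).
Proof. by move=> mE; rewrite /RI /Rintegral integral_indic//; exact: mD. Qed.

Lemma N1_ind E : measurable E -> N1 (ind E) = fine (leb (E `&` D)).
Proof.
move=> mE; rewrite -RI_indic//; apply: RI_ae.
- exact: (measurable_funTS (measurable_nm (borel_ind mE))).
- exact/measurable_funTS/measurable_indicP.
- apply: filterS ae_interior => t ht Dt; have /andP[t0 t2] := ht Dt.
  rewrite nm_realC arg_cis ?(ltW t0)// ger0_norm// indicE; by case: (_ \in _); rewrite ?ler01.
Qed.

Lemma measurable_pre E : measurable E -> measurable (tau @^-1` E).
Proof. by move=> mE; rewrite -[X in measurable X]setTI; exact: measurable_tau. Qed.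

Lemma N2_ind_pre E : measurable E ->
  N2 (fun z => ind E (psi z)) = fine (leb (tau @^-1` E `&` D)).
Proof.
move=> mE; rewrite -(RI_indic (measurable_pre mE)); congr RI; apply/funext => t.
rewrite nm_realC -/(tau t) real_normK ?num_real// !indicE.
rewrite (_ : (t \in tau @^-1` E) = (tau t \in E)).
  by case: (_ \in E); rewrite ?expr1n ?expr0n.
by apply/idP/idP; rewrite !inE.
Qed.

Lemma leb_pre_open U : open U ->
  (leb (tau @^-1` U `&` D) <= distortion%:E * leb (U `&` D))%E.
Proof.
move=> oU; have mU := open_measurable oU; have := N2_ind_psi oU.
rewrite N2_ind_pre// N1_ind// -lee_fin EFinM !fineK//; first exact: fin_num_lebD.
exact: (fin_num_lebD (measurable_pre mU)).
Qed.

(** From open to measurable sets by outer regularity. In particular, preimages of null sets are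
    null, which makes composition meaningful modulo null sets. *)
Lemma leb_pre E : measurable E ->
  (leb (tau @^-1` E `&` D) <= distortion%:E * leb (E `&` D))%E.
Proof.
move=> mE; have C0 : 0 < distortion := lt_le_trans ltr01 distortion_ge1.
have mED : measurable (E `&` D : set (measurableTypeR R)).
  by apply: measurableI => //; exact: mD.
apply/lee_addgt0Pr => e e0.
have fED := fin_num_lebD mE.
have fin : (leb (E `&` D) < +oo)%E by rewrite -ge0_fin_numE.
have [U [oU EU hU]] := lebesgue_regularity_outer mED fin (divr_gt0 e0 C0).
have mU := open_measurable oU.
apply: (@le_trans _ _ (leb (tau @^-1` U `&` D))).
  apply: le_measure; rewrite ?inE.
  - by apply: measurableI; [exact: measurable_pre|exact: mD].
  - by apply: measurableI; [exact: measurable_pre|exact: mD].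
  - move=> t [Et Dt]; split => //; apply: EU; split => //.
    have /andP[t0 t2] := tau_in t.
    by rewrite /angles /= in_itv /= t0 ltW.
apply: (le_trans (leb_pre_open oU)).
have -> : (distortion%:E * leb (E `&` D) + e%:E =
   distortion%:E * (leb (E `&` D) + (e / distortion)%:E))%E.
  rewrite ge0_muleDr ?lee_fin ?(ltW (divr_gt0 e0 C0))//.
  by rewrite -[in RHS]EFinM [distortion * _]mulrC divfK// gt_eqF.
rewrite lee_pmul2l//.
apply: (@le_trans _ _ (leb U)).
  apply: le_measure; rewrite ?inE//.
  by apply: measurableI => //; exact: mD.
have -> : U = (E `&` D) `|` (U `\` (E `&` D)) by rewrite setDUK.
apply: (le_trans (measureU2 _ _ _)) => //; first exact: measurableD.
by rewrite leeD2l// ltW.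
Qed.

Lemma aeT_comp (P : T -> Prop) : aeT P -> aeT (fun z => P (psi z)).
Proof.
move=> [N [mN N0 hN]].
exists (tau @^-1` N `&` D); split.
- by apply: measurableI; [exact: measurable_pre|exact: mD].
- apply/eqP; rewrite eq_le measure_ge0 andbT; apply: (le_trans (leb_pre mN)).
  rewrite (_ : leb (N `&` D) = 0%E) ?mule0//.
  apply/eqP; rewrite eq_le measure_ge0 andbT -N0; apply: le_measure; rewrite ?inE//.
  by apply: measurableI => //; exact: mD.
- move=> t /= /not_implyP[Dt nP]; split => //; apply: hN => /= h; apply: nP.
  rewrite -cis_tau; apply: h; have /andP[t0 t2] := tau_in t.
  by rewrite /angles /= in_itv /= t0 ltW.
Qed.

(* Outside the interval of angles the map is the identity, so that the image
   measure is dominated by a multiple of the Lebesgue measure on the line. *)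
Definition tau_ext t : R := if (0 <= t) && (t <= 2 * pi) then tau t else t.

Lemma measurable_tau_ext : measurable_fun (setT : set (measurableTypeR R))
  (tau_ext : measurableTypeR R -> measurableTypeR R).
Proof.
apply: measurable_fun_ifT; last exact: measurable_id.
  apply: measurable_and.
    by apply: measurable_fun_ler => //; exact: measurable_cst.
  by apply: measurable_fun_ler => //; exact: measurable_cst.
exact: measurable_tau.
Qed.

Lemma tau_ext_in t : D t -> tau_ext t = tau t.
Proof. by rewrite /angles /= in_itv /= /tau_ext => ->. Qed.

Lemma tau_ext_out t : ~ D t -> tau_ext t = t.
Proof. by rewrite /angles /= in_itv /= /tau_ext => /negP/negbTE ->. Qed.

Lemma tau_D t : D (tau t).
Proof. by have /andP[t0 t2] := tau_in t; rewrite /angles /= in_itv /= t0 ltW. Qed.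

(** Change of variables by [tau_ext]. The image measure is dominated set by set by [distortion]
    times Lebesgue measure, through [leb_pre] on the angles and the identity elsewhere, and this
    passes to integrals of nonnegative functions. *)
Lemma L2_comp f : L2 f -> L2 (fun z => f (psi z)) /\
  N2 (fun z => f (psi z)) <= distortion * N2 f.
Proof.
move=> [bf rf]; have C0 : 0 <= distortion := le_trans ler01 distortion_ge1.
have bfp := borel_comp borel_psi bf.
pose h (s : measurableTypeR R) := (nm (f (cis s)) ^+ 2)%:E.
have mh : measurable_fun setT h by apply/measurable_EFinP; exact: measurable_sqr_nm.
have h0 s : (0 <= h s)%E by rewrite lee_fin sqr_ge0.
have mt := measurable_tau_ext.
pose m1 : measure _ _ := pushforward leb (tau_ext : measurableTypeR R -> measurableTypeR R).
pose m2 : measure _ _ := mscale (NngNum C0) leb.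
have m12 S : measurable S -> (m1 mt S <= m2 S)%E.
  move=> mS; change (leb (tau_ext @^-1` S) <= distortion%:E * leb S)%E.
  have mS1 : measurable (tau @^-1` S `&` D : set (measurableTypeR R)).
    by apply: measurableI; [exact: measurable_pre|exact: mD].
  have mS2 : measurable (S `\` D : set (measurableTypeR R)) by apply: measurableD => //; exact: mD.
  have -> : tau_ext @^-1` S = (tau @^-1` S `&` D) `|` (S `\` D).
    apply/seteqP; split => t /=.
      have [Dt|nD] := pselect (D t); first by rewrite tau_ext_in//; left.
      by rewrite tau_ext_out//; right.
    by move=> [[St Dt]|[St nD]]; [rewrite tau_ext_in|rewrite tau_ext_out].
  apply: (le_trans (measureU2 _ mS1 mS2)).
  have -> : leb S = (leb (S `&` D) + leb (S `\` D))%E.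
    by rewrite addeC; apply: measureDI => //; exact: mD.
  rewrite ge0_muleDr//; apply: leeD; first exact: leb_pre.
  by rewrite lee_pemull// lee_fin distortion_ge1.
have key : (\int[leb]_(t in D) (nm (f (psi (cis t))) ^+ 2)%:E <= (distortion * N2 f)%:E)%E.
  have -> : (\int[leb]_(t in D) (nm (f (psi (cis t))) ^+ 2)%:E =
      \int[m1 mt]_(s in D) h s)%E.
    rewrite /m1 ge0_integral_pushforward//; last 2 first.
    - exact: mD.
    - exact: measurable_funTS.
    have -> : tau_ext @^-1` D = D.
      apply/seteqP; split => t /=.
        by have [//|nD] := pselect (D t); rewrite tau_ext_out.
      by move=> Dt; rewrite tau_ext_in//; exact: tau_D.
    apply: eq_integral => t; rewrite inE => Dt.
    by rewrite /h /= tau_ext_in// cis_tau.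
  apply: (le_trans (ge0_le_measure_integral m12 _ h0 mh)); first exact: mD.
  rewrite /m2 ge0_integral_mscale//; last 2 first.
  - exact: mD.
  - exact: measurable_funTS.
  by rewrite RI_EFin// EFinM.
have rfp : rint (fun t => nm (f (psi (cis t))) ^+ 2).
  apply/integrableP; split.
    by apply/measurable_EFinP/measurable_funTS; exact: (measurable_sqr_nm bfp).
  under eq_integral do rewrite gee0_abs ?lee_fin ?sqr_ge0//.
  by apply: (le_lt_trans key); rewrite ltry.
by split; [split|rewrite -lee_fin -RI_EFin].
Qed.

Lemma Linf_comp f : Linf f -> Linf (fun z => f (psi z)).
Proof.
move=> /LinfP[bf [M [M0 hM]]]; apply: Linf_bound; first exact: (borel_comp borel_psi bf).
by exists M; exact: aeT_comp hM.
Qed.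

Lemma an_pe_psi P : an (fun z => pe P (psi z)).
Proof.
rewrite (_ : (fun z => _) = (fun z => \sum_(i < size P) P`_i * ps z ^+ i)); last first.
  by apply/funext => z; rewrite pe_pol.
elim: (size P) => [|n IH].
  by under eq_fun do rewrite big_ord0; exact: an_cst.
under eq_fun do rewrite big_ord_recr /=.
by apply: anD => //; apply/anZ/anX; [exact: Linf_psi|exact: an_psi].
Qed.

Lemma an_comp f : an f -> an (fun z => f (psi z)).
Proof.
move=> hf; have lf := an_L2 hf; have [lfp _] := L2_comp lf.
have C0 : 0 < distortion := lt_le_trans ltr01 distortion_ge1.
apply: an_closed => // e e0.
have [P hP] := an_approx_pe hf (divr_gt0 e0 C0).
exists (fun z => pe P (psi z)); first exact: an_pe_psi.
rewrite N2_sub_sym.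
have [_ h] := L2_comp (L2B lf (L2_pe P)).
by apply: (le_trans h); rewrite mulrC -ler_pdivlMr.
Qed.

Lemma cyclic_comp p : an p -> cyclic p -> cyclic (fun z => p (psi z)).
Proof.
move=> hp cp e e0; have C0 : 0 < distortion := lt_le_trans ltr01 distortion_ge1.
have [u [bu hu hN]] := cp _ (divr_gt0 e0 C0).
exists (fun z => u (psi z)); split; [exact: Linf_comp|exact: an_comp|].
have l : L2 (fun z => u z * p z - 1).
  by apply: L2B; [apply: LinfM_L2 => //; exact: an_L2|exact: L2_cst].
have [_ h] := L2_comp l.
by apply: (le_trans h); rewrite mulrC -ler_pdivlMr.
Qed.

End InnerComposition.

(** * Invertible multipliers and the proposition *)

Section Multipliers.
Context {R : realType}.
Local Notation C := R[i].
Local Notation T := (circle R).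
Implicit Types (f g h k p G hplus hminus : T -> C).

Lemma coan_mulJ h f : Linf h -> an h -> coan f -> coan (fun z => (h z)^* * f z).
Proof.
move=> bh hh /coanP hf; have := an_coan (an_mul bh hh hf).
rewrite (_ : (fun z => (sval z * _)^*) = (fun z => (h z)^* * f z))//.
apply/funext => z; rewrite !conjcM !conjCKc.
by transitivity ((sval z * (sval z)^*) * ((h z)^* * f z)); [ring|rewrite circleJ mul1r].
Qed.

Lemma cyclic_eqT p q : borel p -> borel q -> eqT p q -> cyclic p -> cyclic q.
Proof.
move=> bp bq pq cp e e0; have [u [bu hu hN]] := cp e e0.
exists u; split => //; rewrite (eqT_N2 _ _ (_ : eqT _ (fun z => u z * p z - 1)))//.
- by apply: borelB; [apply: borelM => //; exact: Linf_borel|exact: borel_cst].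
- by apply: borelB; [apply: borelM => //; exact: Linf_borel|exact: borel_cst].
- by apply: aeTW pq _ => z ->.
Qed.

Lemma cyclic_mul h h' p : Linf h -> Linf h' -> an h' ->
  eqT (fun z => h z * h' z) (fun=> 1) -> an p -> cyclic p ->
  cyclic (fun z => h z * p z).
Proof.
move=> bh bh' hh' hhE hp cp e e0; have [u [bu hu hN]] := cp e e0.
exists (fun z => u z * h' z); split; [exact: LinfM|exact: an_mul|].
have bp := L2_borel (an_L2 hp).
have [bu1 bh1 bh1'] := And3 (Linf_borel bu) (Linf_borel bh) (Linf_borel bh').
rewrite (eqT_N2 _ _ (_ : eqT _ (fun z => u z * p z - 1)))//.
- by apply: borelB; [apply: borelM; exact: borelM|exact: borel_cst].
- by apply: borelB; [exact: borelM|exact: borel_cst].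
- apply: aeTW hhE _ => z hz.
  rewrite (_ : _ * _ * _ = u z * p z * (h z * h' z)); last by ring.
  by rewrite hz mulr1.
Qed.

Lemma eqT1_mul_neq0 f g : eqT (fun z => f z * g z) (fun=> 1) -> aeT (fun z => f z != 0).
Proof.
move=> fg; apply: aeTW fg _ => z h; apply/eqP => f0.
by move: h; rewrite f0 mul0r => /eqP; rewrite eq_sym oner_eq0.
Qed.

Lemma Hinf_invertible h : invertible_in Hinf h -> exists h',
  [/\ Linf h, an h, Linf h', an h' & eqT (fun z => h z * h' z) (fun=> 1)].
Proof. by move=> [/Hinf_an[bh hh] [h' /Hinf_an[bh' hh'] hhE]]; exists h'. Qed.

Lemma conj_Hinf_invertible h : invertible_in (conj_set Hinf) h ->
  exists2 h1, h = (fun z => (h1 z)^*) & invertible_in Hinf h1.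
Proof.
move=> [[h1 hh1 ->] [_ [h2 hh2 ->] hE]]; exists h1 => //; split => //.
exists h2 => //; apply: aeTW hE _ => z e.
by rewrite -[LHS]conjCKc conjcM e conjC1.
Qed.

(** Multiplication by [hplus] maps one kernel onto the other: it and its inverse preserve
    analyticity of [f], while [hminus], a conjugate of an invertible analytic function, and its
    inverse preserve coanalyticity of the product with the symbol. *)
Lemma ker_toeplitz_mul G hplus hminus : Linf G ->
  invertible_in Hinf hplus -> invertible_in (conj_set Hinf) hminus ->
  ker_toeplitz (fun z => hminus z * G z * hplus z) =
    mul_set (fun z => (hplus z)^-1) (ker_toeplitz G).
Proof.
move=> bG /Hinf_invertible[hp' [bhp hhp bhp' hhp' hpE]].
move=> /conj_Hinf_invertible[h -> /Hinf_invertible[h' [bh hh bh' hh' hE]]].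
have bF : Linf (fun z => (h z)^* * G z * hplus z).
  by do 2 (apply: LinfM => //); exact: LinfJ.
have hp0 := eqT1_mul_neq0 hpE.
apply/seteqP; split => f.
  move=> /(ker_toeplitzP _ bF)[hf cf]; have bf := L2_borel (an_L2 hf).
  split => //; exists (fun z => hplus z * f z).
    apply/(ker_toeplitzP _ bG); split; first exact: an_mul.
    apply: (coan_eqT (coan_mulJ bh' hh' cf)).
      by apply: borelM; [exact: Linf_borel|apply: borelM => //; exact: Linf_borel].
    apply: aeTW hE _ => z hz.
    transitivity ((h z * h' z)^* * (G z * (hplus z * f z))); first by rewrite conjcM; ring.
    by rewrite hz conjC1 mul1r.
  by apply: aeTW hp0 _ => z hz; rewrite mulKf.
move=> [bf [v /(ker_toeplitzP _ bG)[hv cv] fE]].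
(* The pointwise inverse of [hplus] is replaced by the analytic inverse [hp'], equal to it almost
   everywhere; only the latter is known to be an analytic multiplier. *)
have fE' : eqT f (fun z => hp' z * v z).
  apply: (aeT_and (aeT_and fE hp0 (fun z => @conj _ _)) hpE) => z [-> hz] e.
  by congr (_ * _); apply: (mulfI hz); rewrite mulfV.
apply/(ker_toeplitzP _ bF); split.
  by apply: (an_eqT (an_mul bhp' hhp' hv)) => //; exact: eqT_sym.
apply: (coan_eqT (coan_mulJ bh hh cv)); first by apply: borelM => //; exact: Linf_borel.
apply: aeT_and fE hp0 _ => z -> hz.
by rewrite -!mulrA mulVKf.
Qed.

Lemma maximal_vector_comp g k (psi : T -> T) hplus hminus :
  Linf g -> ~ eqT g (fun=> 0) -> maximal_vector g k ->
  inner_function psi -> nonconstant psi ->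
  invertible_in Hinf hplus -> invertible_in (conj_set Hinf) hminus ->
  maximal_vector
    (fun z => hminus z * ((sval z)^* * sval (psi z) * g (psi z)) * hplus z)
    (fun z => (hplus z)^-1 * k (psi z)).
Proof.
move=> bg g0 hk hpsi psi_nc /Hinf_invertible[hp' [bhp hhp bhp' hhp' hpE]].
move=> /conj_Hinf_invertible[h -> /Hinf_invertible[h' [bh hh bh' hh' hE]]].
have [hp cp] := maximal_cyclic bg g0 hk.
have [/H2P hk2 k0 _] := hk.
have gkE z : g z * k z = (sval z * ((sval z)^* * (g z * k z)^*))^*.
  by rewrite mulrA circleJ mul1r conjCKc.
set p := (fun z => (sval z)^* * (g z * k z)^*) in hp cp.
have hp0 := eqT1_mul_neq0 hpE.
have bG : Linf (fun z => (h z)^* * ((sval z)^* * sval (psi z) * g (psi z)) * hplus z).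
  apply: LinfM => //; apply: LinfM; first exact: LinfJ.
  apply: LinfM; last exact: Linf_comp.
  by apply: LinfM; [exact/LinfJ/Linf_sval|exact: Linf_psi].
have hkp := an_comp hpsi psi_nc hk2.
have bkp := L2_borel (an_L2 hkp).
have bk' : borel (fun z => (hplus z)^-1 * k (psi z)).
  by apply: borelM => //; exact/borelV/Linf_borel.
have hk' : an (fun z => (hplus z)^-1 * k (psi z)).
  apply: (an_eqT (an_mul bhp' hhp' hkp)) => //.
  apply: aeT_and hp0 hpE _ => z hz e.
  by congr (_ * _); apply: (mulfI hz); rewrite mulfV.
have hpp := an_comp hpsi psi_nc hp.
have hP := an_mul bh hh hpp.
have cP := cyclic_mul bh bh' hh' hE hpp (cyclic_comp hpsi psi_nc hp cp).
(* The analytic function attached to the new symbol and vector is [h (p o psi)]. The factor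
   [conj(z) psi] of the symbol, once conjugated, cancels the outer [conj(z)] and supplies the
   [conj(psi)] contained in [p o psi]. *)
have PE : eqT (fun z => h z * p (psi z)) (fun z => (sval z)^* *
    ((h z)^* * ((sval z)^* * sval (psi z) * g (psi z)) * hplus z *
     ((hplus z)^-1 * k (psi z)))^*).
  apply: aeTW hp0 _ => z hz; symmetry.
  transitivity ((sval z)^* * ((h z)^* * (sval z)^* * sval (psi z) *
      (g (psi z) * k (psi z)) * (hplus z / hplus z))^*).
    by congr (_ * _^*); ring.
  rewrite mulfV// mulr1 gkE -/(p (psi z)) !conjcM !conjCKc.
  transitivity ((sval z * (sval z)^*) * (sval (psi z) * (sval (psi z))^*) * (h z * p (psi z))).
    by rewrite /p !conjcM; ring.
  by rewrite !circleJ !mul1r.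
have bP : borel (fun z => (sval z)^* *
    ((h z)^* * ((sval z)^* * sval (psi z) * g (psi z)) * hplus z *
     ((hplus z)^-1 * k (psi z)))^*).
  apply: borelM; first exact/borelJ/borel_sval.
  by apply/borelJ/borelM => //; exact: Linf_borel.
apply: cyclic_maximal => //.
(* [k] vanishes almost nowhere, and preimages of null sets under [psi] are null. *)
- move=> k'0; apply: aeT_False.
  have kn0 := aeT_comp hpsi psi_nc (an_neq0_ae hk2 k0).
  apply: (aeT_and (aeT_and k'0 hp0 (fun z => @conj _ _)) kn0) => z [/eqP + hz].
  by rewrite mulf_eq0 invr_eq0 (negbTE hz) => /eqP.
- exact: an_eqT PE.
- have := cyclic_eqT _ _ PE cP; apply=> //.
  exact/L2_borel/an_L2.
Qed.

End Multipliers.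

Theorem proposition4p5 (R : realType) (g k : circle R -> R[i])
    (hg : Linf g) (g_neq0 : ~ eqT g (fun=> 0)) (hk : maximal_vector g k)
    (psi : circle R -> circle R) (hpsi : inner_function psi)
    (psi_nonconst : nonconstant psi)
    (hplus hminus : circle R -> R[i])
    (hplusP : invertible_in Hinf hplus)
    (hminusP : invertible_in (conj_set Hinf) hminus) :
  let G := fun z : circle R =>
    (sval z)^* * sval (psi z) * hminus z * g (psi z) * hplus z in
  let k' := fun z : circle R => (hplus z)^-1 * k (psi z) in
  maximal_vector G k' /\
  ker_toeplitz G =
    mul_set (fun z : circle R => (hplus z)^-1)
      (ker_toeplitz (fun z : circle R => (sval z)^* * sval (psi z) * g (psi z))).
Proof.
move=> G k'.
have GE : G = fun z => hminus z * ((sval z)^* * sval (psi z) * g (psi z)) * hplus z.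
  by apply/funext => z; rewrite /G; ring.
have bG : Linf (fun z => (sval z)^* * sval (psi z) * g (psi z)).
  apply: LinfM; last exact: Linf_comp.
  by apply: LinfM; [exact/LinfJ/Linf_sval|exact: Linf_psi].
by rewrite GE; split; [exact: maximal_vector_comp|exact: ker_toeplitz_mul].
Qed.
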